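(* Consider Problem B and its pseudospectral discretization Problem $B^N$ (both defined in the context). Suppose Problem B has an optimal solution $(x^\ast(t),u^\ast(t))$ in which the $m$-th order derivative $(x_r^\ast(t))^{(m)}$ of the $r$-th state component has bounded variation for some integer $m\ge 3$. In Problem $B^N$ select an integer $m_1$ and a real number $\alpha$ so that $1\le m_1\le m-1$ and $0<\alpha<m_1-1$. Suppose $f(\cdot)$, $g(\cdot)$, $F(\cdot)$ and $E(x_0,\cdot)$ are $C^m$ and globally Lipschitz. Suppose all other bounds in Problem $B^N$ (namely $\underline{b},\bar b,\underline{b}_j,\bar b_j,d$) are large enough in the sense of the context. Let $\{(\bar x^{\ast N},\bar u^{\ast N})\}_{N\ge N_1}$, with $N_1>r+m_1+1$, be any sequence in which $(\bar x^{\ast N},\bar u^{\ast N})$ is an optimal solution of Problem $B^N$, and let $(x^{\ast N}(t),u^{\ast N}(t))$ be its interpolation as defined in the context. Then there are constants $M_1,M_2$ independent of $N$ such that for all $N\ge N_1$ $$\left|J(x^\ast(\cdot),u^\ast(\cdot))-J(x^{\ast N}(\cdot),u^{\ast N}(\cdot))\right|\le \frac{M_1}{(N-r-m_1-1)^{2m-2m_1-1}}+\frac{M_2}{N^\alpha},$$ $$\left|J(x^\ast(\cdot),u^\ast(\cdot))-\bar J^N(\bar x^{\ast N},\bar u^{\ast N})\right|\le \frac{M_1}{(N-r-m_1-1)^{2m-2m_1-1}}+\frac{M_2}{N^\alpha}.$$ Moreover, $x^{\ast N}(t)$ is the trajectory of the control system of Problem B under the control input $u^{\ast N}(t)$.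
   Context: Derivatives are weak derivatives unless ''strong'' is specified. **Problem B.** Determine the state-control function pair $(x(t),u(t))$, $x\in\mathbb{R}^r$, $u\in\mathbb{R}$, $t\in[-1,1]$, minimizing $$J(x(\cdot),u(\cdot))=\int_{-1}^1F(x(t),u(t))\,dt+E(x(-1),x(1))$$ subject to $\dot x_1=x_2,\ \dots,\ \dot x_{r-1}=x_r,\ \dot x_r=f(x)+g(x)u$, and $x(-1)=x_0$. Here $F:\mathbb{R}^r\times\mathbb{R}\to\mathbb{R}$, $E:\mathbb{R}^r\times\mathbb{R}^r\to\mathbb{R}$, $f,g:\mathbb{R}^r\to\mathbb{R}$ are Lipschitz continuous in their arguments and $g(x)\ne0$ for all $x$. **LGL nodes, weights, differentiation matrix.** $L_N$ is the Legendre polynomial of degree $N$. The nodes are $t_0=-1$, $t_N=1$, and $t_1<\dots<t_{N-1}$ the roots of $\dot L_N$. The weights are $w_k=\frac{2}{N(N+1)}\frac{1}{L_N(t_k)^2}$. $D$ is the $(N+1)\times(N+1)$ matrix with entries $D_{ik}=\frac{L_N(t_i)}{L_N(t_k)}\frac{1}{t_i-t_k}$ for $i\neq k$, $D_{00}=-\frac{N(N+1)}4$, $D_{NN}=\frac{N(N+1)}4$, and $0$ otherwise; it maps the nodal values of a polynomial of degree $\le N$ to the nodal values of its derivative. **Discrete variables and interpolation.** $\bar x^{Nk}=(\bar x_1^{Nk},\dots,\bar x_r^{Nk})^T\in\mathbb{R}^r$, $\bar u^{Nk}\in\mathbb{R}$, $k=0,\dots,N$; $\bar x_i^N=[\bar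 x_i^{N0}\ \cdots\ \bar x_i^{NN}]$ (row vector). The interpolation of $(\bar x^N,\bar u^N)$ is the pair $(x^N(t),u^N(t))$ where $x_i^N(t)$ is the polynomial of degree $\le N$ with $x_i^N(t_k)=\bar x_i^{Nk}$ for all $k$, and $u^N(t)=\frac{\dot x_r^N(t)-f(x^N(t))}{g(x^N(t))}$. **Spectral coefficients.** For an integer $m_1\ge1$ and $0\le n\le N-r-m_1+1$, $$a_n^N(m_1)=\left(n+\tfrac12\right)\sum_{k=0}^N L_n(t_k)\,w_k\,\left(D^{m_1}(\bar x_r^N)^T\right)_k .$$ These are the Legendre coefficients of the polynomial interpolating $\bar x_r^N(D^T)^{m_1}$ (entries of vectors indexed $0,\dots,N$). **Problem $B^N$.** Find $\bar x^{Nk}\in\mathbb{R}^r$, $\bar u^{Nk}\in\mathbb{R}$, $k=0,\dots,N$, minimizing $$\bar J^N(\bar x^N,\bar u^N)=\sum_{k=0}^NF(\bar x^{Nk},\bar u^{Nk})w_k+E(\bar x^{N0},\bar x^{NN})$$ subject to: (1) $D(\bar x_i^N)^T=(\bar x_{i+1}^N)^T$ for $1\le i\le r-1$, and $(D(\bar x_r^N)^T)_k=f(\bar x^{Nk})+g(\bar x^{Nk})\bar u^{Nk}$ for $0\le k\le N$; (2) $\bar x^{N0}=x_0$; (3) $\underline b\le(\bar x^{Nk},\bar u^{Nk})\le\bar b$ componentwise for $0\le k\le N$; (4) if $m_1\ge2$: $\underline b_j\le[1\ 0\ \cdots\ 0]D^j(\bar x_r^N)^T\le\bar b_j$ for $1\le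 j\le m_1-1$; (5) $\sum_{n=0}^{N-r-m_1+1}|a_n^N(m_1)|\le d$. Here $\underline b,\bar b\in\mathbb{R}^{r+1}$ and $\underline b_j,\bar b_j,d\in\mathbb{R}$ are fixed, independent of $N$. **''Bounds large enough''.** There are thresholds, depending on Problem B, $(x^\ast,u^\ast)$, $m$ and $m_1$ but not on $N$, such that the assertion holds whenever $\bar b,\bar b_j,d$ lie (componentwise) above and $\underline b,\underline b_j$ below the corresponding thresholds. In particular, the optimal trajectory $(x^\ast(t),u^\ast(t))$ lies in the interior of the box $[\underline b,\bar b]$, $(x_r^\ast(t))^{(j)}$ lies in the interior of $[\underline b_j,\bar b_j]$, and $d>\frac6{\sqrt\pi}\left(U((x_r^\ast)^{(m_1+1)})+V((x_r^\ast)^{(m_1+1)})\right)\zeta(3/2)$, where $U(h)$ is an upper bound of $|h|$, $V(h)$ the total variation of $h$ on $[-1,1]$, and $\zeta(s)=\sum_{k\ge1}k^{-s}$. *)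

(* Defs.v *)
From HB Require Import structures.
From mathcomp Require Import all_boot all_order all_algebra.
From mathcomp Require Import polyrcf.
From mathcomp Require Import all_classical all_reals all_analysis.

Set Implicit Arguments.
Unset Strict Implicit.
Unset Printing Implicit Defensive.

Import Order.TTheory GRing.Theory Num.Theory.
Import numFieldNormedType.Exports.

Local Open Scope classical_set_scope.
Local Open Scope ring_scope.

Section Calculus.
Variable R : realType.

(* All partial derivatives of order at most k exist everywhere and are
   continuous. *)
Fixpoint Ck (k n : nat) (f : 'cV[R]_n.+1 -> R) : Prop :=
  continuous f /\
  if k is k'.+1 then
    forall i : 'I_n.+1,
      (forall x, derivable f x (delta_mx i 0)) /\
      Ck k' (fun x => 'D_(delta_mx i 0) f x)
  else True.

(* Smooth functions with compact support in the open interval ]-1, 1[. *)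
Definition test_function (phi : R -> R) : Prop :=
  (forall k t, derivable (derive1n k phi) t 1) /\
  exists a b : R, [/\ -1 < a, b < 1 &
    forall t, t \notin `[a, b] -> phi t = 0].

Definition integrable_I (h : R -> R) : Prop :=
  (@lebesgue_measure R).-integrable `[-1, 1] (EFin \o h).

(* [h'] is a weak derivative of order [k] of [h] on ]-1, 1[. *)
Definition weak_deriv (k : nat) (h h' : R -> R) : Prop :=
  [/\ integrable_I h, integrable_I h' &
    forall phi, test_function phi ->
      \int[@lebesgue_measure R]_(t in `[-1, 1]) (h t * derive1n k phi t) =
      (-1) ^+ k * \int[@lebesgue_measure R]_(t in `[-1, 1]) (h' t * phi t)].

Definition zeta (s : R) : R :=
  limn (series (fun k : nat => k.+1%:R `^ (- s))).

(* Rodrigues' formula. *)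
Definition legendre (n : nat) : {poly R} :=
  (2 ^+ n * n`!%:R)^-1 *: (('X^2 - 1) ^+ n)^`(n).

(* Legendre-Gauss-Lobatto nodes; [rootsR] lists the real roots of a nonzero
   polynomial in increasing order, and the derivative of [legendre N] has
   exactly N - 1 of them, all in ]-1, 1[. *)
Definition lgl_node (N : nat) (k : 'I_N.+1) : R :=
  nth 0 (-1 :: rcons (rootsR (legendre N)^`()) 1) k.

Definition lgl_weight (N : nat) (k : 'I_N.+1) : R :=
  2 / (N * N.+1)%:R / (legendre N).[lgl_node k] ^+ 2.

Definition lgl_D (N : nat) : 'M[R]_N.+1 :=
  \matrix_(i, k)
    if i != k then
      (legendre N).[lgl_node i] / (legendre N).[lgl_node k]
        / (lgl_node i - lgl_node k)
    else if i == ord0 then - ((N * N.+1)%:R / 4)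
    else if i == ord_max then (N * N.+1)%:R / 4
    else 0.

End Calculus.

Section OptimalControl.
Variables (R : realType) (r' : nat).
Local Notation r := r'.+1.

(* The point (x, u) of R^r x R = R^(r + 1). *)
Definition xu (x : 'cV[R]_r) (u : R) : 'cV[R]_(r + 1) := col_mx x u%:M.

Record problemB := ProblemB {
  F : 'cV[R]_(r + 1) -> R;
  E : 'cV[R]_r -> 'cV[R]_r -> R;
  f : 'cV[R]_r -> R;
  g : 'cV[R]_r -> R;
  x0 : 'cV[R]_r;
  F_lipschitz : lipschitz F;
  E_lipschitz : lipschitz (fun p : 'cV[R]_r * 'cV[R]_r => E p.1 p.2);
  f_lipschitz : lipschitz f;
  g_lipschitz : lipschitz g;
  g_neq0 : forall x, g x != 0 }.

Variable B : problemB.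

Definition J (x : R -> 'cV[R]_r) (u : R -> R) : R :=
  \int[@lebesgue_measure R]_(t in `[-1, 1]) F B (xu (x t) (u t))
  + E B (x (-1)) (x 1).

(* The state is the continuous representative of a function in W^{1,1}; since
   g has no zero, the control is then automatically integrable. *)
Definition trajectory (x : R -> 'cV[R]_r) (u : R -> R) : Prop :=
  [/\ {within `[-1, 1], continuous x},
      measurable_fun (`[-1, 1] : set R) u,
      forall i j : 'I_r, j = i.+1 :> nat ->
        weak_deriv 1 (fun t => x t i 0) (fun t => x t j 0),
      weak_deriv 1 (fun t => x t ord_max 0)
        (fun t => f B (x t) + g B (x t) * u t) &
      x (-1) = x0 B].

Definition optimalB (x : R -> 'cV[R]_r) (u : R -> R) : Prop :=
  trajectory x u /\ forall y v, trajectory y v -> J x u <= J y v.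

Record bounds := Bounds {
  blo : 'cV[R]_(r + 1);
  bhi : 'cV[R]_(r + 1);
  bjlo : nat -> R;
  bjhi : nat -> R;
  bd : R }.

(* The bounds [b] lie beyond the thresholds [b0]; only the indices
   1 <= j <= m1 - 1 of the sequences [bjlo] and [bjhi] are relevant. *)
Definition beyond (m1 : nat) (b0 b : bounds) : Prop :=
  [/\ forall i, blo b i 0 < blo b0 i 0,
      forall i, bhi b0 i 0 < bhi b i 0,
      forall j, (1 <= j <= m1.-1)%N -> bjlo b j < bjlo b0 j,
      forall j, (1 <= j <= m1.-1)%N -> bjhi b0 j < bjhi b j &
      bd b0 < bd b].

(* Weak derivatives are only determined almost everywhere: those of order at
   most m1 - 1 are taken continuous, and the one of order m1 + 1 is taken of
   bounded variation. *)
Definition contains_optimal (m1 : nat) (x : R -> 'cV[R]_r) (u : R -> R)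
    (b : bounds) : Prop :=
  [/\ forall t (i : 'I_r), t \in `[-1, 1] ->
        blo b (lshift 1 i) 0 < x t i 0 < bhi b (lshift 1 i) 0,
      {ae @lebesgue_measure R, forall t, t \in `[-1, 1] ->
        blo b (rshift r ord0) 0 < u t < bhi b (rshift r ord0) 0},
      forall j, (1 <= j <= m1.-1)%N -> exists h : R -> R,
        [/\ weak_deriv j (fun t => x t ord_max 0) h,
            {within `[-1, 1], continuous h} &
            forall t, t \in `[-1, 1] -> bjlo b j < h t < bjhi b j] &
      exists (h : R -> R) (U : R),
        [/\ weak_deriv m1.+1 (fun t => x t ord_max 0) h,
            bounded_variation (-1) 1 h,
            forall t, t \in `[-1, 1] -> `|h t| <= U &
            6 / Num.sqrt pi * (U + fine (total_variation (-1) 1 h))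
              * zeta (3 / 2) < bd b]].

Section Discretization.
Variable N : nat.
Local Notation D := (lgl_D R N).

(* A discrete state has the nodal values of the i-th state component in its
   i-th row, and the state at the k-th node in its k-th column. *)
Implicit Types (x : 'M[R]_(r, N.+1)) (u : 'rV[R]_N.+1).

(* Meant for r + m1 <= N + 1. *)
Definition spectral_coef (m1 : nat) x (n : nat) : R :=
  (n%:R + 1 / 2) * \sum_(k < N.+1)
    (legendre R n).[lgl_node R k] * lgl_weight R k
    * (D ^+ m1 *m (row ord_max x)^T) k 0.

Definition Jbar x u : R :=
  \sum_(k < N.+1) F B (xu (col k x) (u 0 k)) * lgl_weight R k
  + E B (col ord0 x) (col ord_max x).

Definition feasibleBN (m1 : nat) (b : bounds) x u : Prop :=
  [/\ (forall i j : 'I_r, j = i.+1 :> nat ->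
         D *m (row i x)^T = (row j x)^T) /\
      (forall k : 'I_N.+1, (D *m (row ord_max x)^T) k 0 =
         f B (col k x) + g B (col k x) * u 0 k),
      col ord0 x = x0 B,
      forall (k : 'I_N.+1) i,
        blo b i 0 <= xu (col k x) (u 0 k) i 0 <= bhi b i 0,
      forall j, (1 <= j <= m1.-1)%N ->
        bjlo b j <= (D ^+ j *m (row ord_max x)^T) ord0 0 <= bjhi b j &
      (* 0 <= n <= N - r - m1 + 1 *)
      \sum_(n < N.+2 - r - m1) `|spectral_coef m1 x n| <= bd b].

Definition optimalBN (m1 : nat) (b : bounds) x u : Prop :=
  feasibleBN m1 b x u /\
  forall y v, feasibleBN m1 b y v -> Jbar x u <= Jbar y v.

Definition interpolates x (p : 'I_r -> {poly R}) : Prop :=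
  forall i, (size (p i) <= N.+1)%N /\
    forall k : 'I_N.+1, (p i).[lgl_node R k] = x i k.

End Discretization.

Definition interp_state (p : 'I_r -> {poly R}) (t : R) : 'cV[R]_r :=
  \col_i (p i).[t].

Definition interp_control (p : 'I_r -> {poly R}) (t : R) : R :=
  ((p ord_max)^`().[t] - f B (interp_state p t)) / g B (interp_state p t).

End OptimalControl.

(* Main.v *)
Require Import Defs.
From HB Require Import structures.
From mathcomp Require Import all_boot all_order all_algebra.
From mathcomp Require Import polyrcf.
From mathcomp Require Import all_classical all_reals all_analysis.
From mathcomp Require Import measurable_realfun.
From mathcomp Require Import ring lra zify.

(** Write k = m1 - 1, so that alpha < k, J for the continuous cost, Jbar for
    the discrete one, and B^N for the discrete problem.  All errors are
    O(N^-k).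

    An optimal point of B^N interpolates to polynomials satisfying the control
    system exactly: both sides of each equation D x_i = x_(i+1) are nodal
    values of polynomials of degree at most N, and the interpolated control is
    defined by the last equation.  They form an admissible trajectory, whence
    J(optimum) <= J(interpolation).  The other end of the comparison is an
    explicit competitor, the _approximant_: expand the derivative of order m1
    of the last state component in Legendre polynomials, truncate, and
    integrate back with the true initial values.  The chain is

      J(optimum) <= J(interpolation) <= Jbar(discrete optimum) + O(N^-k)
                 <= Jbar(approximant) + O(N^-k) <= J(approximant) + O(N^-k)
                 <= J(optimum) + O(N^-k),

    and it also traps Jbar(discrete optimum).  Its ingredients are as follows.

    Quadrature.  The constraints of B^N bound the interpolating polynomials
    independently of N: the sum of the spectral coefficients bounds the
    derivative of order m1 on [-1, 1] because |L_n| <= 1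
    ([poly_top_bound]), and the constraints at -1 together with the initial
    state give the lower orders by integration ([poly_last_bounded],
    [poly_all_bounded]).  Hence the running cost along them is C^k with bounds
    uniform over all feasible points ([unif_smooth_cost]); Jackson's theorem
    ([jackson]) and the exactness of the Lobatto rule in degree 2N - 1
    ([quad_exact]) give the error N^-k ([quadrature_error]).

    Feasibility of the approximant.  The spectral coefficients of its nodal
    values are the Legendre coefficients of the derivative of order m1 of the
    true last component.  One more derivative of that function has bounded
    variation, so they decay like n^(-3/2) ([fun_lcoef_bound]) and are summable
    ([fun_lcoef_summable]); beyond suitable thresholds every constraint holds
    ([approximant_feasible]).

    Cost of the approximant.  A k-fold primitive of L_n vanishing at -1 is
    O(n^-k), so integrating the tail of the series k times produces the rate
    N^-k for the states and for the derivative of the last one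
    ([lift_part_error], [approximant_error]); the Lipschitz conditions carry
    it over to the cost ([approximant_cost]).

    The optimal trajectory is only given through weak derivatives.  The lemma
    of du Bois-Reymond ([du_bois_reymond], tested against explicit smooth
    bumps) turns them into a sequence of functions each of which is a primitive
    of the next ([chain], [trajectory_chain]), and the optimal control agrees
    almost everywhere with a continuous function ([smooth_control_ae]). *)

Set Implicit Arguments.
Unset Strict Implicit.
Unset Printing Implicit Defensive.

Import Order.TTheory GRing.Theory Num.Theory.
Import numFieldNormedType.Exports.

Local Open Scope classical_set_scope.
Local Open Scope ring_scope.

(** * Antiderivatives and integrals of polynomials *)

Lemma horner1p (R : realType) (x : R) : (1 : {poly R}).[x] = 1.
Proof. by rewrite -polyC1 hornerC. Qed.

Lemma deriv1p (R : realType) : (1 : {poly R})^`() = 0.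
Proof. by rewrite -polyC1 derivC. Qed.

Definition horner_rules := (hornerXn, horner_exp, hornerX, hornerD, hornerN, hornerM, hornerMn, horner1p, hornerC).
Definition deriv_rules := (derivD, derivN, derivZ, derivM, derivXn, deriv_exp, deriv1p, derivX, derivC).

Section PolynomialIntegral.
Variable R : realType.
Implicit Types p q : {poly R}.

(** The antiderivative of p vanishing at -1: with it, integrals of polynomials
    over [-1, 1] are evaluations and no measure theory is involved. *)
Definition primp p : {poly R} :=
  let q := \poly_(i < (size p).+1) (p`_i.-1 / i%:R) in q - q.[-1]%:P.

Lemma deriv_primp p : (primp p)^`() = p.
Proof.
rewrite /primp derivB derivC subr0; apply/polyP => i.
rewrite coef_deriv coef_poly ltnS /=; case: ltnP => ip.
  by rewrite -[LHS]mulr_natr divfK// pnatr_eq0.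
by rewrite mul0rn nth_default.
Qed.

Lemma primpN1 p : (primp p).[-1] = 0.
Proof. by rewrite /primp hornerD hornerN hornerC subrr. Qed.

Lemma size_primp p : (size (primp p) <= (size p).+1)%N.
Proof.
rewrite /primp; apply: (leq_trans (size_polyD _ _)); rewrite geq_max.
by rewrite size_poly size_polyN (leq_trans (size_polyC_leq1 _)).
Qed.

Lemma deriv_eq0 p : p^`() = 0 -> p = (p`_0)%:P.
Proof.
move=> p0; apply/polyP => -[|i]; rewrite coefC//=.
have /polyP/(_ i) := p0; rewrite coef_deriv coef0 => /eqP.
by rewrite mulrn_eq0/= => /eqP.
Qed.

Lemma primp_deriv p : primp p^`() = p - p.[-1]%:P.
Proof.
have /deriv_eq0 h : (primp p^`() - p)^`() = 0 by rewrite derivB deriv_primp subrr.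
have := congr1 (fun q : {poly R} => q.[-1]) h.
rewrite hornerC hornerD hornerN primpN1 sub0r => h1.
by apply/eqP; rewrite -subr_eq0 opprB addrA addrAC h -h1 -polyCD addNr.
Qed.

Lemma primp_eq p q : q^`() = p -> q.[-1] = 0 -> primp p = q.
Proof. by move=> <- q0; rewrite primp_deriv q0 subr0. Qed.

Lemma primpD p q : primp (p + q) = primp p + primp q.
Proof.
apply: primp_eq; first by rewrite derivD !deriv_primp.
by rewrite hornerD !primpN1 addr0.
Qed.

Lemma primpZ c p : primp (c *: p) = c *: primp p.
Proof. apply: primp_eq; first by rewrite derivZ deriv_primp.
by rewrite hornerZ primpN1 mulr0. Qed.

Lemma primp0 : primp 0 = 0.
Proof. by apply: primp_eq; rewrite ?deriv0 ?horner0. Qed.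

Definition intp p : R := (primp p).[1].

Lemma intpD p q : intp (p + q) = intp p + intp q.
Proof. by rewrite /intp primpD hornerD. Qed.
Lemma intpZ c p : intp (c *: p) = c * intp p.
Proof. by rewrite /intp primpZ hornerZ. Qed.
Lemma intp0 : intp 0 = 0.
Proof. by rewrite /intp primp0 horner0. Qed.
Lemma intpN p : intp (- p) = - intp p.
Proof. by rewrite -scaleN1r intpZ mulN1r. Qed.
Lemma intpB p q : intp (p - q) = intp p - intp q.
Proof. by rewrite intpD intpN. Qed.
Lemma intp_sum I (r : seq I) (P : pred I) (F : I -> {poly R}) :
  intp (\sum_(i <- r | P i) F i) = \sum_(i <- r | P i) intp (F i).
Proof.
by elim/big_rec2: _ => [|i x y _ <-]; rewrite ?intp0// intpD.
Qed.
Lemma intp_deriv p : intp p^`() = p.[1] - p.[-1].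
Proof. by rewrite /intp primp_deriv hornerD hornerN hornerC. Qed.

Lemma intp_by_parts p q :
  intp (p^`() * q) = (p * q).[1] - (p * q).[-1] - intp (p * q^`()).
Proof. by rewrite -intp_deriv derivM intpD addrK. Qed.

End PolynomialIntegral.

(** * Legendre polynomials: differential equation, recurrences, orthogonality *)

Section Legendre.
Variable R : realType.
Implicit Types p q : {poly R}.
Local Notation L := (legendre R).

Let u n : {poly R} := ('X^2 - 1) ^+ n.

Let u_deriv n : ('X^2 - 1) * (u n)^`() = (2 * n%:R) *: ('X * u n).
Proof.
rewrite /u deriv_exp derivB derivXn -polyC1 derivC subr0.
case: n => [|n]; first by rewrite mulr0n mulr0 mulr0 scale0r.
rewrite /= -mul_polyC polyCM !polyC_natr polyC1 expr1.
by move: ('X^2 - 1) => q; rewrite (exprS q n); ring.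
Qed.

(** u = (X^2 - 1)^n solves (X^2 - 1) u' = 2 n X u; differentiating this k + 1
    times gives all the relations between consecutive derivatives of u.  When
    k + 1 is equal to n the middle term vanishes, which is Legendre's
    equation. *)
Let u_derivn n k : ('X^2 - 1) * (u n)^`(k.+2) =
  (2 * (n%:R - k.+1%:R)) *: ('X * (u n)^`(k.+1)) +
  (2 * n%:R * k.+1%:R - k.+1%:R * k%:R) *: (u n)^`(k).
Proof.
elim: k => [|k IH].
  have := congr1 deriv (u_deriv n).
  rewrite derivM derivB derivXn -polyC1 derivC subr0 derivZ derivM derivX.
  rewrite !derivnS derivn0 -!mul_polyC !(polyCM, polyCB, polyCD, polyC_natr) => h.
  have -> : ('X^2 - 1) * (u n)^`()^`() =
    ('X^1 *+ 2 * (u n)^`() + ('X^2 - 1) * (u n)^`()^`()) - 'X^1 *+ 2 * (u n)^`().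
    by rewrite [RHS]addrC addKr.
  rewrite h expr1; ring.
have := congr1 deriv IH.
rewrite derivM derivB derivXn -polyC1 derivC subr0 derivD !derivZ derivM derivX.
rewrite -!derivnS -!mul_polyC !(polyCM, polyCB, polyCD, polyC_natr) polyC1 => h.
have -> : ('X^2 - 1) * (u n)^`(k.+3) =
  ('X^1 *+ 2 * (u n)^`(k.+2) + ('X^2 - 1) * (u n)^`(k.+3)) - 'X^1 *+ 2 * (u n)^`(k.+2).
  by rewrite [RHS]addrC addKr.
rewrite h expr1; ring.
Qed.

Let c n : R := (2 ^+ n * n`!%:R)^-1.
Let c_neq0 n : 2 ^+ n * n`!%:R != 0 :> R.
Proof. by rewrite mulf_neq0 ?expf_neq0 ?pnatr_eq0// -lt0n fact_gt0. Qed.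

Lemma legendre0 : L 0 = 1.
Proof. by rewrite /legendre derivn0 expr0 mul1r fact0 invr1 scale1r. Qed.

Lemma size_legendre n : size (L n) = n.+1.
Proof.
rewrite /legendre size_scale ?invr_neq0//.
have s : size (u n) = (2 * n).+1.
  have s2 : size ('X^2 - 1 : {poly R}) = 3 by rewrite -polyC1 size_XnsubC.
  have := size_exp ('X^2 - 1 : {poly R}) n; rewrite s2 -/(u n) => <-.
  by rewrite prednK// lt0n size_poly_eq0 expf_neq0// -size_poly_eq0 s2.
apply/eqP; rewrite eqn_leq; apply/andP; split.
  apply/leq_sizeP => j nj; rewrite coef_derivn -/(u n) nth_default ?mul0rn//.
  by rewrite s mul2n -addnn -addnS leq_add2l.
rewrite ltnNge; apply/negP => /leq_sizeP /(_ n (leqnn _)).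
rewrite coef_derivn -/(u n) => /eqP.
rewrite mulrn_eq0 eqn0Ngt ffact_gt0 leq_addr /= addnn -mul2n.
have -> : (2 * n)%N = (size (u n)).-1 by rewrite s.
by rewrite -lead_coefE lead_coef_eq0 -size_poly_eq0 s.
Qed.

Lemma legendre_neq0 n : L n != 0.
Proof. by rewrite -size_poly_eq0 size_legendre. Qed.

Lemma legendre_ode n :
  (('X^2 - 1) * (L n)^`())^`() = (n * n.+1)%:R *: L n.
Proof.
case: n => [|n]; first by rewrite legendre0 -polyC1 derivC mulr0 derivC mul0n scale0r.
have h : ('X^2 - 1) * (u n.+1)^`(n.+2) = (n.+1 * n.+2)%:R *: (u n.+1)^`(n).
  rewrite u_derivn subrr mulr0 scale0r add0r; congr (_ *: _).
  rewrite natrM; ring.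
rewrite /legendre derivZ -scalerAr -derivnS -/(u n.+1) h !derivZ -derivnS.
by rewrite !scalerA mulrC.
Qed.

(** Leibniz at a root of order n: only the term differentiating all n factors
    survives. *)
Lemma derivn_root (a : R) n (g : {poly R}) :
  ((('X - a%:P) ^+ n * g)^`(n)).[a] = n`!%:R * g.[a].
Proof.
elim: n g => [|n IH] g; first by rewrite derivn0 mul1r fact0 mul1r.
rewrite derivSn derivM deriv_exp derivXsubC mul1r /=.
have -> : ('X - a%:P) ^+ n *+ n.+1 * g + ('X - a%:P) ^+ n.+1 * g^`() =
   ('X - a%:P) ^+ n * (n.+1%:R * g + ('X - a%:P) * g^`()).
  rewrite exprS -(mulr_natl _ n.+1); ring.
rewrite IH -polyC_natr !horner_rules subrr mul0r addr0 mulrA -natrM mulnC.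
by rewrite -factS.
Qed.

Lemma derivn_root_lt (a : R) n k (g : {poly R}) : (k < n)%N ->
  ((('X - a%:P) ^+ n * g)^`(k)).[a] = 0.
Proof.
move=> kn; rewrite -(subnKC (ltnW kn)) exprD -mulrA derivn_root.
rewrite hornerM !horner_rules subrr expr0n subn_eq0 leqNgt kn/=.
by rewrite mul0r mulr0.
Qed.

Let uE n : u n = ('X - 1%:P) ^+ n * ('X - (-1)%:P) ^+ n.
Proof.
by rewrite /u -exprMn; congr (_ ^+ n); rewrite polyCN opprK polyC1; ring.
Qed.

Let uE' n : u n = ('X - (-1)%:P) ^+ n * ('X - 1%:P) ^+ n.
Proof. by rewrite uE mulrC. Qed.

Lemma legendre1 n : (L n).[1] = 1.
Proof.
rewrite /legendre hornerZ -/(u n) uE derivn_root !horner_rules opprK.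
by rewrite mulrC (mulrC n`!%:R) divff.
Qed.

Lemma legendreN1 n : (L n).[-1] = (-1) ^+ n.
Proof.
rewrite /legendre hornerZ -/(u n) uE' derivn_root !horner_rules.
have -> : -1 - 1 = (-1) * 2 :> R by ring.
rewrite exprMn (mulrC n`!%:R) -mulrA mulrCA mulVf// mulr1//.
Qed.

Let u_end n k : (k < n)%N -> ((u n)^`(k)).[1] = 0 /\ ((u n)^`(k)).[-1] = 0.
Proof.
by move=> kn; split; [rewrite uE|rewrite uE']; rewrite derivn_root_lt.
Qed.

Lemma derivnMX k p : ('X * p)^`(k) = 'X * p^`(k) + k%:R *: p^`(k.-1).
Proof.
elim: k => [|k IH]; first by rewrite !derivn0 scale0r addr0.
rewrite derivnS IH derivD derivM derivX mul1r derivZ -!derivnS.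
case: k IH => [|k] IH /=.
  by rewrite scale0r addr0 scale1r addrC.
rewrite -!mul_polyC !polyC_natr; ring.
Qed.

Let cS n : 2 * n.+1%:R * c n.+1 = c n.
Proof.
have h := c_neq0 n.+1; have h' := c_neq0 n.
move: h h'; rewrite /c factS natrM exprS => h h'.
field; apply/and3P; split.
- by move: h'; rewrite mulf_eq0 negb_or => /andP[].
- by rewrite expf_neq0 ?pnatr_eq0.
- by rewrite nat1r pnatr_eq0.
Qed.

Lemma legendre_derivS n : (L n.+1)^`() = 'X * (L n)^`() + n.+1%:R *: L n.
Proof.
rewrite /legendre !derivZ -derivnS derivSn -/(u n) -/(u n.+1) -/(c n) -/(c n.+1).
have -> : (u n.+1)^`() = (2 * n.+1%:R) *: ('X * u n).
  rewrite /u deriv_exp derivB derivXn -polyC1 derivC subr0 /=.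
  by rewrite -mul_polyC polyCM !polyC_natr expr1; ring.
rewrite derivnZ scalerA mulrC cS derivnMX /=.
by rewrite scalerDr -scalerAr !scalerA (mulrC (c n)).
Qed.

Lemma legendre_rec n :
  (L n.+2)^`() - (L n)^`() = (2 * n.+1%:R + 1) *: L n.+1.
Proof.
rewrite /legendre !derivZ -!derivnS -/(u n) -/(u n.+1) -/(u n.+2).
rewrite -/(c n) -/(c n.+1) -/(c n.+2).
have -> : (u n.+2)^`(n.+3) = ((u n.+2)^`(2))^`(n.+1).
  by rewrite /derivn -iterD addn2.
have -> : (u n.+2)^`(2) = (2 * n.+2%:R) *: ((2 * n.+1%:R + 1) *: u n.+1 +
    (2 * n.+1%:R) *: u n).
  have e1 : (u n.+2)^`() = (2 * n.+2%:R) *: ('X * u n.+1).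
    rewrite /u deriv_exp derivB derivXn -polyC1 derivC subr0 /=.
    by rewrite -mul_polyC polyCM !polyC_natr expr1; ring.
  rewrite derivnS derivn1 e1 derivZ derivM derivX mul1r; congr (_ *: _).
  rewrite /u deriv_exp derivB derivXn -polyC1 derivC subr0 /=.
  rewrite -!mul_polyC !(polyCM, polyCD) !polyC_natr !polyC1 exprS; ring.
rewrite derivnZ derivnD !derivnZ scalerA (mulrC (c n.+2)) cS.
rewrite scalerDr !scalerA (mulrC (c n.+1)) (mulrC (c n.+1)) cS.
by rewrite addrK mulrC.
Qed.

Lemma legendre_rec1 n : n%:R *: L n.+1 =
  'X * (L n.+1)^`() - (L n)^`() - (L n.+1).
Proof.
have h1 := legendre_rec n; have := legendre_derivS n.+1.
move=> h2; move: h1; rewrite h2 => h1.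
have -> : 'X * (L n.+1)^`() - (L n)^`() = (2 * n.+1%:R + 1) *: L n.+1 - n.+2%:R *: L n.+1.
  by rewrite -h1; ring.
rewrite -scalerBl -[X in _ = _ - X]scale1r -scalerBl; congr (_ *: _).
ring.
Qed.

(** n integrations by parts in Rodrigues' formula; the boundary terms vanish
    as both ends are roots of order n of (X^2 - 1)^n. *)
Lemma legendre_orth n p : (size p <= n)%N -> intp (L n * p) = 0.
Proof.
move=> sp; rewrite /legendre -/(u n) -scalerAl intpZ.
suff h k : (k <= n)%N -> forall p : {poly R}, (size p <= k)%N ->
    intp ((u n)^`(k) * p) = 0 by rewrite h ?mulr0.
elim: k => [|k IH] kn q sq.
  move: sq; rewrite leqn0 size_poly_eq0 => /eqP ->.
  by rewrite mulr0 intp0.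
rewrite derivnS intp_by_parts !hornerM.
have [-> ->] := u_end kn; rewrite !mul0r subrr sub0r IH ?oppr0//; first exact: ltnW.
have [->|q0] := eqVneq q 0; first by rewrite deriv0 size_poly0.
by rewrite -ltnS (leq_trans _ sq)// lt_size_deriv.
Qed.

Lemma size_deriv_le p n : (size p <= n.+1)%N -> (size p^`() <= n)%N.
Proof.
move=> sp; have [->|q0] := eqVneq p 0; first by rewrite deriv0 size_poly0.
by rewrite -ltnS (leq_trans _ sp)// lt_size_deriv.
Qed.

(** Replace (2n + 1) L_n by the derivative of L_(n+1) - L_(n-1) and integrate
    by parts: everything but the boundary term is killed by orthogonality. *)
Lemma legendre_norm2 n : intp (L n * L n) = 2 / (2 * n%:R + 1).
Proof.
have e : (2 * n%:R + 1) *: L n = (L n.+1)^`() - (if n is k.+1 then (L k)^`() else 0).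
  case: n => [|n]; last by rewrite legendre_rec.
  rewrite subr0 legendre_derivS legendre0 -polyC1 derivC mulr0 add0r.
  by rewrite mulr0 add0r.
have n0 : 2 * n%:R + 1 != 0 :> R by rewrite -natrM natr1 pnatr_eq0.
apply: (mulfI n0); rewrite mulrCA divff// mulr1 -intpZ scalerAl e mulrBl intpB.
rewrite intp_by_parts.
rewrite (legendre_orth (n := n.+1)); last first.
  by apply: leq_trans (size_deriv_le (n := n) _) _; rewrite ?size_legendre.
have -> : intp ((if n is k.+1 then (L k)^`() else 0) * L n) = 0.
  case: n {e n0} => [|n]; first by rewrite mul0r intp0.
  rewrite mulrC legendre_orth//.
  by apply: leq_trans (size_deriv_le (n := n) _) _; rewrite ?size_legendre.
rewrite !hornerM !legendre1 !legendreN1 !subr0 mul1r exprS -mulrA -[X in -1 * X]expr2 sqrr_sign; ring.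
Qed.

Lemma legendre_orth_neq n k : n != k -> intp (L n * L k) = 0.
Proof.
by rewrite neq_ltn => /orP[nk|nk]; [rewrite mulrC|]; rewrite legendre_orth// size_legendre.
Qed.

Definition poly_lcoef p n : R := (n%:R + 1 / 2) * intp (p * L n).

Lemma legendre_expansion p M : (size p <= M)%N ->
  p = \sum_(n < M) poly_lcoef p n *: L n.
Proof.
move=> sp.
have [a pE] : exists a : nat -> R, p = \sum_(n < M) a n *: L n.
  elim: M p sp => [|M IH] p sp.
    by exists (fun=> 0); rewrite big_ord0; apply/eqP; rewrite -size_poly_eq0 -leqn0.
  pose b := p`_M / lead_coef (L M).
  have lc0 : lead_coef (L M) != 0 by rewrite lead_coef_eq0 legendre_neq0.
  have [|a aE] := IH (p - b *: L M).
    apply/leq_sizeP => j; rewrite leq_eqVlt => /predU1P[<-|Mj].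
      rewrite coefB coefZ; have -> : (L M)`_M = lead_coef (L M).
        by rewrite lead_coefE size_legendre.
      by rewrite divfK// subrr.
    rewrite coefB coefZ !nth_default ?mulr0 ?subr0 ?size_legendre//.
    exact: leq_trans sp _.
  exists (fun n => if (n < M)%N then a n else b).
  rewrite big_ord_recr /= ltnn; apply/eqP; rewrite -subr_eq aE; apply/eqP.
  by apply: eq_bigr => i _; rewrite ltn_ord.
rewrite {1}pE; apply: eq_bigr => i _; congr (_ *: _).
rewrite /poly_lcoef [in RHS]pE mulr_suml intp_sum (bigD1 i)//= big1 => [|j ji].
  rewrite addr0 -scalerAl intpZ legendre_norm2.
  have n0 : 2 * i%:R + 1 != 0 :> R by rewrite -natrM natr1 pnatr_eq0.
  by field.
by rewrite -scalerAl intpZ legendre_orth_neq ?mulr0.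
Qed.

End Legendre.

(** * Bounds on Legendre polynomials and their primitives *)

Section LegendreBounds.
Variable R : realType.
Implicit Types p q : {poly R}.
Local Notation L := (legendre R).

Lemma sqr_le1 (t : R) : -1 <= t <= 1 -> t ^+ 2 <= 1.
Proof. by move=> /andP[? ?]; nra. Qed.

Lemma n21_neq0 n : 2 * n%:R + 1 != 0 :> R.
Proof. by rewrite lt0r_neq0// ltr_wpDl// mulr_ge0. Qed.

Lemma poly_incr p (a b : R) : a <= b ->
  (forall t, a <= t <= b -> 0 <= p^`().[t]) -> p.[a] <= p.[b].
Proof.
rewrite le_eqVlt => /predU1P[->//|ab] h.
have [c cab /eqP] := poly_mvt p ab; rewrite subr_eq => /eqP ->.
rewrite lerDr mulr_ge0 ?subr_ge0 ?(ltW ab)// h//.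
by move: cab; rewrite in_itv/= => /andP[/ltW -> /ltW ->].
Qed.

Lemma poly_decr p (a b : R) : a <= b ->
  (forall t, a <= t <= b -> p^`().[t] <= 0) -> p.[b] <= p.[a].
Proof.
move=> ab h; rewrite -lerN2 -!hornerN; apply: poly_incr => // t tab.
by rewrite derivN hornerN oppr_ge0 h.
Qed.

Let ode_at n t : (2 * t) * (L n)^`().[t] + (t ^+ 2 - 1) * (L n)^`()^`().[t]
  = (n * n.+1)%:R * (L n).[t].
Proof.
have := congr1 (fun p : {poly R} => p.[t]) (legendre_ode R n).
rewrite !deriv_rules -!mul_polyC !horner_rules ?expr1 => <-; ring.
Qed.

(** Energy method for Legendre's equation: the function S = L^2 + (1 - X^2)
    L'^2 / (n (n + 1)) has the derivative 2 X L'^2 / (n (n + 1)), so on each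
    half of the interval it is at most its value 1 at the end. *)
Lemma legendre_bound n t : -1 <= t <= 1 -> `|(L n).[t]| <= 1.
Proof.
case: n => [|n] t1; first by rewrite legendre0 hornerC normr1.
pose N : R := (n.+1 * n.+2)%:R.
have N0 : 0 < N by rewrite ltr0n.
pose S := L n.+1 ^+ 2 + N^-1 *: ((1 - 'X ^+ 2) * (L n.+1)^`() ^+ 2).
have S' s : S^`().[s] = 2 * s * ((L n.+1)^`().[s] ^+ 2 / N).
  have := ode_at n.+1 s; rewrite -/N => h.
  have -> : S^`().[s] = 2 * (L n.+1).[s] * (L n.+1)^`().[s] + N^-1 * (
     - (2 * s) * (L n.+1)^`().[s] ^+ 2 -
     2 * (L n.+1)^`().[s] * ((s ^+ 2 - 1) * (L n.+1)^`()^`().[s])).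
    rewrite /S !deriv_rules -!mul_polyC !horner_rules /= ?expr1; ring.
  have -> : (s ^+ 2 - 1) * (L n.+1)^`()^`().[s] =
     N * (L n.+1).[s] - (2 * s) * (L n.+1)^`().[s] by rewrite -h; ring.
  by clear S h; move: N N0 => N N0; field; exact: lt0r_neq0.
have Send (e : R) : e ^+ 2 = 1 -> (L n.+1).[e] ^+ 2 = 1 -> S.[e] = 1.
  move=> e1 L1; rewrite /S -!mul_polyC !horner_rules.
  by rewrite e1 L1 subrr mul0r mulr0 addr0.
have SL : (L n.+1).[t] ^+ 2 <= S.[t].
  rewrite /S -!mul_polyC !horner_rules lerDl mulr_ge0 ?invr_ge0 ?(ltW N0)//.
  rewrite mulr_ge0 ?sqr_ge0// subr_ge0 sqr_le1//.
rewrite -(@ler_pXn2r _ 2) ?nnegrE// expr1n real_normK ?num_real//.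
apply: (le_trans SL); case/andP: t1 => t1 t2.
have [t0|t0] := leP 0 t.
  rewrite -(Send 1) ?expr1n// ?legendre1 ?expr1n//.
  apply: poly_incr => // s /andP[ts _]; rewrite S'.
  apply: mulr_ge0; first by apply: mulr_ge0 => //; exact: le_trans ts.
  by apply: divr_ge0; [exact: sqr_ge0|exact: ltW].
rewrite -(Send (-1)) ?sqrrN ?expr1n// ?legendreN1 ?sqrr_sign//.
apply: poly_decr => // s /andP[_ st]; rewrite S'.
by rewrite mulr_le0_ge0 ?divr_ge0 ?sqr_ge0 ?(ltW N0)// mulr_ge0_le0// (le_trans st)// ltW.
Qed.

(** At 0 the recurrence reduces to (n + 2) L_(n+2)(0) = - (n + 1) L_n(0), and
    (n + 3) (n + 1) <= (n + 2)^2. *)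
Lemma legendre_at0 n : n.+1%:R * (L n).[0] ^+ 2 <= 1.
Proof.
suff : n.+1%:R * (L n).[0] ^+ 2 <= 1 /\ n.+2%:R * (L n.+1).[0] ^+ 2 <= 1 by case.
elim: n => [|n [IH1 IH2]].
  split; first by rewrite legendre0 hornerC expr1n mulr1.
  suff -> : (L 1).[0] = 0 by rewrite expr0n mulr0.
  have := congr1 (fun p : {poly R} => p.[0]) (legendre_rec1 R 0).
  rewrite /= scale0r legendre0 deriv1p !horner_rules mul0r subr0 sub0r.
  by move/eqP; rewrite eq_sym oppr_eq0 => /eqP.
split=> //.
have h : n.+2%:R * (L n.+2).[0] = - (n.+1%:R * (L n).[0]).
  have h1 := congr1 (fun p : {poly R} => p.[0]) (legendre_rec1 R n.+1).
  have h2 := congr1 (fun p : {poly R} => p.[0]) (legendre_derivS R n).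
  move: h1 h2; rewrite /= -!mul_polyC !horner_rules !mul0r !add0r => h1 h2.
  rewrite -h2 -(natr1 n.+1) mulrDl mul1r h1; ring.
have n2 : 0 < n.+2%:R :> R by rewrite ltr0n.
have -> : (L n.+2).[0] = - (n.+1%:R * (L n).[0]) / n.+2%:R.
  by rewrite -h mulrC mulKf// lt0r_neq0.
rewrite exprMn sqrrN exprVn mulrA ler_pdivrMr ?exprn_gt0// mul1r.
have -> : n.+3%:R * (n.+1%:R * (L n).[0]) ^+ 2 = (n.+3%:R * n.+1%:R) * (n.+1%:R * (L n).[0] ^+ 2) :> R by ring.
apply: (@le_trans _ _ (n.+3%:R * n.+1%:R)); first by rewrite ler_piMr ?mulr_ge0.
rewrite -natrM -natrX ler_nat; lia.
Qed.

(** A second energy, V = v^2 + n (n + 1) (1 - X^2) L^2 for v = (1 - X^2) L':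
    since v' = - n (n + 1) L, its derivative has the sign of - X, so V is
    largest at 0, where [legendre_at0] applies. *)
Lemma legendre_deriv_bound n t : -1 <= t <= 1 ->
  `|(1 - t ^+ 2) * (L n)^`().[t]| <= Num.sqrt (2 * n%:R).
Proof.
case: n => [|n] t1; first by rewrite legendre0 deriv1p hornerC mulr0 normr0 sqrtr_ge0.
pose N : R := (n.+1 * n.+2)%:R.
have N0 : 0 < N by rewrite ltr0n.
pose v := (1 - 'X ^+ 2) * (L n.+1)^`().
have v' : v^`() = - (N *: L n.+1).
  rewrite -legendre_ode -derivN; congr deriv; rewrite /v; ring.
pose V := v ^+ 2 + N *: ((1 - 'X ^+ 2) * L n.+1 ^+ 2).
have V' s : V^`().[s] = - (2 * s * (N * (L n.+1).[s] ^+ 2)).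
  rewrite /V derivD deriv_exp v' /v !deriv_rules -!mul_polyC !horner_rules /= ?expr1; ring.
have VV : v.[t] ^+ 2 <= V.[t].
  rewrite /V -!mul_polyC !horner_rules lerDl mulr_ge0 ?(ltW N0)//.
  by rewrite mulr_ge0 ?sqr_ge0// subr_ge0 sqr_le1.
have vE : v.[t] = (1 - t ^+ 2) * (L n.+1)^`().[t].
  by rewrite /v !horner_rules.
rewrite -vE -sqrtr_sqr ler_wsqrtr// (le_trans VV)//.
have V0 : V.[0] <= 2 * n.+1%:R.
  have h1 : (L n.+1)^`().[0] = n.+1%:R * (L n).[0].
    by rewrite legendre_derivS -mul_polyC !horner_rules mul0r add0r.
  have -> : V.[0] = n.+1%:R ^+ 2 * (L n).[0] ^+ 2 + N * (L n.+1).[0] ^+ 2.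
    by rewrite /V /v -!mul_polyC !horner_rules h1; ring.
  have := legendre_at0 n; have := legendre_at0 n.+1.
  rewrite /N natrM => a1 a2.
  have n1 : 0 <= n.+1%:R :> R by [].
  have := ler_wpM2l n1 a1; have := ler_wpM2l n1 a2; rewrite !mulr1 => b1 b2.
  have -> : n.+1%:R ^+ 2 * (L n).[0] ^+ 2 + n.+1%:R * n.+2%:R * (L n.+1).[0] ^+ 2 =
   n.+1%:R * (n.+1%:R * (L n).[0] ^+ 2) + n.+1%:R * (n.+2%:R * (L n.+1).[0] ^+ 2) by ring.
  lra.
apply: le_trans V0; case/andP: t1 => t1 t2.
have [t0|t0] := leP 0 t.
  apply: poly_decr => // s /andP[s0 _]; rewrite V' oppr_le0.
  apply: mulr_ge0; first exact: mulr_ge0.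
  by apply: mulr_ge0; [exact: ltW|exact: sqr_ge0].
apply: poly_incr; first exact: ltW.
move=> s /andP[_ s0]; rewrite V' -mulNr.
apply: mulr_ge0; first by rewrite oppr_ge0 mulr_ge0_le0.
by apply: mulr_ge0; [exact: ltW|exact: sqr_ge0].
Qed.

(** By Legendre's equation, the primitive of L_n is (X^2 - 1) L_n' up to the
    factor n (n + 1), so it is O(n^(-3/2)), which is half an order better than
    what the integration of |L_n| <= 1 in [iterL_bound] yields. *)
Lemma primp_legendre_bound n t : (0 < n)%N -> -1 <= t <= 1 ->
  `|(primp (L n)).[t]| <= Num.sqrt (2 * n%:R) / (n * n.+1)%:R.
Proof.
move=> n0 t1; have N0 : 0 < (n * n.+1)%:R :> R by rewrite ltr0n muln_gt0 n0.
have -> : primp (L n) = (n * n.+1)%:R^-1 *: (('X^2 - 1) * (L n)^`()).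
  apply: primp_eq.
    by rewrite derivZ legendre_ode scalerA mulVf ?scale1r// lt0r_neq0.
  rewrite -mul_polyC !horner_rules; ring.
have := legendre_deriv_bound n t1.
have -> : (1 - t ^+ 2) * (L n)^`().[t] = - (('X^2 - 1) * (L n)^`()).[t].
  by rewrite !horner_rules; ring.
rewrite normrN hornerZ normrM gtr0_norm ?invr_gt0// => h.
by rewrite mulrC ler_wpM2r// invr_ge0 ltW.
Qed.

(** The k-fold primitive of L_n vanishing at -1, for k <= n: by [legendre_rec]
    a primitive of L_n is (L_(n+1) - L_(n-1)) / (2n + 1), so that each
    integration gains a factor n^-1. *)
Fixpoint iterL (k n : nat) : {poly R} :=
  if k is k'.+1 then (2 * n%:R + 1)^-1 *: (iterL k' n.+1 - iterL k' n.-1)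
  else L n.

Lemma deriv_iterL k n : (k < n)%N -> (iterL k.+1 n)^`() = iterL k n.
Proof.
elim: k n => [|k IH] [//|n] kn.
  by rewrite /= derivZ derivB legendre_rec scalerA mulVf ?n21_neq0// scale1r.
have -> : iterL k.+2 n.+1 = (2 * n.+1%:R + 1)^-1 *: (iterL k.+1 n.+2 - iterL k.+1 n) by [].
by rewrite derivZ derivB !IH// ltnW// ltnW.
Qed.

Lemma iterLN1 k n : (k < n)%N -> (iterL k.+1 n).[-1] = 0.
Proof.
elim: k n => [|k IH] [//|n] kn.
  by rewrite /= -!mul_polyC !horner_rules !legendreN1 exprS exprS mulrA mulrNN mulr1 mul1r subrr mulr0.
have -> : iterL k.+2 n.+1 = (2 * n.+1%:R + 1)^-1 *: (iterL k.+1 n.+2 - iterL k.+1 n) by [].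
by rewrite -!mul_polyC !horner_rules !IH ?subrr ?mulr0// ltnW// ltnW.
Qed.

Lemma iterL_bound k n t : (k <= n)%N -> -1 <= t <= 1 ->
  `|(iterL k n).[t]| <= ((n - k).+1%:R^-1) ^+ k.
Proof.
elim: k n => [|k IH] n kn t1; first by rewrite expr0 legendre_bound.
case: n kn => [//|n]; rewrite ltnS => kn.
have -> : iterL k.+1 n.+1 = (2 * n.+1%:R + 1)^-1 *: (iterL k n.+2 - iterL k n) by [].
have p0 : 0 < 2 * n.+1%:R + 1 :> R by rewrite ltr_wpDl// mulr_ge0.
rewrite -!mul_polyC !horner_rules normrM gtr0_norm ?invr_gt0// mulrC ler_pdivrMr//.
rewrite subSS; set a := (n - k).+1%:R^-1.
have a0 : 0 < a by rewrite invr_gt0.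
apply: le_trans (ler_normB _ _) _.
have h1 := IH n kn t1; rewrite -/a in h1.
have h2 : `|(iterL k n.+2).[t]| <= a ^+ k.
  apply: (le_trans (IH n.+2 _ t1)); first by rewrite (leq_trans kn)// ltnW.
  rewrite lerXn2r ?nnegrE ?invr_ge0// lef_pV2 ?posrE// ler_nat ltnS.
  by rewrite leq_sub2r// ltnW.
apply: (le_trans (lerD h2 h1)).
have key : 2 <= a * (2 * n.+1%:R + 1).
  rewrite mulrC ler_pdivlMr//.
  have : ((n - k).+1%:R : R) <= n.+1%:R by rewrite ler_nat ltnS leq_subr.
  lra.
have := ler_wpM2l (exprn_ge0 k (ltW a0)) key; rewrite exprS; lra.
Qed.

End LegendreBounds.

(** * Legendre-Gauss-Lobatto nodes *)

Section Nodes.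
Variable R : realType.
Implicit Types p q : {poly R}.
Local Notation L := (legendre R).

Let N11 : -1 < 1 :> R. Proof. by lra. Qed.

Lemma rolle_seq p (x : R) (s : seq R) :
  path <%R x s -> all (root p) (x :: s) ->
  exists s' : seq R, [/\ size s' = size s, path <%R x s', all (root p^`()) s' &
    all (fun z => z < last x s) s'].
Proof.
elim: s x => [|y s IH] x /=; first by exists [::].
move=> /andP[xy ys] /and3P[px py ps].
have [|s' [ss' ys' ps' ls']] := IH y ys; first by rewrite /= py ps.
have pxy : p.[x] = p.[y] by rewrite (rootP px) (rootP py).
have [c] := poly_rolle xy pxy; rewrite in_itv/= => /andP[xc cy] pc.
exists (c :: s'); split => /=.
- by rewrite ss'.
- rewrite xc /=; case: s' ys' {ss' ps' ls'} => //= z s' /andP[yz ->].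
  by rewrite (lt_trans cy yz).
- by rewrite ps' rootE pc eqxx.
- rewrite ls' andbT; apply: (lt_le_trans cy).
  elim: s y ys {IH py ps pxy cy xy ys' ls' ss' ps'} => //= z s IH y /andP[yz zs].
  by rewrite (le_trans (ltW yz))// IH.
Qed.

Let u n : {poly R} := ('X^2 - 1) ^+ n.

Let legE n : L n = (2 ^+ n * n`!%:R)^-1 *: (u n)^`(n).
Proof. by []. Qed.

(** As long as k < n the ends -1 and 1 are still roots of the k-th derivative
    of (X^2 - 1)^n, so Rolle's theorem provides one more inner root at each
    differentiation. *)
Lemma rodrigues_roots n k : (k <= n)%N -> exists s : seq R,
  [/\ size s = k, path <%R (-1) (rcons s 1) & all (root (u n)^`(k)) s].
Proof.
elim: k => [|k IH] kn; first by exists [::]; rewrite /= N11.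
have [s [sk ps rs]] := IH (ltnW kn).
have e1 (a : R) : a ^+ 2 = 1 -> root (u n)^`(k) a.
  move=> a1; apply/rootP.
  have -> : u n = ('X - a%:P) ^+ n * ('X + a%:P) ^+ n.
    rewrite /u -exprMn; congr (_ ^+ n).
    have -> : ('X - a%:P) * ('X + a%:P) = 'X ^+ 2 - (a ^+ 2)%:P by rewrite polyC_exp; ring.
    by rewrite a1 polyC1.
  exact: derivn_root_lt.
have [|s' [ss' ps' rs' ls']] := rolle_seq ps (p := (u n)^`(k)).
  by rewrite /= all_rcons rs !e1 ?sqrrN ?expr1n.
exists s'; split => //.
- by rewrite ss' size_rcons sk.
- rewrite rcons_path ps'/=.
  case: (lastP s') ls' => [_|t z]; first by rewrite /= N11.
  by rewrite last_rcons all_rcons => /andP[+ _]; rewrite last_rcons.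
Qed.

Lemma legendre_deriv_neq0 N : (0 < N)%N -> (L N)^`() != 0.
Proof.
move=> N0; apply/eqP => /deriv_eq0 h.
have := size_legendre R N; rewrite h => /eqP; rewrite ltn_eqF//.
by rewrite ltnS (leq_trans (size_polyC_leq1 _)).
Qed.

(** L_N has N roots in ]-1, 1[, so Rolle's theorem gives N - 1 roots of L_N',
    and its degree leaves room for no other: the list [rootsR] consists
    exactly of these. *)
Lemma legendre_deriv_roots N : (0 < N)%N ->
  size (rootsR (L N)^`()) = N.-1 /\
  path <%R (-1) (rcons (rootsR (L N)^`()) 1).
Proof.
case: N => [//|N] _ /=.
have d0 := legendre_deriv_neq0 (ltn0Sn N).
have [s [sN ps rs]] := rodrigues_roots (leqnn N.+1).
case: s sN ps rs => [//|x s] [sN] /=; rewrite rcons_path => /andP[x1 /andP[xs s1]] rs.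
have rL y : root (u N.+1)^`(N.+1) y -> root (L N.+1) y.
  by move=> /rootP ry; apply/rootP; rewrite legE hornerZ ry mulr0.
have [|s' [ss' ps' rs' ls']] := rolle_seq xs (p := L N.+1).
  by apply/allP => y yxs; apply: rL; have /allP := (rs : all (root (u N.+1)^`(N.+1)) (x :: s)); apply.
have srt := sorted_roots (- cauchy_bound (L N.+1)^`()) (cauchy_bound (L N.+1)^`()) (L N.+1)^`().
rewrite -/(rootsR _) in srt.
have us : uniq (rootsR (L N.+1)^`()) by apply: sorted_uniq srt; [exact: lt_trans|exact: ltxx].
have us' : uniq s'.
  apply: (@sorted_uniq _ <%R); [exact: lt_trans|exact: ltxx|].
  by apply: path_sorted ps'.
have sub : {subset s' <= rootsR (L N.+1)^`()}.
  move=> y ys; rewrite -roots_on_rootsR// in_itv/=.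
  by move/allP : rs' => ->.
have szle : (size (rootsR (L N.+1)^`()) <= N)%N.
  rewrite -ltnS (leq_trans (max_poly_roots d0 _ us))//.
    by apply/allP => y; rewrite -roots_on_rootsR// => /andP[].
  by apply: size_deriv_le; rewrite size_legendre.
have szge : (size s' <= size (rootsR (L N.+1)^`()))%N by exact: uniq_leq_size.
have szE : size (rootsR (L N.+1)^`()) = N.
  by apply/eqP; rewrite eqn_leq szle /=; apply: leq_trans szge; rewrite ss' sN.
split => //.
have szle' : (size (rootsR (L N.+1)^`()) <= size s')%N by rewrite szE ss' sN.
have [_ mE] := uniq_min_size us' sub szle'.
rewrite rcons_path; apply/andP; split.
  rewrite path_min_sorted//; apply/allP => y; rewrite -mE => ys.
  apply: (lt_trans x1); move: ps'; rewrite lt_path_sortedE => /andP[/allP + _].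
  by apply.
case: (lastP (rootsR (L N.+1)^`())) mE => [_|t z mE].
  by rewrite /= N11.
rewrite last_rcons; apply: lt_trans s1.
by move/allP : ls'; apply; rewrite mE mem_rcons mem_head.
Qed.

Definition nodes N : seq R := -1 :: rcons (rootsR (L N)^`()) 1.

Lemma size_nodes N : (0 < N)%N -> size (nodes N) = N.+1.
Proof.
move=> N0; rewrite /nodes /= size_rcons (legendre_deriv_roots N0).1.
by rewrite prednK.
Qed.

Lemma nodes_sorted N : (0 < N)%N -> sorted <%R (nodes N).
Proof. by move=> N0; exact: (legendre_deriv_roots N0).2. Qed.

Lemma nodes_uniq N : (0 < N)%N -> uniq (nodes N).
Proof.
move=> N0; apply: (@sorted_uniq _ <%R); [exact: lt_trans|exact: ltxx|].
exact: nodes_sorted.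
Qed.

(** * Differentiation matrix and exactness of the quadrature *)

Section FixN.
Variable N : nat.
Hypothesis N0 : (0 < N)%N.
Local Notation t_ := (lgl_node R).

Lemma lgl_node_mem (k : 'I_N.+1) : t_ k \in nodes N.
Proof. by rewrite mem_nth// size_nodes. Qed.

Lemma lgl_node_inj : injective (fun k : 'I_N.+1 => t_ k).
Proof.
move=> i j /eqP; rewrite nth_uniq ?size_nodes ?nodes_uniq//.
by move/eqP/val_inj.
Qed.

Lemma lgl_node0 : t_ (ord0 : 'I_N.+1) = -1.
Proof. by []. Qed.

Lemma lgl_node_max : t_ (ord_max : 'I_N.+1) = 1.
Proof.
rewrite /lgl_node -/(nodes N) /= -[N in nth _ _ N]prednK//= nth_rcons.
by rewrite (legendre_deriv_roots N0).1 ltnn eqxx.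
Qed.

Lemma lgl_node_itv (k : 'I_N.+1) : -1 <= t_ k <= 1.
Proof.
have := nodes_sorted N0 => /= h.
have : t_ k \in nodes N := lgl_node_mem k.
rewrite inE mem_rcons inE => /or3P[/eqP ->|/eqP ->|tk]; rewrite ?lexx ?lerN10//; try lra.
move: h; rewrite rcons_path => /andP[h l1].
have h1 := h; move: h1; rewrite lt_path_sortedE => /andP[/allP/(_ _ tk) a1 _].
rewrite (ltW a1)/=; apply/ltW; apply: le_lt_trans l1.
move: h tk; elim: (rootsR _) {a1} (-1) => //= y s IH x /andP[xy ys].
rewrite inE => /predU1P[->|]; last exact: IH.
elim: s y ys {IH xy} => //= z s IH y /andP[yz zs].
by rewrite (le_trans (ltW yz))// IH.
Qed.

Lemma lgl_poly_eq0 p : (size p <= N.+1)%N ->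
  (forall k : 'I_N.+1, p.[t_ k] = 0) -> p = 0.
Proof.
move=> sp p0; apply: (@poly_ltsp_roots _ _ (nodes N)); rewrite ?size_nodes ?nodes_uniq//.
apply/allP => x xn; have kN : (index x (nodes N) < N.+1)%N by rewrite -(size_nodes N0) index_mem.
have := p0 (Ordinal kN); rewrite /lgl_node/= => h.
by apply/rootP; rewrite -h /= -/(nodes N) nth_index.
Qed.

Lemma lgl_poly_eq p q : (size p <= N.+1)%N -> (size q <= N.+1)%N ->
  (forall k : 'I_N.+1, p.[t_ k] = q.[t_ k]) -> p = q.
Proof.
move=> sp sq pq; apply/eqP; rewrite -subr_eq0; apply/eqP.
apply: lgl_poly_eq0 => [|k]; last by rewrite hornerD hornerN pq subrr.
by rewrite (leq_trans (size_polyD _ _))// size_polyN geq_max sp.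
Qed.

(** The node polynomial, with simple roots at all nodes.  By Legendre's
    equation om' = - N (N + 1) L_N, so its derivative at a node is explicit
    and the Lagrange basis can be written with L_N. *)
Let om : {poly R} := (1 - 'X^2) * (L N)^`().

Let om_root (k : 'I_N.+1) : om.[t_ k] = 0.
Proof.
rewrite /om !horner_rules; have := lgl_node_mem k.
rewrite inE mem_rcons inE => /or3P[/eqP ->|/eqP ->|tk].
- by rewrite sqrrN expr1n subrr mul0r.
- by rewrite expr1n subrr mul0r.
- have : root (L N)^`() (t_ k).
    by move: tk; rewrite -roots_on_rootsR ?legendre_deriv_neq0// => /andP[].
  by move/rootP ->; rewrite mulr0.
Qed.

Let om' : om^`() = - (N * N.+1)%:R *: L N.
Proof. by rewrite scaleNr -legendre_ode -derivN; congr deriv; rewrite /om; ring. Qed.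

Let size_om : (size om <= N.+2)%N.
Proof.
rewrite /om; apply: leq_trans (size_polyMleq _ _) _.
have s3 : (size (1 - 'X^2 : {poly R})%R <= 3)%N.
  by rewrite (leq_trans (size_polyD _ _))// size_polyN size_polyXn geq_max size_poly1.
have s1 : (size (L N)^`() <= N)%N by apply: size_deriv_le; rewrite size_legendre.
lia.
Qed.

Let om_neq0 : om != 0.
Proof.
apply/eqP => h; move: om'; rewrite h deriv0 => /esym/eqP.
rewrite scaler_eq0 oppr_eq0 pnatr_eq0 (negbTE (legendre_neq0 R N)) orbF muln_eq0.
by move: N0; case: (N).
Qed.

Let A (k : 'I_N.+1) : {poly R} := om %/ ('X - (t_ k)%:P).

Let AE k : om = A k * ('X - (t_ k)%:P).
Proof. by rewrite /A divpK// dvdp_XsubCl; apply/rootP; exact: om_root. Qed.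

Let size_A k : (size (A k) <= N.+1)%N.
Proof.
rewrite /A size_divp ?polyXsubC_eq0// size_XsubC /= subn1.
by have := size_om; case: (size om).
Qed.

Let A_at k j : j != k -> (A k).[t_ j] = 0.
Proof.
move=> jk; have := om_root j; rewrite (AE k) !horner_rules => /eqP.
rewrite mulf_eq0 => /orP[/eqP//|]; rewrite subr_eq0 => /eqP/lgl_node_inj/eqP.
by rewrite (negbTE jk).
Qed.

Let A_self k : (A k).[t_ k] = - (N * N.+1)%:R * (L N).[t_ k].
Proof.
have := congr1 (fun p : {poly R} => p.[t_ k]) om'.
by rewrite {1}(AE k) hornerZ derivM derivXsubC !horner_rules subrr mulr0 add0r mulr1 => <-.
Qed.

Lemma legendre_node_neq0 (k : 'I_N.+1) : (L N).[t_ k] != 0.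
Proof.
apply/eqP => h; have h0 : A k = 0.
  apply: lgl_poly_eq0 (size_A k) _ => j.
  have [->|/A_at//] := eqVneq j k; by rewrite A_self h mulr0.
by move: om_neq0; rewrite (AE k) h0 mul0r eqxx.
Qed.

Let NN0 : - (N * N.+1)%:R != 0 :> R.
Proof. by rewrite oppr_eq0 pnatr_eq0 muln_eq0; move: N0; case: (N). Qed.

Let c (k : 'I_N.+1) : R := (- (N * N.+1)%:R * (L N).[t_ k])^-1.

Definition lgl_ell (k : 'I_N.+1) : {poly R} := c k *: A k.
Local Notation ell := lgl_ell.

Lemma lgl_ell_at k j : (ell k).[t_ j] = (j == k)%:R.
Proof.
rewrite /ell hornerZ; have [->|/A_at ->] := eqVneq j k; last by rewrite mulr0.
by rewrite A_self mulVf// mulf_neq0 ?legendre_node_neq0.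
Qed.

Lemma size_lgl_ell k : (size (ell k) <= N.+1)%N.
Proof. exact: leq_trans (size_scale_leq _ _) (size_A k). Qed.

Lemma lgl_interp p : (size p <= N.+1)%N ->
  p = \sum_(k < N.+1) p.[t_ k] *: ell k.
Proof.
move=> sp; apply: lgl_poly_eq => // [|j].
  apply: leq_trans (size_sum _ _ _) _; apply/bigmax_leqP => i _.
  exact: leq_trans (size_scale_leq _ _) (size_lgl_ell _).
rewrite horner_sum (bigD1 j)//= big1 => [|i ij].
  by rewrite hornerZ lgl_ell_at eqxx mulr1 addr0.
by rewrite hornerZ lgl_ell_at eq_sym (negbTE ij) mulr0.
Qed.

Let ell_eq k : ell k * ('X - (t_ k)%:P) = c k *: om.
Proof. by rewrite /ell -scalerAl -AE. Qed.

Let com' k : c k *: om^`() = (L N).[t_ k]^-1 *: L N.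
Proof.
rewrite om' scalerA; congr (_ *: _).
by rewrite /c invfM mulrAC mulVf ?mul1r.
Qed.

Let dell k : (ell k)^`() * ('X - (t_ k)%:P) + ell k = (L N).[t_ k]^-1 *: L N.
Proof.
rewrite -com' -derivZ -ell_eq derivM derivXsubC mulr1 //.
Qed.

(** Off the diagonal this is the derivative of ell_k (X - t_k) = c_k om at
    t_i.  On the diagonal a second derivative is needed, and twice ell_k'(t_k)
    turns out to be L_N'(t_k) / L_N(t_k): this is 0 at the inner nodes, and
    Legendre's equation evaluates it at the ends. *)
Lemma lgl_D_ell (i k : 'I_N.+1) : lgl_D R N i k = (ell k)^`().[t_ i].
Proof.
rewrite mxE; have [->|ik] /= := eqVneq i k; last first.
  have := congr1 (fun p : {poly R} => p.[t_ i]) (dell k).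
  rewrite hornerZ hornerD hornerM hornerXsubC lgl_ell_at (negbTE ik) addr0 => h.
  have tik : t_ i - t_ k != 0 by rewrite subr_eq0; apply: contra ik => /eqP/lgl_node_inj ->.
  by apply: (mulIf tik); rewrite h divfK// mulrC.
have {i} h : 2 * (ell k)^`().[t_ k] = (L N)^`().[t_ k] / (L N).[t_ k].
  move: (ell k) (dell k) => e de.
  have := congr1 (fun p : {poly R} => p^`().[t_ k]) de.
  rewrite derivD derivM derivXsubC mulr1 derivZ hornerZ.
  by rewrite !hornerD !hornerM hornerXsubC subrr mulr0 add0r mulrC => <-; ring.
have -> : (ell k)^`().[t_ k] = (L N)^`().[t_ k] / (L N).[t_ k] / 2.
  by rewrite -h; field.
have hd (e : R) : e ^+ 2 = 1 -> 2 * e * (L N)^`().[e] = (N * N.+1)%:R * (L N).[e].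
  move=> e1; have := congr1 (fun p : {poly R} => p.[e]) (legendre_ode R N).
  by rewrite hornerZ !deriv_rules !horner_rules e1 subrr mul0r addr0 expr1 => <-; ring.
have [->|k0] := eqVneq k ord0.
  rewrite lgl_node0; have := hd (-1); rewrite sqrrN expr1n => /(_ erefl) e.
  have l0 : (L N).[-1] != 0 by rewrite legendreN1 signr_eq0.
  have -> : (N * N.+1)%:R = (2 * -1 * (L N)^`().[-1]) / (L N).[-1] by rewrite e mulfK.
  by field.
have [->|kN] := eqVneq k ord_max.
  rewrite lgl_node_max; have := hd 1; rewrite expr1n => /(_ erefl) e.
  rewrite legendre1 in e *.
  have -> : (N * N.+1)%:R = (2 * 1 * (L N)^`().[1]) by rewrite e mulr1.
  by field.
have : om.[t_ k] = 0 := om_root k.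
rewrite /om hornerM => /eqP; rewrite mulf_eq0 => /orP[|/eqP ->]; last by rewrite !mul0r.
rewrite !horner_rules subr_eq0 eq_sym -[X in _ == X](expr1n _ 2) eqf_sqr => /orP[/eqP h1|/eqP h1]; exfalso.
  by move: kN; rewrite -lgl_node_max in h1; move/lgl_node_inj: h1 => ->; rewrite eqxx.
by move: k0; rewrite -lgl_node0 in h1; move/lgl_node_inj: h1 => ->; rewrite eqxx.
Qed.

Lemma lgl_D_deriv p (i : 'I_N.+1) : (size p <= N.+1)%N ->
  \sum_(k < N.+1) lgl_D R N i k * p.[t_ k] = p^`().[t_ i].
Proof.
move=> sp; rewrite [in RHS](lgl_interp sp) raddf_sum /= horner_sum.
by apply: eq_bigr => k _; rewrite lgl_D_ell derivZ hornerZ mulrC.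
Qed.

Definition quad p : R := \sum_(k < N.+1) p.[t_ k] * lgl_weight R k.

(** The quadrature with the integrals of the Lagrange basis as weights is
    exact by construction up to degree N; these weights are afterwards shown
    to be the [lgl_weight]. *)
Let Q p : R := \sum_(k < N.+1) p.[t_ k] * intp (ell k).

Let Q_small p : (size p <= N.+1)%N -> Q p = intp p.
Proof.
move=> sp; rewrite [in RHS](lgl_interp sp) intp_sum.
by apply: eq_bigr => k _; rewrite intpZ.
Qed.

(** Integration by parts: om vanishes at both ends, and om' is a multiple of
    L_N, which is orthogonal to a primitive of q. *)
Let om_orth q : (size q < N)%N -> intp (om * q) = 0.
Proof.
move=> sq; rewrite mulrC -{1}(deriv_primp q) intp_by_parts.
have e1 (e : R) : e ^+ 2 = 1 -> (primp q * om).[e] = 0.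
  by move=> e1; rewrite /om !horner_rules e1 subrr mul0r mulr0.
rewrite !e1 ?sqrrN ?expr1n// subrr sub0r om' -scalerAr intpZ.
rewrite [primp q * _]mulrC legendre_orth ?mulr0 ?mul0r ?oppr0//.
exact: leq_trans (size_primp _) _.
Qed.

Let Q_exact p : (size p <= 2 * N)%N -> Q p = intp p.
Proof.
move=> sp; rewrite (divp_eq p om) mulrC intpD om_orth ?add0r; last first.
  rewrite size_divp//.
  have -> : size om = N.+2.
    apply/eqP; rewrite eqn_leq size_om /= ltnNge; apply/negP => h.
    by move/eqP: om_neq0; apply; apply: lgl_poly_eq0 => // k; exact: om_root.
  rewrite /=; move: sp N0; move: (size p) => s; lia.
rewrite -Q_small; last first.
  by rewrite -ltnS (leq_trans _ size_om)// ltn_modp.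
by apply: eq_bigr => k _; rewrite hornerD hornerM om_root mul0r add0r.
Qed.

(** ell_k - kap L_N has degree less than N for the right constant kap, so its
    product with L_N is integrated exactly, with integral 0.  Evaluated at the
    nodes this says that the k-th weight times L_N(t_k)^2 does not depend on
    k. *)
Let Qconst k : intp (ell k) * (L N).[t_ k] ^+ 2 * N.+1%:R = Q (L N ^+ 2).
Proof.
have lc0 : lead_coef (L N) != 0 by rewrite lead_coef_eq0 legendre_neq0.
pose kap := (N.+1%:R * (L N).[t_ k])^-1.
have N10 : N.+1%:R != 0 :> R by rewrite pnatr_eq0.
have ellN : (ell k)`_N = kap * (L N)`_N.
  have := congr1 (fun p : {poly R} => p`_N.+1) (ell_eq k).
  rewrite mulrC mulrBl coefB coefXM /= -mul_polyC coefCM coefCM.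
  rewrite [X in _ * X]nth_default ?size_lgl_ell// mulr0 subr0 => ->.
  have -> : om`_N.+1 = - (N%:R * (L N)`_N).
    rewrite /om mulrBl mul1r coefB nth_default ?sub0r; last first.
      by apply: leq_trans (size_deriv_le (n := N) _) _; rewrite ?size_legendre.
    rewrite coefXnM ltnS; move: N0; case: (N) => [//|n] _.
    have -> : (n.+1 < 1)%N = false by [].
    by rewrite !subSS subn0 coef_deriv mulr_natl.
  rewrite /c /kap natrM; have := legendre_node_neq0 k => l0.
  have n0 : N%:R != 0 :> R by rewrite pnatr_eq0 -lt0n.
  by field; rewrite ?n0 ?l0 ?nat1r ?natr1 ?N10.
pose p := ell k * L N - kap *: L N ^+ 2.
have sp : (size p <= 2 * N)%N.
  have -> : p = (ell k - kap *: L N) * L N by rewrite /p -!mul_polyC; ring.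
  apply: leq_trans (size_polyMleq _ _) _; rewrite size_legendre addnS /= mul2n -addnn leq_add2r.
  apply/leq_sizeP => j; rewrite leq_eqVlt => /predU1P[<-|Nj].
    by rewrite coefB [X in _ - X]coefZ ellN subrr.
  rewrite coefB [X in _ - X]coefZ !nth_default ?mulr0 ?subr0// ?size_legendre//.
  exact: leq_trans (size_lgl_ell _) Nj.
have := Q_exact sp; rewrite /p intpB intpZ expr2.
have -> : intp (ell k * L N) = kap * intp (L N * L N).
  have -> : ell k = (ell k - kap *: L N) + kap *: L N by rewrite subrK.
  rewrite mulrDl intpD -scalerAl intpZ (mulrC _ (L N)).
  rewrite (@legendre_orth R N (ell k - kap *: L N)) ?add0r//.
  apply/leq_sizeP => j; rewrite leq_eqVlt => /predU1P[<-|Nj].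
    by rewrite coefB [X in _ - X]coefZ ellN subrr.
  rewrite coefB [X in _ - X]coefZ !nth_default ?mulr0 ?subr0// ?size_legendre//.
  exact: leq_trans (size_lgl_ell _) Nj.
rewrite subrr => /eqP; have -> : Q (ell k * L N - kap *: (L N * L N)) =
   (L N).[t_ k] * intp (ell k) - kap * Q (L N * L N).
  have -> : (L N).[t_ k] * intp (ell k) = \sum_(j < N.+1) (ell k * L N).[t_ j] * intp (ell j).
    rewrite (bigD1 k)//= big1 ?addr0 => [|j jk].
      by rewrite hornerM lgl_ell_at eqxx mul1r.
    by rewrite hornerM lgl_ell_at (negbTE jk) !mul0r.
  rewrite /Q mulr_sumr -sumrB; apply: eq_bigr => j _.
  by rewrite hornerD hornerN hornerZ; ring.
rewrite subr_eq0 => /eqP h.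
rewrite expr2 mulrA [intp _ * _]mulrC h /kap; have := legendre_node_neq0 k => l0.
by field; rewrite l0 nat1r.
Qed.

(** The common value in [Qconst], computed with (X + 1) L_N', which vanishes
    at all the nodes but the last. *)
Let W_max : intp (ell ord_max) = 2 / (N * N.+1)%:R.
Proof.
pose p := ('X + 1) * (L N)^`().
have sp : (size p <= N.+1)%N.
  rewrite /p; apply: leq_trans (size_polyMleq _ _) _.
  have -> : 'X + 1 = 'X - (-1)%:P :> {poly R} by rewrite polyCN opprK polyC1.
  by rewrite size_XsubC /= ltnS size_deriv_le ?size_legendre.
have ip : intp p = 2.
  rewrite /p mulrC intp_by_parts derivD derivX deriv1p addr0.
  rewrite legendre_orth ?size_poly1// !horner_rules legendre1; ring.
have pmax : p.[1] = (N * N.+1)%:R.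
  have := congr1 (fun p : {poly R} => p.[1]) (legendre_ode R N).
  rewrite hornerZ legendre1 derivM derivB derivXn deriv1p !horner_rules !expr1n subrr mul0r addr0 mulr1 => <-.
  ring.
have := Q_small sp; rewrite ip /Q (bigD1 ord_max)//= big1 ?addr0 => [|k kN].
  rewrite lgl_node_max pmax => <-; rewrite mulrC mulKf//.
  by rewrite -oppr_eq0.
have := om_root k; have -> : om = (1 - 'X) * p by rewrite /om /p; ring.
rewrite hornerM => /eqP; rewrite mulf_eq0 => /orP[|/eqP ->]; last by rewrite mul0r.
rewrite !horner_rules subr_eq0 -lgl_node_max => /eqP/lgl_node_inj h.
by move: kN; rewrite h eqxx.
Qed.

Lemma lgl_weightE k : lgl_weight R k = intp (ell k).
Proof.
have N10 : N.+1%:R != 0 :> R by rewrite pnatr_eq0.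
have h1 := Qconst k; have := Qconst ord_max; rewrite -h1.
move/(mulIf N10); rewrite lgl_node_max legendre1 expr1n mulr1 W_max => h.
by rewrite /lgl_weight h mulfK// expf_neq0// legendre_node_neq0.
Qed.

Lemma lgl_weight_ge0 (k : 'I_N.+1) : 0 <= lgl_weight R k.
Proof. by rewrite /lgl_weight !divr_ge0// sqr_ge0. Qed.

Lemma quad_exact p : (size p <= 2 * N)%N -> quad p = intp p.
Proof.
move=> sp; rewrite -Q_exact//; apply: eq_bigr => k _.
by rewrite lgl_weightE.
Qed.

Lemma sum_lgl_weight : \sum_(k < N.+1) lgl_weight R k = 2.
Proof.
have -> : \sum_(k < N.+1) lgl_weight R k = quad 1.
  by apply: eq_bigr => k _; rewrite horner1p mul1r.
rewrite quad_exact; first by rewrite -derivX intp_deriv !hornerX; ring.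
by rewrite size_poly1 muln_gt0.
Qed.

End FixN.
End Nodes.

(** * Polynomial approximation: Jackson's theorem *)

Section MeanValue.
Variable R : realType.

Lemma MVT_le (h h' : R -> R) (M a b : R) : a <= b ->
  (forall t, a <= t <= b -> is_derive t 1 h (h' t)) ->
  (forall t, a <= t <= b -> `|h' t| <= M) ->
  `|h b - h a| <= M * (b - a).
Proof.
move=> ab hd hM.
have [|t|c cab ->] := @MVT_segment R h h' a b ab.
- by move=> t tab; apply: hd; move: tab; rewrite in_itv/= => /andP[/ltW -> /ltW ->].
- apply: derivable_within_continuous => z tab.
  by apply: ex_derive; apply: hd; move: tab; rewrite in_itv.
- rewrite normrM [X in _ * X]ger0_norm ?subr_ge0// ler_wpM2r ?subr_ge0//.
  by apply: hM; move: cab; rewrite in_itv.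
Qed.

Lemma MVT_nonneg (h h' : R -> R) (a b : R) : a <= b ->
  (forall t, a <= t <= b -> is_derive t 1 h (h' t)) ->
  (forall t, a <= t <= b -> 0 <= h' t) -> h a <= h b.
Proof.
move=> ab hd hM.
have [|t|c cab] := @MVT_segment R h h' a b ab.
- by move=> t tab; apply: hd; move: tab; rewrite in_itv/= => /andP[/ltW -> /ltW ->].
- apply: derivable_within_continuous => z tab.
  by apply: ex_derive; apply: hd; move: tab; rewrite in_itv.
- move=> /eqP; rewrite subr_eq => /eqP ->; rewrite lerDr mulr_ge0 ?subr_ge0//.
  by apply: hM; move: cab; rewrite in_itv.
Qed.

Lemma is_derive_horner (p : {poly R}) (t : R) : is_derive t 1 (horner p) p^`().[t].
Proof.
apply: DeriveDef; first exact: derivable_horner.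
by rewrite -derive1E derivE.
Qed.

End MeanValue.

Section TrigBounds.
Variable R : realType.
Implicit Types t : R.

Lemma sin_le_id t : 0 <= t -> sin t <= t.
Proof.
move=> t0; rewrite -subr_ge0.
have -> : 0 = 0 - sin 0 :> R by rewrite sin0 subr0.
apply: (@MVT_nonneg R (fun s => s - sin s) (fun s => 1 - cos s)).
  by [].
by move=> s _; rewrite subr_ge0 cos_le1.
Qed.

Lemma cos_ge_half t : 0 <= t <= 1 -> 1 / 2 <= cos t.
Proof.
move=> /andP[t0 t1].
have -> : t = (t / 2) *+ 2 by rewrite -mulr_natr divfK.
rewrite cos_mulr2n cos2sin2.
have s0 : 0 <= sin (t / 2).
  apply: sin_ge0_pi; rewrite divr_ge0//=.
  have := pi_ge2 R; lra.
have : sin (t / 2) <= t / 2 by apply: sin_le_id; rewrite divr_ge0.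
move=> h; have h2 : sin (t/2) ^+ 2 <= 1/4.
  have : sin (t/2) <= 1/2 by lra.
  move: s0; move: (sin _) => s s0 s2; nra.
move: (sin (t / 2) ^+ 2) h2 => q h2; lra.
Qed.

Lemma sin_ge_half t : 0 <= t <= 1 -> t / 2 <= sin t.
Proof.
move=> /andP[t0 t1]; rewrite -subr_ge0.
have -> : 0 = sin 0 - 0 / 2 :> R by rewrite sin0 mul0r subr0.
apply: (@MVT_nonneg R (fun s => sin s - s / 2) (fun s => cos s - 2^-1)) => // s.
  move=> _; apply: is_derive_eq; by rewrite /GRing.scale/= ?mulr1 ?mulr0 ?addr0 ?add0r.
move=> /andP[s0 st]; rewrite subr_ge0 -div1r; apply: cos_ge_half.
by rewrite s0 (le_trans st).
Qed.

(** W is the polynomial sin(m theta) / sin(theta), m = 2j + 1, in the variable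
    x = sin(theta).  The factor V for the cosine is only there to make the
    induction by the addition formulas go through. *)
Lemma chebyshev_sin (j : nat) : exists W V : {poly R},
  [/\ (size W <= 2 * j + 1)%N, (size V <= 2 * j + 1)%N,
   forall t, W.[sin t] * sin t = sin ((2 * j + 1)%:R * t) &
   forall t, V.[sin t] * cos t = cos ((2 * j + 1)%:R * t)].
Proof.
elim: j => [|j [W [V [sW sV hW hV]]]].
  by exists 1, 1; split; rewrite ?size_poly1// => t; rewrite !horner_rules !mul1r.
have e t : (2 * j.+1 + 1)%:R * t = (2 * j + 1)%:R * t + t *+ 2.
  by rewrite mulnS -addnA natrD mulrDl mulr_natl addrC.
pose d2 : {poly R} := 1 - 2%:R *: 'X^2.
have s2 (p : {poly R}) (c d : R) : (size p <= 2 * j + 1)%N ->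
    (size (p * (c%:P + d *: 'X^2))%R <= 2 * j.+1 + 1)%N.
  move=> sp; apply: leq_trans (size_polyMleq _ _) _.
  have : (size (c%:P + d *: 'X^2)%R <= 3)%N.
    rewrite (leq_trans (size_polyD _ _))// geq_max (leq_trans (size_polyC_leq1 _))//=.
    by rewrite (leq_trans (size_scale_leq _ _))// size_polyXn.
  move: sp; move: (size p) (size _) => a b; lia.
have sD (p q : {poly R}) n : (size p <= n)%N -> (size q <= n)%N -> (size (p + q)%R <= n)%N.
  by move=> sp sq; rewrite (leq_trans (size_polyD _ _))// geq_max sp.
exists (W * (1%:P + (-2) *: 'X^2) + V * (2%:P + (-2) *: 'X^2)).
exists (V * (1%:P + (-2) *: 'X^2) + W * (0%:P + (-2) *: 'X^2)).
split; rewrite ?sD ?s2// => t; rewrite e.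
  rewrite sinD -hW -hV cos_mulr2n sin_mulr2n -!mul_polyC !horner_rules !cos2sin2.
  have := cos2sin2 t; move: (cos t) (sin t) W.[_] V.[_] => c s w v h.
  have -> : v * c * (c * s *+ 2) = v * (c ^+ 2 * s *+ 2) by ring.
  by rewrite h; ring.
rewrite cosD -hW -hV cos_mulr2n sin_mulr2n -!mul_polyC !horner_rules !cos2sin2; ring.
Qed.

End TrigBounds.

Section Kernel.
Variable R : realType.

(** The derivative of A is at most v^-4, the derivative of - v^-3 / 3. *)
Lemma kernel_tail (A : {poly R}) (x : R) : 0 < x <= 1 ->
  (forall v : R, 0 < v <= 1 -> A^`().[v] * v ^+ 4 <= 1) ->
  A.[1] - A.[x] <= 3^-1 / x ^+ 3.
Proof.
move=> /andP[x0 x1] hA.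
pose G v := - A.[v] - (v ^+ 3)^-1 / 3.
pose G' v := - A^`().[v] + (v ^+ 4)^-1.
have GG : G x <= G 1.
  apply: (@MVT_nonneg R G G') => // v /andP[xv v1]; have v0 : 0 < v by exact: lt_le_trans xv.
    have d1 := is_derive_horner A v.
    have d2 : is_derive v 1 (fun w : R => (w ^+ 3)^-1) (- (v ^+ 3) ^- 2 *: (3 * v ^+ 2)).
      apply: is_deriveV; first by rewrite expf_neq0// lt0r_neq0.
      apply: DeriveDef; first exact: exprn_derivable.
      by rewrite exp_derive /GRing.scale/= mulr1.
    apply: is_derive_eq; rewrite /GRing.scale/= /G'; congr (_ + _).
    by field; rewrite lt0r_neq0.
  have := hA v; rewrite v0 v1 => /(_ isT).
  by rewrite /G' addrC subr_ge0 -ler_pdivlMr ?exprn_gt0// mul1r.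
move: GG; rewrite /G expr1n invr1; move: ((x ^+ 3)^-1) => z; lra.
Qed.

(** A polynomial Heaviside function: S is the normalised primitive of W^4,
    which is the Jackson kernel (sin(m theta) / sin(theta))^4 in the variable
    x = sin(theta).  Since |W x| <= 1 its tails are O(x^-3), while W >= m / 2
    for 0 < x <= sin(1/m), hence the total mass is of order m^3; the ratio is
    O((m x)^-3). *)
Lemma heaviside_poly (j : nat) : exists S : {poly R},
  let m : R := (2 * j + 1)%:R in
  [/\ (size S <= 8 * j + 2)%N,
      forall x : R, -1 <= x <= 1 -> 0 <= S.[x] <= 1,
      forall x : R, 0 < x <= 1 -> 1 - S.[x] <= 11 / (m * x) ^+ 3 &
      forall x : R, -1 <= x < 0 -> S.[x] <= 11 / (m * - x) ^+ 3].
Proof.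
have [W [_ [sW _ hW _]]] := chebyshev_sin R j.
set m : R := (2 * j + 1)%:R in hW *.
have m1 : 1 <= m by rewrite ler1n addn1.
have m0 : 0 < m by exact: lt_le_trans m1.
pose K := W ^+ 4; pose A := primp K.
have A' t : A^`().[t] = W.[t] ^+ 4 by rewrite deriv_primp horner_exp.
have W4 t : 0 <= W.[t] ^+ 4 by rewrite (_ : 4 = 2 * 2)%N// exprM sqr_ge0.
have Amono (a b : R) : a <= b -> A.[a] <= A.[b].
  by move=> ab; apply: poly_incr => // t _; rewrite A'.
have Wx (v : R) : -1 <= v <= 1 -> W.[v] ^+ 4 * v ^+ 4 <= 1.
  move=> v1; have <- : sin (asin v) = v by apply: asinK; rewrite in_itv.
  rewrite -exprMn hW; set s := sin _.
  have : `|s| <= 1 := sin_max _; move=> s1.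
  rewrite (_ : 4 = 2 * 2)%N// exprM -[s ^+ 2]real_normK ?num_real//.
  by rewrite -exprM exprn_ile1.
have Wlow (v : R) : 0 <= v <= sin m^-1 -> m / 2 <= W.[v] \/ v = 0.
  move=> /andP[]; rewrite le_eqVlt => /predU1P[->|v0 vm]; [by right|left].
  have v1 : -1 <= v <= 1 by rewrite (le_trans vm (sin_le1 _)) (le_trans _ (ltW v0)) ?lerN10.
  have vE : sin (asin v) = v by apply: asinK; rewrite in_itv.
  have im1 : m^-1 <= 1 by rewrite invf_le1.
  have im0 : 0 < m^-1 by rewrite invr_gt0.
  have p2 := pi_ge2 R.
  have h1 := asin_geNpi2 v1; have h2 := asin_lepi2 v1.
  have t0 : 0 < asin v.
    rewrite ltNge; apply/negP => h; move: v0; rewrite -vE ltNge => /negP; apply.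
    rewrite -oppr_ge0 -sinN; apply: sin_ge0_pi; lra.
  have tm : asin v <= m^-1.
    rewrite leNgt; apply/negP => h; move: vm; rewrite -{1}vE leNgt => /negP; apply.
    rewrite ltr_sin// in_itv/=; lra.
  have mt : 0 <= m * asin v <= 1.
    by rewrite mulr_ge0 ?(ltW m0) ?(ltW t0)//= -(mulfV (lt0r_neq0 m0)) ler_pM2l.
  have := sin_ge_half mt; rewrite -hW vE => h3.
  have h4 : v <= asin v by rewrite -{1}vE; apply: sin_le_id; exact: ltW.
  rewrite -(ler_pM2r v0); apply: le_trans h3.
  by rewrite mulrAC ler_pM2r ?invr_gt0// ler_pM2l.
pose a := sin m^-1.
have im01 : 0 <= m^-1 <= 1 by rewrite invr_ge0 (ltW m0) invf_le1.
have a_lo : m^-1 / 2 <= a by exact: sin_ge_half.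
have a0 : 0 < a by apply: lt_le_trans a_lo; rewrite divr_gt0 ?invr_gt0.
have a1 : a <= 1 by exact: sin_le1.
have A1 : m ^+ 3 / 32 <= A.[1].
  have hA0 : 0 <= A.[0] by have := Amono _ _ (lerN10 R); rewrite primpN1.
  apply: le_trans (Amono _ _ a1); rewrite -[X in X <= _]add0r -[A.[a]](subrK A.[0]) addrC.
  apply: lerD => //.
  have [c] := poly_mvt A a0; rewrite in_itv/= subr0 => /andP[c0 ca] ->.
  rewrite A'; have [|h|/eqP] := Wlow c; [by rewrite !ltW| |by rewrite gt_eqF].
  have h4 : (m / 2) ^+ 4 <= W.[c] ^+ 4 by rewrite lerXn2r ?nnegrE ?divr_ge0 ?(ltW m0)// (le_trans _ h)// divr_ge0// ltW.
  have -> : m ^+ 3 / 32 = (m / 2) ^+ 4 * (m^-1 / 2) by field; exact: lt0r_neq0.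
  by apply: ler_pM => //; rewrite ?exprn_ge0 ?divr_ge0 ?invr_ge0 ?(ltW m0).
have A10 : 0 < A.[1] by apply: lt_le_trans A1; rewrite divr_gt0 ?exprn_gt0.
have N1 (v : R) : -1 <= v <= 1 -> -1 <= - v <= 1 by move=> /andP[? ?]; apply/andP; split; lra.
have S1 : (A.[1]^-1 *: A).[1] = 1 by rewrite hornerZ mulVf// lt0r_neq0.
have bnd (x : R) : 0 < x <= 1 -> A.[1]^-1 * (3^-1 / x ^+ 3) <= 11 / (m * x) ^+ 3.
  move=> /andP[x0 _].
  apply: (@le_trans _ _ ((m ^+ 3 / 32)^-1 * (3^-1 / x ^+ 3))).
    rewrite ler_wpM2r ?divr_ge0 ?exprn_ge0 ?(ltW x0)//.
    by rewrite lef_pV2 ?posrE// divr_gt0// exprn_gt0.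
  have -> : (m ^+ 3 / 32)^-1 * (3^-1 / x ^+ 3) = (32 / 3) / (m * x) ^+ 3.
    by field; rewrite !lt0r_neq0.
  by rewrite ler_wpM2r ?invr_ge0 ?exprn_ge0 ?mulr_ge0 ?(ltW m0) ?(ltW x0)//; lra.
exists (A.[1]^-1 *: A); split.
- apply: leq_trans (size_scale_leq _ _) _; apply: leq_trans (size_primp _) _.
  rewrite /K; have h4 : (size (W ^+ 4) <= ((size W).-1 * 4).+1)%N by exact: size_poly_exp_leq.
  move: sW h4; move: (size W) (size _) => s t; lia.
- move=> x /andP[x0 x1]; rewrite hornerZ mulrC.
  rewrite divr_ge0 ?(ltW A10)//=; last by rewrite -(primpN1 K); exact: Amono.
  by rewrite ler_pdivrMr// mul1r; exact: Amono.
- move=> x x1; apply: le_trans (bnd x x1); have := @kernel_tail A x x1 => h.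
  rewrite -[X in X - _]S1 !hornerZ -mulrBr ler_pM2l ?invr_gt0//.
  apply: h => v /andP[v0 v1]; rewrite A'; apply: Wx.
  by rewrite v1 andbT (le_trans _ (ltW v0)) ?lerN10.
- move=> x /andP[x1 x0]; have nx : 0 < - x <= 1 by rewrite oppr_gt0 x0/= lerNl.
  apply: le_trans (bnd _ nx); rewrite hornerZ ler_pM2l ?invr_gt0//.
  have := @kernel_tail (- (A \Po (- 'X))) (- x) nx.
  rewrite !hornerN !horner_comp !hornerN !hornerX !opprK (primpN1 K) oppr0 add0r.
  apply => v /andP[v0 v1].
  rewrite derivN deriv_comp derivN derivX mulrN1 opprK horner_comp hornerN hornerX A'.
  have -> : v ^+ 4 = (- v) ^+ 4 by ring.
  apply: Wx; apply: N1; by rewrite v1 andbT (le_trans _ (ltW v0)) ?lerN10.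
Qed.

End Kernel.

Section Jackson.
Variable R : realType.

Let cubic_bound d : (0 < d)%N -> (d.+2 * d.+3 <= 12 * d ^ 3)%N.
Proof.
move=> d0; apply: (@leq_trans ((3 * d) * (4 * d))); first by apply: leq_mul; lia.
by rewrite mulnACA (_ : 3 * 4 = 12)%N// leq_mul2l /= mulnn leq_pexp2l.
Qed.

(** The sums of 1 / ((d + 1) (d + 2)) over the distances d from i0 telescope
    on each side of i0; P bounds the partial sums. *)
Let dist_sum (i0 M : nat) (e : nat -> R) (c : R) : 0 <= c ->
  (forall i, (i <= i0)%N -> e i <= c / ((i0 - i).+1 * (i0 - i).+2)%:R) ->
  (forall i, (i0 < i)%N -> e i <= c / ((i - i0).+1 * (i - i0).+2)%:R) ->
  \sum_(i < M) e i <= 2 * c.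
Proof.
move=> c0 e1 e2.
pose P (k : nat) : R := if (k <= i0)%N then (i0 - k).+2%:R^-1 else 2 - (k - i0).+1%:R^-1.
have P0 k : 0 <= P k <= 2.
  rewrite /P; case: ifP => _.
    by rewrite invr_ge0 ler0n /= (@le_trans _ _ 1) ?invf_le1 ?ler1n// ler1n.
  have h1 : (0:R) <= (k - i0).+1%:R^-1 by rewrite invr_ge0.
  have h2 : (k - i0).+1%:R^-1 <= 1 :> R by rewrite invf_le1 ?ler1n.
  by move: (_^-1) h1 h2 => z h1 h2; apply/andP; split; lra.
suff h k : \sum_(i < k) e i <= c * P k.
  by apply: (le_trans (h M)); rewrite mulrC ler_wpM2r//; case/andP: (P0 M).
elim: k => [|k IH]; first by rewrite big_ord0 mulr_ge0//; case/andP: (P0 0%N).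
have inv2 (d : nat) : d.+1%:R^-1 - d.+2%:R^-1 = (d.+1 * d.+2)%:R^-1 :> R.
  rewrite natrM; field; rewrite -!natr1.
  have d0 : (0:R) <= d%:R by [].
  by apply/andP; split; apply: lt0r_neq0; lra.
rewrite big_ord_recr /=; apply: le_trans (lerD IH (lexx _)) _.
rewrite addrC -lerBrDr -mulrBr.
have [ki|ik] := leqP k i0; last first.
  apply: (le_trans (e2 _ ik)); rewrite ler_wpM2l//.
  rewrite /P leqNgt (leq_trans ik)// leqNgt ik /= -inv2.
  have -> : (k.+1 - i0)%N = (k - i0).+1 by rewrite subSn// ltnW.
  by move: ((k - i0).+1%:R^-1) ((k - i0).+2%:R^-1) => z w; lra.
apply: (le_trans (e1 _ ki)); rewrite ler_wpM2l// /P ki.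
move: ki; rewrite leq_eqVlt => /predU1P[->|ki].
  by rewrite ltnn subnn subSnn mul1n; lra.
rewrite ki -inv2; have -> : (i0 - k)%N = (i0 - k.+1).+1 by rewrite subnSK.
by [].
Qed.

(** Sharp steps reproduce the piecewise constant interpolation of F, up to the
    step i0. *)
Let telescope_ind (i0 M : nat) (F : nat -> R) :
  \sum_(i < M) (i <= i0)%N%:R * (F i.+1 - F i) = F (minn i0.+1 M) - F 0%N.
Proof.
elim: M => [|M IH]; first by rewrite big_ord0 minn0 subrr.
rewrite big_ord_recr /= IH; have [Mi|iM] := leqP M i0.
  rewrite mul1r (minn_idPr _) ?(leq_trans Mi)// (minn_idPr _) ?ltnS//; ring.
rewrite mul0r addr0 (minn_idPl _)// (minn_idPl _)// ltnW//.
Qed.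

(** Replace f by the step function through its values on a grid of mesh 2/m,
    and each step by the smoothed step of [heaviside_poly].  A step at d
    meshes from t contributes an error O(d^-3) times the height M / m of the
    step; these add up to O(M / m), and m is proportional to the degree n. *)
Lemma jackson_lipschitz (f : R -> R) (M : R) (n : nat) : 0 <= M -> (0 < n)%N ->
  (forall s t : R, -1 <= s <= 1 -> -1 <= t <= 1 -> `|f s - f t| <= M * `|s - t|) ->
  exists p : {poly R}, (size p <= n.+1)%N /\
    forall t : R, -1 <= t <= 1 -> `|f t - p.[t]| <= (160 * 163) * M / n%:R.
Proof.
(* The smoothed steps have degree 8 j + 1, which must not exceed n. *)
move=> M0 n0 fM; pose j := (n.-1 %/ 8)%N.
have [S] := heaviside_poly R j.
set m : R := (2 * j + 1)%:R => /= -[sS S01 Spos Sneg].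
pose k := (2 * j + 1)%N.
have mk : m = k%:R by [].
have k0 : (0 < k)%N by rewrite /k addn1.
have nk : (2 * n <= 16 * k)%N by rewrite /k /j; clear -n0; lia.
have m0 : 0 < m by rewrite mk ltr0n.
pose s (i : nat) : R := -1 + 2 * i%:R / m.
pose F i := f (s i).
pose T i : {poly R} := S \Po (2^-1 *: ('X - (s i)%:P)).
pose p := (F 0%N)%:P + \sum_(i < k) (F i.+1 - F i) *: T i.
have sT i : (size (T i) <= n.+1)%N.
  rewrite /T; have -> : 2^-1 *: ('X - (s i)%:P) = 2^-1 *: 'X + (- (s i / 2))%:P.
    by rewrite scalerBr -[X in _ - X]mul_polyC -polyCM polyCN (mulrC 2^-1).
  apply: leq_trans (_ : size S <= _)%N; last first.
    by apply: leq_trans sS _; rewrite /j; lia.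
  have [->|S0] := eqVneq S 0; first by rewrite comp_poly0 size_poly0.
  apply: leq_trans (size_comp_poly_leq _ _) _.
  have : (size (2^-1 *: 'X + (- (s i / 2))%:P : {poly R})%R <= 2)%N.
    rewrite (leq_trans (size_polyD _ _))// geq_max (leq_trans (size_scale_leq _ _)) ?size_polyX//.
    by rewrite (leq_trans (size_polyC_leq1 _)).
  have : (0 < size S)%N by rewrite size_poly_gt0.
  move: (size S) (size _) => a b; nia.
exists p; split.
  rewrite /p (leq_trans (size_polyD _ _))// geq_max (leq_trans (size_polyC_leq1 _))//=.
  apply: leq_trans (size_sum _ _ _) _; apply/bigmax_leqP => i _.
  exact: leq_trans (size_scale_leq _ _) (sT _).
move=> t t1.
pose y := (t + 1) * m / 2.
have y0 : 0 <= y by rewrite divr_ge0// mulr_ge0 ?(ltW m0)//; case/andP: t1 => ? ?; lra.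
have ym : y <= m.
  by rewrite /y ler_pdivrMr// mulrC ler_pM2l//; case/andP: t1 => ? ?; lra.
(* In the units y of the grid, t lies between the nodes i0 and i0 + 1. *)
pose i0 := Num.truncn y.
have /andP[i0y yi0] : i0%:R <= y < i0.+1%:R by exact: truncn_itv.
have s1 i : (i <= k)%N -> -1 <= s i <= 1.
  move=> ik; have : 0 <= i%:R / m <= 1.
    by rewrite divr_ge0 ?(ltW m0)//= ler_pdivrMr// mul1r mk ler_nat.
  by rewrite /s -mulrA => /andP[? ?]; apply/andP; split; lra.
have tE : t = -1 + 2 * y / m by rewrite /y; field; rewrite lt0r_neq0.
have ts i : t - s i = 2 * (y - i%:R) / m by rewrite tE /s; field; rewrite lt0r_neq0.
have Tv i : (T i).[t] = S.[(y - i%:R) / m].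
  rewrite /T horner_comp hornerZ hornerXsubC ts; congr (S.[_]); field; rewrite lt0r_neq0//.
have xi i : (i <= k)%N -> -1 <= (y - i%:R) / m <= 1.
  move=> ik; have := s1 i ik => /andP[? ?]; case/andP: t1 => ? ?.
  have -> : (y - i%:R) / m = (t - s i) / 2 by rewrite ts; field; rewrite lt0r_neq0.
  by apply/andP; split; lra.
have FF i : (i < k)%N -> `|F i.+1 - F i| <= M * (2 / m).
  move=> ik; apply: le_trans (fM _ _ _ _) _; [exact: s1|by apply: s1; exact: ltnW|].
  rewrite ler_wpM2l//; have -> : s i.+1 - s i = 2 / m by rewrite /s -natr1; field; rewrite lt0r_neq0.
  by rewrite ger0_norm// divr_ge0// ltW.
pose e (i : nat) : R := `|(i <= i0)%N%:R - (T i).[t]|.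
pose jj := minn i0.+1 k.
have near : `|f t - F jj| <= M * (2 / m).
  apply: le_trans (fM _ _ _ _) _ => //; first by apply: s1; exact: geq_minr.
  rewrite ler_wpM2l// ts -mulrA normrM ger0_norm// ler_pM2l//.
  rewrite normrM [X in _ * X]ger0_norm ?invr_ge0 ?(ltW m0)//.
  rewrite -[X in _ <= X]mul1r ler_pM2r ?invr_gt0// ler_norml.
  rewrite /jj; case: (leqP i0.+1 k) => ik.
    rewrite -natr1; move: yi0 i0y; rewrite -natr1 => ? ?.
    by apply/andP; split; lra.
  have : k%:R <= i0%:R :> R by rewrite ler_nat.
  rewrite -mk => ?; apply/andP; split; lra.
have e1 i : (i < k)%N -> e i <= 1.
  move=> ik; rewrite /e Tv; have /andP[a b] := S01 _ (xi i (ltnW ik)).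
  by rewrite ler_norml; case: (i <= i0)%N => /=; apply/andP; split; lra.
have tail (d : nat) (z : R) : (0 < d)%N -> d%:R <= z -> 11 / z ^+ 3 <= 132 / (d.+2 * d.+3)%:R.
  move=> d0 dz; have z0 : 0 < z by apply: lt_le_trans dz; rewrite ltr0n.
  rewrite ler_pdivrMr ?exprn_gt0// mulrAC ler_pdivlMr ?ltr0n//.
  have h1 : (d.+2 * d.+3)%:R <= 12 * d%:R ^+ 3 :> R.
    rewrite -natrX -[12]/(12%:R) -natrM ler_nat.
    exact: cubic_bound.
  have h2 : d%:R ^+ 3 <= z ^+ 3 by rewrite lerXn2r ?nnegrE// ltW.
  lra.
(* The constant is hidden behind an equation, so that linear arithmetic treats
   it as an atom where its value does not matter. *)
have [c cE] : exists c : R, c = 6 * 132 by exists (6 * 132).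
have c0 : 0 <= c by lra.
have err : \sum_(i < k) e i <= 2 * c.
  pose e' i := if (i < k)%N then e i else 0.
  have -> : \sum_(i < k) e i = \sum_(i < k) e' i by apply: eq_bigr => i _; rewrite /e' ltn_ord.
  apply: (@dist_sum i0 k e' c c0) => i ii; rewrite /e';
    (case: ltnP => ik; last exact: divr_ge0).
    have [di|di] := eqVneq i i0.
      rewrite di subnn mul1n; apply: le_trans (e1 _ _) _; first by rewrite -di.
      by rewrite cE; lra.
    have lt_i : (i < i0)%N by rewrite ltn_neqAle di.
    have dy : (i0 - i)%:R <= y - i%:R by rewrite natrB// lerB.
    have d0 : (0 < i0 - i)%N by rewrite subn_gt0.
    have yi : 0 < y - i%:R by apply: lt_le_trans dy; rewrite ltr0n.
    have x0 : 0 < (y - i%:R) / m <= 1.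
      by rewrite divr_gt0//=; case/andP: (xi i (ltnW ik)).
    rewrite /e ii Tv ger0_norm ?subr_ge0; last first.
      by case/andP: (S01 _ (xi i (ltnW ik))).
    apply: (le_trans (Spos _ x0)); rewrite [m * _]mulrC divfK ?lt0r_neq0//.
    apply: (le_trans (tail _ _ d0 dy)).
    apply: ler_pM; rewrite ?invr_ge0// ?lef_pV2 ?posrE ?ltr0n//; first by lra.
    by rewrite ler_nat; apply: leq_mul.
  have [di|di] := eqVneq i i0.+1.
    rewrite di subSnn; apply: le_trans (e1 _ _) _; first by rewrite -di.
    by rewrite cE -[(2 * 3)%N]/6%N; lra.
  have lt_i : (i0.+1 < i)%N by rewrite ltn_neqAle eq_sym di.
  have dy : (i - i0.+1)%:R <= i%:R - y by rewrite natrB// lerB// ltW.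
  have d0 : (0 < i - i0.+1)%N by rewrite subn_gt0.
  have yi : 0 < i%:R - y by apply: lt_le_trans dy; rewrite ltr0n.
  have x0 : -1 <= (y - i%:R) / m < 0.
    case/andP: (xi i (ltnW ik)) => -> _ /=.
    by rewrite ltr_pdivrMr// mul0r -oppr_gt0 opprB.
  rewrite /e leqNgt ii /= sub0r normrN Tv ger0_norm; last first.
    by case/andP: (S01 _ (xi i (ltnW ik))).
  apply: (le_trans (Sneg _ x0)); rewrite -mulNr opprB [m * _]mulrC divfK ?lt0r_neq0//.
  apply: (le_trans (tail _ _ d0 dy)).
  have -> : (i - i0)%N = (i - i0.+1).+1 by rewrite subnSK.
  by rewrite ler_wpM2r ?invr_ge0//; lra.
have pE : f t - p.[t] = (f t - F jj) +
    \sum_(i < k) ((i <= i0)%N%:R - (T i).[t]) * (F i.+1 - F i).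
  have := telescope_ind i0 k F; rewrite -/jj => h.
  have -> : F jj = F 0%N + \sum_(i < k) (i <= i0)%N%:R * (F i.+1 - F i) by rewrite h; ring.
  rewrite /p hornerD hornerC horner_sum.
  under [X in _ = _ + X]eq_bigr do rewrite mulrBl.
  rewrite sumrB; under [X in f t - (_ + X)]eq_bigr do rewrite hornerZ mulrC.
  ring.
rewrite pE; apply: (le_trans (ler_normD _ _)).
have : `|\sum_(i < k) ((i <= i0)%N%:R - (T i).[t]) * (F i.+1 - F i)| <= (2 * c) * (M * (2 / m)).
  apply: (le_trans (ler_norm_sum _ _ _)).
  apply: (@le_trans _ _ (\sum_(i < k) e i * (M * (2 / m)))).
    apply: ler_sum => i _; rewrite normrM ler_wpM2l//; exact: FF.
  by rewrite -mulr_suml ler_wpM2r// mulr_ge0// divr_ge0// ltW.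
have mn : 2 / m <= 16 / n%:R.
  rewrite ler_pdivrMr// mulrAC ler_pdivlMr ?ltr0n// mk.
  rewrite -[2]/(2%:R) -[16]/(16%:R) -!natrM ler_nat; exact: nk.
have := ler_wpM2l M0 mn.
have -> : (160 * 163) * M / n%:R = 1630 * (M * (16 / n%:R)).
  by field; rewrite pnatr_eq0 -lt0n.
have b0 : 0 <= M * (16 / n%:R) by rewrite mulr_ge0// divr_ge0.
rewrite cE => h1 h2; move: h1 h2 near b0; move: (M * (2 / m)) (M * (16 / n%:R)) (`|f t - _|) (`|\sum_(i < k) _|) => a b z d.
lra.
Qed.

(** Induction on the number of derivatives: a primitive of the approximation
    of h' leaves a remainder that is Lipschitz with the error of that
    approximation as its constant, and [jackson_lipschitz] gains the missing
    factor 1/n. *)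
Lemma jackson (k : nat) : exists C : R, 0 < C /\
  forall (h : nat -> R -> R) (M : R) (n : nat), 0 <= M -> (0 < n)%N ->
  (forall j (t : R), (j < k)%N -> is_derive t 1 (h j) (h j.+1 t)) ->
  (forall t : R, -1 <= t <= 1 -> `|h k t| <= M) ->
  exists p : {poly R}, (size p <= n + k + 1)%N /\
    forall t : R, -1 <= t <= 1 -> `|h 0%N t - p.[t]| <= C * M / n%:R ^+ k.
Proof.
elim: k => [|k [C [C0 IH]]].
  exists 1; split=> // h M n M0 n0 _ hM; exists 0; split; first by rewrite size_poly0.
  by move=> t t1; rewrite horner0 subr0 expr0 divr1 mul1r; exact: hM.
exists ((160 * 163) * C); split; first by rewrite mulr_gt0.
move=> h M n M0 n0 hd hM.
have [||q [sq hq]] := IH (fun j => h j.+1) M n M0 n0; [|exact: hM|].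
  by move=> j t jk; exact: hd.
pose eps := C * M / n%:R ^+ k.
have eps0 : 0 <= eps by rewrite divr_ge0 ?mulr_ge0 ?(ltW C0)// exprn_ge0.
pose f t := h 0%N t - (primp q).[t].
have fd (t : R) : is_derive t 1 f (h 1%N t - q.[t]).
  have d1 := hd 0%N t (ltn0Sn _); have := is_derive_horner (primp q) t.
  rewrite deriv_primp => d2; exact: is_deriveB.
have fle (s t : R) : -1 <= s <= 1 -> -1 <= t <= 1 -> s <= t -> `|f s - f t| <= eps * `|s - t|.
  move=> /andP[s1 s2] /andP[t1 t2] st; rewrite distrC [`|s - t|]distrC [X in _ * X]ger0_norm ?subr_ge0//.
  apply: (MVT_le st (h' := fun t => h 1%N t - q.[t])) => // x /andP[sx xt].
  by apply: hq; rewrite (le_trans s1)//= (le_trans xt).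
have [s t s1 t1|p [sp hp]] := @jackson_lipschitz f eps n eps0 n0.
  case: (leP s t) => st; first exact: fle.
  by rewrite distrC [`|s - t|]distrC; apply: fle => //; exact: ltW.
exists (primp q + p); split.
  rewrite (leq_trans (size_polyD _ _))// geq_max (leq_trans (size_primp _)) ?addnS ?addSn ?ltnS//=; last by rewrite addn0 -addn1.
  by rewrite addn0 (leq_trans sp)// ltnS leqW// leq_addr.
move=> t t1; have := hp t t1; rewrite /f hornerD opprD addrA => /le_trans; apply.
rewrite /eps exprS; have n0' : n%:R != 0 :> R by rewrite pnatr_eq0 -lt0n.
by rewrite invfM le_eqVlt; apply/orP; left; apply/eqP; ring.
Qed.

End Jackson.

(** * Functions of several variables along curves *)

Section ColumnVectors.
Variable R : realType.

Lemma mx_norm_leP m n (x : 'M[R]_(m, n)) (e : R) : 0 <= e ->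
  (forall i j, `|x i j| <= e) -> `|x| <= e.
Proof.
move=> e0 h; rewrite [leLHS]/Num.Def.normr /= mx_normrE; apply/bigmax_leP; split => // -[i j] _.
Qed.

Lemma cvg_col (T : Type) (F : set_system T) (FF : Filter F) n
    (Y : T -> 'cV[R]_n) (a : 'cV[R]_n) :
  (forall i, (fun z => Y z i 0) @ F --> a i 0) -> Y @ F --> a.
Proof.
move=> h; apply/cvgrPdist_le => e e0.
have : \forall z \near F, forall i : 'I_n, `|a i 0 - Y z i 0| <= e.
  by apply: filter_forall => i; move/cvgrPdist_le: (h i); exact.
apply: filterS => z hz; apply: mx_norm_leP; first exact: ltW.
by move=> i j; rewrite !mxE !ord1; exact: hz.
Qed.

Lemma box_bounded n (f : 'cV[R]_n -> R) (C : R) : continuous f ->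
  exists M, forall x : 'cV[R]_n, (forall j, `|x j 0| <= C) -> `|f x| <= M.
Proof.
move=> cf; pose A := [set v : 'rV[R]_n | forall i, `[- C, C]%classic (v ord0 i)].
have cA : compact A.
  by apply: (@rV_compact _ n (fun=> `[- C, C]%classic)) => i; exact: segment_compact.
pose g (v : 'rV[R]_n) := f (v^T).
have cg : continuous g.
  move=> v; apply: continuous_comp; last exact: cf.
  apply: (@cvg_col _ (nbhs v) (nbhs_filter v)) => i; have -> : (fun z : 'rV[R]_n => z^T i 0) = (fun z => z 0 i).
    by apply/funext => z; rewrite mxE.
  by rewrite mxE; exact: coord_continuous.
have := compact_bounded (continuous_compact (continuous_subspaceT cg) cA).
case=> M [_ hM]; exists (M + 1) => x xC.
have := hM (M + 1); rewrite ltrDl ltr01 => /(_ isT (f x)); apply.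
exists (x^T); last by rewrite /g trmxK.
by move=> i /=; rewrite mxE in_itv /= -ler_norml.
Qed.

Lemma continuous_at_sum n (F : 'I_n -> R -> R) (t : R) :
  (forall i, {for t, continuous (F i)}) ->
  {for t, continuous (fun s => \sum_(i < n) F i s)}.
Proof.
elim: n F => [|n IH] F hF.
  have -> : (fun s => \sum_(i < 0) F i s) = cst 0.
    by apply/funext => s; rewrite big_ord0.
  exact: cvg_cst.
have -> : (fun s => \sum_(i < n.+1) F i s) =
    (fun s => \sum_(i < n) F (widen_ord (leqnSn n) i) s) \+ F ord_max.
  by apply/funext => s; rewrite big_ord_recr.
by apply: cvgD; [apply: IH => i|]; exact: hF.
Qed.

Lemma MVT_any (h h' : R -> R) (d : R) :
  (forall t : R, is_derive t 1 h (h' t)) ->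
  exists c, h d - h 0 = h' c * d /\ `|c| <= `|d|.
Proof.
move=> hd.
have cont (a b : R) : {within `[a, b], continuous h}.
  by apply: derivable_within_continuous => z _; apply: ex_derive; exact: hd.
have [d0|d0] := leP 0 d.
  have [c cab ->] := @MVT_segment R h h' 0 d d0 (fun z _ => hd z) (cont _ _).
  exists c; rewrite subr0; split => //; move: cab; rewrite in_itv/= => /andP[c0 cd].
  by rewrite !ger0_norm.
have [c cab E] := @MVT_segment R h h' d 0 (ltW d0) (fun z _ => hd z) (cont _ _).
exists c; split; first by rewrite -opprB E; ring.
move: cab; rewrite in_itv/= => /andP[c0 cd].
by rewrite !ler0_norm ?lerN2// ltW.
Qed.

Lemma is_derive_line n (f : 'cV[R]_n -> R) (z e : 'cV[R]_n) (s : R) :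
  (forall x, derivable f x e) ->
  is_derive s 1 (fun s => f (s *: e + z)) ('D_e f (s *: e + z)).
Proof.
move=> df.
have E : (fun h : R => h^-1 *: (((fun s => f (s *: e + z)) \o shift s) (h *: 1) - f (s *: e + z))) =
         (fun h : R => h^-1 *: ((f \o shift (s *: e + z)) (h *: e) - f (s *: e + z))).
  apply/funext => h /=; congr (_ *: (f _ - _)).
  by rewrite /GRing.scale/= mulr1 -/(GRing.scale _ _) scalerDl addrA.
have := df (s *: e + z); rewrite /derivable -E => h.
by split; [exact: h|rewrite /derive E].
Qed.

(** Go from x to y changing one coordinate at a time.  The intermediate points
    need not vary continuously with y, but they tend to x when y does, which
    is all that continuity at x uses. *)
Lemma MVT_col n (f : 'cV[R]_n.+1 -> R) (x y : 'cV[R]_n.+1) :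
  (forall i x, derivable f x (delta_mx i 0)) ->
  exists w : 'I_n.+1 -> 'cV[R]_n.+1,
    f y - f x = \sum_i 'D_(delta_mx i 0) f (w i) * (y i 0 - x i 0) /\
    forall i j, `|w i j 0 - x j 0| <= `|y j 0 - x j 0|.
Proof.
move=> df.
pose z (k : nat) : 'cV[R]_n.+1 := \col_j (if (j < k)%N then y j 0 else x j 0).
have step (i : 'I_n.+1) : exists w : 'cV[R]_n.+1,
    f (z i.+1) - f (z i) = 'D_(delta_mx i 0) f w * (y i 0 - x i 0) /\
    forall j, `|w j 0 - x j 0| <= `|y j 0 - x j 0|.
  pose e : 'cV[R]_n.+1 := delta_mx i 0.
  have zS : z i.+1 = (y i 0 - x i 0) *: e + z i.
    apply/colP => j; rewrite !mxE ltnS leq_eqVlt eqxx andbT.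
    have [->|ji] := eqVneq j i; first by rewrite eqxx ltnn /= mulr1 subrK.
    by rewrite -val_eqE /= in ji; rewrite (negbTE ji) /= mulr0 add0r.
  have [c [hc cd]] := @MVT_any (fun s => f (s *: e + z i)) (fun s => 'D_e f (s *: e + z i))
     (y i 0 - x i 0) (fun t => is_derive_line (z i) t (df i)).
  exists (c *: e + z i); split; first by rewrite zS -hc scale0r add0r.
  move=> j; rewrite !mxE eqxx andbT.
  have [->|ji] := eqVneq j i; first by rewrite ltnn /= mulr1 addrK.
  by rewrite mulr0 add0r; case: ifP => // _; rewrite subrr normr0.
have [w hw] := choice step; exists w; split; last by move=> i; exact: (hw i).2.
rewrite -[f y](_ : f (z n.+1) = _); last first.
  by congr f; apply/colP => j; rewrite mxE ltn_ord.
rewrite -[f x](_ : f (z 0%N) = _); last by congr f; apply/colP => j; rewrite mxE.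
under eq_bigr => i _ do rewrite -(hw i).1.
rewrite -(big_mkord xpredT (fun i => f (z i.+1) - f (z i))).
by rewrite telescope_sumr.
Qed.

(** The chain rule from continuous partial derivatives. [MVT_col] writes the
    increment as a sum of partial derivatives times increments, which is a
    slope function in the sense of Caratheodory, continuous at t. *)
Lemma is_derive_comp_col n (f : 'cV[R]_n.+1 -> R) (Y : R -> 'cV[R]_n.+1)
    (Y' : 'cV[R]_n.+1) (t : R) :
  (forall i x, derivable f x (delta_mx i 0)) ->
  (forall i, continuous (fun x => 'D_(delta_mx i 0) f x)) ->
  (forall i, is_derive t 1 (fun s => Y s i 0) (Y' i 0)) ->
  is_derive t 1 (fun s => f (Y s)) (\sum_i 'D_(delta_mx i 0) f (Y t) * Y' i 0).
Proof.
move=> df cf dY.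
have hw (s : R) := MVT_col (Y t) (Y s) df.
have [w {}hw] := choice hw.
have hg (i : 'I_n.+1) := (is_derive1_caratheodory (fun s => Y s i 0) t (Y' i 0)).1 (dY i).
have [g {}hg] := choice hg.
have cY i : {for t, continuous (fun s => Y s i 0)}.
  by apply: differentiable_continuous; apply/derivable1_diffP; apply: ex_derive; exact: dY.
have wt i j : w t i j 0 = Y t j 0.
  have := (hw t).2 i j; rewrite subrr normr0 normr_le0 subr_eq0 => /eqP//.
apply/is_derive1_caratheodory.
exists (fun s => \sum_i 'D_(delta_mx i 0) f (w s i) * g i s); split.
- move=> s; rewrite (hw s).1 mulr_suml; apply: eq_bigr => i _.
  by have [-> _ _] := hg i; rewrite mulrA.
- apply: continuous_at_sum => i; apply: cvgM; last by have [_ + _] := hg i.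
  have := @continuous_comp _ _ _ (fun s => w s i) (fun x => 'D_(delta_mx i 0) f x) t.
  apply; last exact: cf.
  apply: cvg_col => j; apply/cvgrPdist_le => e e0.
  have /cvgrPdist_le/(_ e e0) := cY j.
  apply: filterS => s hs; rewrite wt distrC; apply: le_trans ((hw s).2 i j) _.
  by rewrite distrC.
- apply: eq_bigr => i _; have [_ _ ->] := hg i.
  by have -> : w t i = Y t by apply/colP => j; rewrite wt.
Qed.

End ColumnVectors.

(** * Families of functions with uniformly bounded derivatives *)

Section UniformlySmooth.
Variables (R : realType) (I : Type).
Implicit Types h : I -> R -> R.

(** The members of a family indexed by I have derivatives up to the order k,
    bounded on [-1, 1] by constants that do not depend on the index.  This
    uniformity is what makes the quadrature error uniform over all feasible
    points.  Derivatives are required on the whole line, where the polynomials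
    and the data of the problem live, which avoids one-sided derivatives. *)
Fixpoint unif_smooth (k : nat) h : Prop :=
  (exists C, forall i (t : R), -1 <= t <= 1 -> `|h i t| <= C) /\
  if k is k'.+1 then
    exists h', (forall i (t : R), is_derive t 1 (h i) (h' i t)) /\ unif_smooth k' h'
  else True.

Lemma unif_smooth_bounded k h : unif_smooth k h ->
  exists C, 0 <= C /\ forall i (t : R), -1 <= t <= 1 -> `|h i t| <= C.
Proof.
have main : unif_smooth 0 h -> exists C, 0 <= C /\ forall i (t : R), -1 <= t <= 1 -> `|h i t| <= C.
  move=> [[C hC] _]; exists (Num.max C 0); split; first by rewrite le_max lexx orbT.
  by move=> i t t1; rewrite le_max hC.
by case: k => [|k] [h0 _]; apply: main.
Qed.

Lemma unif_smoothW k h : unif_smooth k.+1 h -> unif_smooth k h.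
Proof.
elim: k h => [|k IH] h [hb [h' [hd hk]]]; first by split.
by split => //; exists h'; split => //; exact: IH.
Qed.

Lemma unif_smooth_eq k h1 h2 : (forall i t, h1 i t = h2 i t) -> unif_smooth k h1 -> unif_smooth k h2.
Proof.
move=> e; have -> // : h1 = h2 by apply/funext => i; apply/funext => t.
Qed.

Lemma unif_smooth0 k : unif_smooth k (fun _ _ => 0).
Proof.
elim: k => [|k IH]; split => //; try by exists 0 => i t _; rewrite normr0.
by exists (fun _ _ => 0); split => // i t; exact: is_derive_cst.
Qed.

Lemma unif_smoothD k h1 h2 : unif_smooth k h1 -> unif_smooth k h2 -> unif_smooth k (fun i t => h1 i t + h2 i t).
Proof.
elim: k h1 h2 => [|k IH] h1 h2 [[C1 b1] d1] [[C2 b2] d2]; split.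
- by exists (C1 + C2) => i t t1; rewrite (le_trans (ler_normD _ _))// lerD ?b1 ?b2.
- by [].
- by exists (C1 + C2) => i t t1; rewrite (le_trans (ler_normD _ _))// lerD ?b1 ?b2.
- case: d1 => h1' [d1 u1]; case: d2 => h2' [d2 u2].
  exists (fun i t => h1' i t + h2' i t); split; last exact: IH.
  by move=> i t; apply: is_deriveD.
Qed.

Lemma unif_smoothN k h : unif_smooth k h -> unif_smooth k (fun i t => - h i t).
Proof.
elim: k h => [|k IH] h [[C b] d]; split => //.
- by exists C => i t t1; rewrite normrN b.
- by exists C => i t t1; rewrite normrN b.
- case: d => h' [d u]; exists (fun i t => - h' i t); split; last exact: IH.
  by move=> i t; apply: is_deriveN.
Qed.

Lemma unif_smoothM k h1 h2 : unif_smooth k h1 -> unif_smooth k h2 -> unif_smooth k (fun i t => h1 i t * h2 i t).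
Proof.
elim: k h1 h2 => [|k IH] h1 h2 u1 u2.
  have [C1 [c1 b1]] := unif_smooth_bounded u1; have [C2 [c2 b2]] := unif_smooth_bounded u2.
  by split => //; exists (C1 * C2) => i t t1; rewrite normrM ler_pM ?b1 ?b2.
have [C1 [c1 b1]] := unif_smooth_bounded u1; have [C2 [c2 b2]] := unif_smooth_bounded u2.
split; first by exists (C1 * C2) => i t t1; rewrite normrM ler_pM ?b1 ?b2.
have [_ [h1' [d1 e1]]] := u1; have [_ [h2' [d2 e2]]] := u2.
exists (fun i t => h1 i t * h2' i t + h2 i t * h1' i t); split.
  by move=> i t; apply: is_deriveM.
by apply: unif_smoothD; apply: IH => //; exact: unif_smoothW.
Qed.

Lemma unif_smooth_sum k n (h : 'I_n -> I -> R -> R) : (forall j, unif_smooth k (h j)) ->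
  unif_smooth k (fun i t => \sum_(j < n) h j i t).
Proof.
elim: n h => [|n IH] h hk.
  by apply: unif_smooth_eq (unif_smooth0 k) => i t; rewrite big_ord0.
apply: unif_smooth_eq (unif_smoothD (IH (fun j => h (lift ord0 j)) _) (hk ord0)).
  by move=> i t; rewrite big_ord_recl addrC.
by move=> j; exact: hk.
Qed.

Lemma unif_smoothV k h : (forall i t, h i t != 0) ->
  (exists C, forall i (t : R), -1 <= t <= 1 -> `|(h i t)^-1| <= C) ->
  unif_smooth k h -> unif_smooth k (fun i t => (h i t)^-1).
Proof.
move=> h0 hC; elim: k => [|k IH] u; first by split.
split => //; have [_ [h' [d u']]] := u.
have uV := IH (unif_smoothW u).
exists (fun i t => - (h' i t * ((h i t)^-1 * (h i t)^-1))); split; last first.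
  by apply: unif_smoothN; apply: unif_smoothM => //; exact: unif_smoothM.
move=> i t; have := is_deriveV (h0 i t) (d i t) => dV.
apply: is_derive_eq; rewrite /GRing.scale/= -exprVn; ring.
Qed.

(** The values of the curves stay in a common box, hence in a compact set, on
    which f and its partial derivatives are bounded; the chain rule then feeds
    the induction. *)
Lemma unif_smooth_comp k n (f : 'cV[R]_n.+1 -> R) (Y : I -> R -> 'cV[R]_n.+1) :
  Ck k f -> (forall j, unif_smooth k (fun i t => Y i t j 0)) ->
  unif_smooth k (fun i t => f (Y i t)).
Proof.
have bd (f0 : 'cV[R]_n.+1 -> R) :
    (forall j, exists C, 0 <= C /\ forall i (t : R), -1 <= t <= 1 -> `|Y i t j 0| <= C) ->
    continuous f0 -> exists C, forall i (t : R), -1 <= t <= 1 -> `|f0 (Y i t)| <= C.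
  move=> /choice[C hC] cf.
  have [M hM] := box_bounded (\big[Num.max/0]_j C j) cf.
  exists M => i t t1; apply: hM => j.
  by apply: le_trans ((hC j).2 i t t1) _; exact: le_bigmax.
elim: k f => [|k IH] f fk uY.
  by split => //; apply: bd; [move=> j; exact: unif_smooth_bounded (uY j)|case: fk].
split; first by apply: bd; [move=> j; exact: unif_smooth_bounded (uY j)|case: fk].
have [cf df] := fk.
have hj j := (uY j).2; have [Y' hY'] := choice hj.
exists (fun i t => \sum_j 'D_(delta_mx j 0) f (Y i t) * Y' j i t); split; last first.
  apply: unif_smooth_sum => j; apply: unif_smoothM; last exact: (hY' j).2.
  apply: (IH (fun x => 'D_(delta_mx j 0) f x)); first exact: (df j).2.
  by move=> l; exact: unif_smoothW.
move=> i t.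
have := @is_derive_comp_col R n f (Y i) (\col_j Y' j i t) t.
under [X in _ -> _ -> _ -> is_derive _ _ _ X]eq_bigr do rewrite mxE.
apply.
- by move=> j; exact: (df j).1.
- by move=> j; have := (df j).2; case: (k) => [|k'] [].
- by move=> j; rewrite mxE; exact: (hY' j).1.
Qed.

End UniformlySmooth.

(** * Integrals over subintervals of [-1, 1] *)

Section IntervalIntegral.
Variable R : realType.
Local Notation mu := (@lebesgue_measure R).
Implicit Types (f g h : R -> R) (a b c t : R).

Let mI a b : measurable (`[a, b]%classic : set (measurableTypeR R)) := measurable_itv `[a, b].

Definition itg f a b : R := \int[mu]_(x in `[a, b]) f x.

Lemma integrable_sub f a b : integrable_I f -> -1 <= a -> b <= 1 ->
  mu.-integrable `[a, b] (EFin \o f).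
Proof.
move=> fi a1 b1; apply: integrableS fi => //.
by move=> x /=; rewrite !in_itv/= => /andP[xa xb]; rewrite (le_trans a1)//= (le_trans xb).
Qed.

Lemma cont_integrable f : {within `[-1, 1], continuous f} -> integrable_I f.
Proof. by move=> cf; apply: continuous_compact_integrable => //; exact: segment_compact. Qed.

Lemma integrable_ID f g : integrable_I f -> integrable_I g -> integrable_I (fun x => f x + g x).
Proof. by move=> fi gi; have := integrableD (mI _ _) fi gi. Qed.

Lemma integrable_IZ r f : integrable_I f -> integrable_I (fun x => r * f x).
Proof. by move=> fi; have := integrableZl (mI _ _) r fi. Qed.

Lemma integrable_IN f : integrable_I f -> integrable_I (fun x => - f x).
Proof.
move=> /(integrable_IZ (-1)).
by have -> : (fun x => -1 * f x) = (fun x => - f x) by apply/funext => x; rewrite mulN1r.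
Qed.

Lemma integrable_IB f g : integrable_I f -> integrable_I g -> integrable_I (fun x => f x - g x).
Proof. by move=> fi /integrable_IN; exact: integrable_ID. Qed.

Lemma cont_bounded f : {within `[-1, 1], continuous f} ->
  exists C : R, 0 <= C /\ forall t, -1 <= t <= 1 -> `|f t| <= C.
Proof.
move=> cf.
have := compact_bounded (continuous_compact cf (@segment_compact R (-1) 1)).
case=> M [_ hM]; exists (`|M| + 1); split; first by rewrite addr_ge0.
move=> t t1.
have := hM (`|M| + 1); rewrite ltr_pwDr ?ltr01 ?ler_norm// => /(_ isT (f t)); apply.
by exists t => //=; rewrite in_itv.
Qed.

Lemma integrable_IM f g : integrable_I f -> {within `[-1, 1], continuous g} ->
  integrable_I (fun x => f x * g x).
Proof.
move=> fi cg; have [C [C0 gC]] := cont_bounded cg.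
have mf := measurable_int mu fi.
have mg : measurable_fun (`[-1, 1] : set R) g by exact: subspace_continuous_measurable_fun.
apply: (le_integrable (mI _ _) _ _ (integrable_IZ C (f := fun x => `|f x|) _)).
- by apply/measurable_EFinP; apply: measurable_funM => //; exact/measurable_EFinP.
- move=> x x1 /=; rewrite lee_fin !normrM normr_id [X in _ <= X * _]ger0_norm// mulrC.
  by rewrite ler_wpM2r// gC//; move: x1 => /=; rewrite in_itv.
- exact: integrable_norm fi.
Qed.

Lemma itgxx f a : itg f a a = 0.
Proof. by rewrite /itg set_itv1 Rintegral_set1. Qed.

Lemma eq_itg f g a b : (forall t, a <= t <= b -> f t = g t) -> itg f a b = itg g a b.
Proof. by move=> fg; apply: eq_Rintegral => t; rewrite inE /= in_itv /= => /fg. Qed.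

Section Sub.
Variables a b : R.
Hypotheses (a1 : -1 <= a) (b1 : b <= 1).

Lemma itgD f g : integrable_I f -> integrable_I g ->
  itg (fun x => f x + g x) a b = itg f a b + itg g a b.
Proof. by move=> fi gi; rewrite /itg RintegralD//; exact: integrable_sub. Qed.

Lemma itgB f g : integrable_I f -> integrable_I g ->
  itg (fun x => f x - g x) a b = itg f a b - itg g a b.
Proof. by move=> fi gi; rewrite /itg RintegralB//; exact: integrable_sub. Qed.

Lemma itgZ r f : integrable_I f ->
  itg (fun x => r * f x) a b = r * itg f a b.
Proof. by move=> fi; rewrite /itg RintegralZl//; exact: integrable_sub. Qed.

Lemma itg_split f c : integrable_I f -> a <= c -> c <= b ->
  itg f a b = itg f a c + itg f c b.
Proof.
move=> fi ac cb; have := @Rintegral_itvB R f (BLeft a) (BRight b) c.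
rewrite !bnd_simp => /(_ (integrable_sub fi a1 b1) ac cb).
rewrite Rintegral_itv_obnd_cbnd; last first.
  apply: integrableS (integrable_sub fi (le_trans a1 ac) b1) => //.
  by apply: subset_itvr; rewrite bnd_simp.
by rewrite -/(itg f a b) -/(itg f a c) -/(itg f c b) => /eqP; rewrite subr_eq addrC => /eqP.
Qed.

Lemma itg_norm_le f (C : R) : integrable_I f -> a <= b ->
  (forall t, a <= t <= b -> `|f t| <= C) -> `|itg f a b| <= C * (b - a).
Proof.
move=> fi ab fC; have fs := integrable_sub fi a1 b1.
apply: (le_trans (le_normr_Rintegral (mI _ _) fs)).
have -> : C * (b - a) = \int[mu]_(x in `[a, b]) C.
  rewrite Rintegral_cst//= lebesgue_measure_itv/= lte_fin.
  by move: ab; rewrite le_eqVlt => /predU1P[->|->]; rewrite ?ltxx ?subrr//.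
apply: le_Rintegral => //; first exact: integrable_norm fs.
- apply: measurable_bounded_integrable => //=.
    by rewrite lebesgue_measure_itv/=; case: ifP => _; rewrite -?EFinD ltry.
  by exists `|C|; split => // M CM x _; exact: ltW.
Qed.

Lemma itg_ge0 f : (forall t, a <= t <= b -> 0 <= f t) -> 0 <= itg f a b.
Proof. by move=> f0; apply: Rintegral_ge0 => t /=; rewrite in_itv; exact: f0. Qed.

Lemma le_itg f g : integrable_I f -> integrable_I g ->
  (forall t, a <= t <= b -> f t <= g t) -> itg f a b <= itg g a b.
Proof.
move=> fi gi fg; apply: le_Rintegral; [exact: mI|exact: integrable_sub|exact: integrable_sub|].
by move=> x /=; rewrite in_itv; exact: fg.
Qed.

Lemma itg_FTC G g : (forall t, is_derive t 1 G (g t)) ->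
  {within `[-1, 1], continuous g} -> a <= b -> itg g a b = G b - G a.
Proof.
move=> dG cg; rewrite le_eqVlt => /predU1P[->|ab]; first by rewrite itgxx subrr.
have cG t : {for t, continuous G}.
  by apply: differentiable_continuous; apply/derivable1_diffP; apply: ex_derive.
rewrite /itg /Rintegral (@continuous_FTC2 R g G a b)//.
- apply: continuous_subspaceW cg.
  by move=> x /=; rewrite !in_itv/= => /andP[xa xb]; rewrite (le_trans a1)//= (le_trans xb).
- split; first by move=> t _; exact: ex_derive.
  + by apply: cvg_at_right_filter; exact: cG.
  + by apply: cvg_at_left_filter; exact: cG.
- by move=> t _; rewrite derive1E; apply: derive_val.
Qed.

End Sub.

(** Bisecting n times divides the bound on the total increment by 2^n.  This
    replaces differentiation for functions that need not be differentiable. *)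
Lemma quad_increment_cst (Phi : R -> R) (C : R) :
  (forall a b, -1 <= a -> a <= b -> b <= 1 -> `|Phi b - Phi a| <= C * (b - a) ^+ 2) ->
  Phi 1 = Phi (-1).
Proof.
move=> h.
have main n : forall a b, -1 <= a -> a <= b -> b <= 1 ->
    `|Phi b - Phi a| <= C * (b - a) ^+ 2 / 2 ^+ n.
  elim: n => [|n IH] a b a1 ab b1; first by rewrite expr0 divr1 h.
  pose c := (a + b) / 2.
  have ac : a <= c by rewrite /c; lra.
  have cb : c <= b by rewrite /c; lra.
  have -> : Phi b - Phi a = (Phi b - Phi c) + (Phi c - Phi a) by ring.
  apply: (le_trans (ler_normD _ _)).
  have h1 := IH c b (le_trans a1 ac) cb b1.
  have h2 := IH a c a1 ac (le_trans cb b1).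
  apply: (le_trans (lerD h1 h2)).
  rewrite le_eqVlt; apply/orP; left; apply/eqP.
  by rewrite [2 ^+ n.+1]exprS invfM /c; move: ((2 ^+ n)^-1) => q; field.
have C0 : 0 <= C.
  have := h (-1) 1 (lexx _) _ (lexx _) => h1.
  have {}h1 : `|Phi 1 - Phi (-1)| <= C * (1 - -1) ^+ 2 by apply: h1; lra.
  have := le_trans (normr_ge0 _) h1; rewrite opprK pmulr_lge0// exprn_gt0//.
apply/eqP; rewrite -subr_eq0 -normr_le0; apply/ler_addgt0Pl => e e0; rewrite addr0.
pose n := (Num.truncn (C * 4 / e)).+1.
apply: (le_trans (main n (-1) 1 (lexx _) _ (lexx _))); first by lra.
have -> : C * (1 - -1) ^+ 2 = C * 4 by ring.
rewrite ler_pdivrMr ?exprn_gt0// [e * _]mulrC -ler_pdivrMr//.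
have : C * 4 / e < n%:R by apply: truncnS_gt.
move=> /ltW /le_trans; apply.
by rewrite -natrX ler_nat ltnW// ltn_expl.
Qed.

Lemma itg_prim_sub h a b : integrable_I h -> -1 <= a -> a <= b -> b <= 1 ->
  itg h (-1) b - itg h (-1) a = itg h a b.
Proof.
move=> hi a1 ab b1; rewrite (@itg_split _ _ _ _ _ a)// ?lexx//; ring.
Qed.

Lemma itg_prim_cont h : integrable_I h -> {within `[-1, 1], continuous (itg h (-1))}.
Proof.
move=> hi; apply: (@parameterized_integral_continuous R (-1) 1 h) => //; lra.
Qed.

(** The primitive H of a bounded integrable h is differentiable only almost
    everywhere, so the fundamental theorem does not apply to H phi.  Instead,
    the increments of itg (H phi' + h phi) - H phi over [a, b] are of second
    order in b - a, and [quad_increment_cst] concludes. *)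
Lemma itg_by_parts (c : R) h phi phi' U : integrable_I h ->
  (forall t, -1 <= t <= 1 -> `|h t| <= U) ->
  (forall t, is_derive t 1 phi (phi' t)) ->
  {within `[-1, 1], continuous phi'} ->
  let H t := c + itg h (-1) t in
  itg (fun t => H t * phi' t) (-1) 1 =
    H 1 * phi 1 - H (-1) * phi (-1) - itg (fun t => h t * phi t) (-1) 1.
Proof.
move=> hi hU dphi cphi' H.
have U0 : 0 <= U by apply: le_trans (normr_ge0 _) (hU 1 _); lra.
have cphi : {within `[-1, 1], continuous phi}.
  by apply: derivable_within_continuous => z _; apply: ex_derive; exact: dphi.
have [P [P0 hP]] := cont_bounded cphi'.
have cH : {within `[-1, 1], continuous H}.
  move=> x; apply: continuousD; first exact: cst_continuous.
  exact: itg_prim_cont.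
have iH := cont_integrable cH.
have i1 : integrable_I (fun t => H t * phi' t) by exact: integrable_IM.
have i2 : integrable_I (fun t => h t * phi t) by exact: integrable_IM.
have i12 : integrable_I (fun t => H t * phi' t + h t * phi t) by exact: integrable_ID.
have i' := cont_integrable cphi'.
pose Phi t := itg (fun t => H t * phi' t + h t * phi t) (-1) t - H t * phi t.
have HB a b : -1 <= a -> a <= b -> b <= 1 -> H b - H a = itg h a b.
  by move=> a1 ab b1; rewrite /H opprD addrACA subrr add0r; exact: itg_prim_sub.
suff key : Phi 1 = Phi (-1).
  move: key; rewrite /Phi itgxx sub0r itgD ?lexx//.
  move: (itg _ _ _) (itg _ _ _) (H 1 * phi 1) (H (-1) * phi (-1)) => x y z w; lra.
apply: (@quad_increment_cst Phi (2 * U * P)) => a b a1 ab b1; rewrite /Phi.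
(* The part of the integrand that is O(b - a) on [a, b]. *)
pose k t := (H t - H b) * phi' t + h t * (phi t - phi a).
have ccst (r : R) : {within `[-1, 1], continuous (fun _ : R => r)} by move=> x; exact: cst_continuous.
have cHb : {within `[-1, 1], continuous (fun t => H t - H b)}.
  by move=> x; apply: continuousB; [exact: cH|exact: ccst].
have cpa : {within `[-1, 1], continuous (fun t => phi t - phi a)}.
  by move=> x; apply: continuousB; [exact: cphi|exact: ccst].
have ik1 : integrable_I (fun t => (H t - H b) * phi' t).
  by apply: integrable_IM => //; exact: cont_integrable.
have ik2 : integrable_I (fun t => h t * (phi t - phi a)) by exact: integrable_IM.
have ik : integrable_I k by exact: integrable_ID.
have il : integrable_I (fun t => H b * phi' t + phi a * h t).
  by apply: integrable_ID; exact: integrable_IZ.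
have E : itg (fun t => H t * phi' t + h t * phi t) a b =
    itg k a b + (H b * (phi b - phi a) + phi a * (H b - H a)).
  rewrite (@eq_itg _ (fun t => k t + (H b * phi' t + phi a * h t))); last first.
    by move=> t _; rewrite /k; ring.
  rewrite (itgD a1 b1 ik il) (itgD a1 b1 (integrable_IZ _ i') (integrable_IZ _ hi)).
  by rewrite !itgZ// (itg_FTC a1 b1 dphi cphi' ab) HB.
have -> : itg (fun t => H t * phi' t + h t * phi t) (-1) b - H b * phi b -
   (itg (fun t => H t * phi' t + h t * phi t) (-1) a - H a * phi a) = itg k a b.
  have := itg_prim_sub i12 a1 ab b1; rewrite E => e.
  move/eqP: e; rewrite -subr_eq0 => /eqP e; apply/eqP; rewrite -subr_eq0; apply/eqP.
  by rewrite -[RHS]e; ring.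
have ba : 0 <= b - a by rewrite subr_ge0.
have -> : 2 * U * P * (b - a) ^+ 2 = (U * (b - a) * P + U * (P * (b - a))) * (b - a) by ring.
apply: itg_norm_le => // t /andP[at_ tb].
have t1 : -1 <= t by exact: le_trans at_.
have t2 : t <= 1 by exact: le_trans b1.
apply: (le_trans (ler_normD _ _)); rewrite !normrM; apply: lerD; apply: ler_pM => //.
- rewrite distrC HB//; apply: (@le_trans _ _ (U * (b - t))).
    apply: itg_norm_le => // s /andP[ts sb]; apply: hU.
    by rewrite (le_trans t1)//= (le_trans sb).
  by rewrite ler_wpM2l// lerD2l lerN2.
- by apply: hP; rewrite t1.
- by apply: hU; rewrite t1.
- apply: (@le_trans _ _ (P * (t - a))).
    apply: (MVT_le at_ (h' := phi')) => // s /andP[as_ st].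
    by apply: hP; rewrite (le_trans a1)//= (le_trans st).
  by rewrite ler_wpM2l// lerD2r.
Qed.

End IntervalIntegral.

(** * Smooth functions with compact support *)

Section SmoothFunctions.
Variable R : realType.
Local Notation mu := (@lebesgue_measure R).
Implicit Types (f g h phi : R -> R).

Lemma derivable_cont f : (forall t : R, derivable f t 1) -> continuous f.
Proof.
by move=> df t; apply: differentiable_continuous; apply/derivable1_diffP.
Qed.

Lemma smooth_of_class (S : (R -> R) -> Prop) :
  (forall f, S f -> exists f', S f' /\ forall t : R, is_derive t 1 f (f' t)) ->
  forall f, S f -> forall k (t : R), derivable (derive1n k f) t 1.
Proof.
move=> Sd f Sf k; suff Sk : S (derive1n k f).
  by have [f' [_ df]] := Sd _ Sk; move=> t; apply: ex_derive.
elim: k => [//|k IH]; have [f' [Sf' df]] := Sd _ IH.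
by rewrite derive1nS; have -> // : derive1 (derive1n k f) = f' by apply/funext => t; rewrite derive1E; apply: derive_val.
Qed.

Lemma derive1n_seq (F : nat -> R -> R) :
  (forall k (t : R), is_derive t 1 (F k) (F k.+1 t)) -> forall k, derive1n k (F 0%N) = F k.
Proof.
move=> dF; elim=> [//|k IH]; rewrite derive1nS IH.
by apply/funext => t; rewrite derive1E; apply: derive_val.
Qed.

Lemma smooth_seq (F : nat -> R -> R) :
  (forall k (t : R), is_derive t 1 (F k) (F k.+1 t)) ->
  forall k (t : R), derivable (derive1n k (F 0%N)) t 1.
Proof. by move=> dF k t; rewrite derive1n_seq//; apply: ex_derive. Qed.

(** The functions P(1/t) exp(-1/t), extended by 0 for t <= 0: this class
    contains the usual flat function and is closed under differentiation. *)
Definition flat (P : {poly R}) (t : R) : R :=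
  if 0 < t then P.[t^-1] * expR (- t^-1) else 0.

(** From exp(s) >= s^(d+2) / (d+2)! for s = 1/t, where d exceeds the degree of
    P.  The order t^2 makes [flat P] differentiable at 0 with derivative 0. *)
Lemma flat_small (P : {poly R}) : exists C : R, 0 <= C /\
  forall t, 0 < t <= 1 -> `|flat P t| <= C * t ^+ 2.
Proof.
pose d := size P; pose A := \sum_(i < d) `|P`_i|.
have A0 : 0 <= A by apply: sumr_ge0.
exists (A * (d.+2)`!%:R); split; first by rewrite mulr_ge0.
move=> t /andP[t0 t1]; rewrite /flat t0; set s := t^-1.
have s1 : 1 <= s by rewrite invf_ge1.
have s0 : 0 < s by exact: lt_le_trans s1.
have hP : `|P.[s]| <= A * s ^+ d.
  rewrite horner_coef mulr_suml; apply: (le_trans (ler_norm_sum _ _ _)).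
  apply: ler_sum => i _; rewrite normrM ler_wpM2l// ger0_norm ?exprn_ge0 ?(ltW s0)//.
  by apply: ler_weXn2l => //; exact: ltnW (ltn_ord i).
have he : expR (- s) <= (d.+2)`!%:R / s ^+ d.+2.
  rewrite expRN -[X in _ <= X]invrK lef_pV2 ?posrE ?expR_gt0 ?invr_gt0 ?divr_gt0 ?exprn_gt0 ?ltr0n ?fact_gt0//.
  rewrite invf_div; apply: le_trans (expR_ge1Dxn d.+1 (ltW s0)).
  by rewrite lerDr.
rewrite normrM [X in _ * X]ger0_norm ?expR_ge0//.
apply: (le_trans (ler_pM (normr_ge0 _) (expR_ge0 _) hP he)).
have -> : t = s^-1 by rewrite invrK.
rewrite le_eqVlt; apply/orP; left; apply/eqP.
have sd : s ^+ d != 0 by rewrite expf_neq0// lt0r_neq0.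
rewrite !exprS; field; rewrite sd lt0r_neq0//.
Qed.

Lemma flat_le0 P (t : R) : t <= 0 -> flat P t = 0.
Proof. by move=> t0; rewrite /flat ltNge t0. Qed.

Lemma is_derive_flat P (t : R) : is_derive t 1 (flat P) (flat ('X^2 * (P - P^`())) t).
Proof.
have [t0|t0|->] := ltgtP t 0.
- apply: (@near_eq_is_derive R R R (cst 0)); rewrite ?oner_neq0//.
    by near=> s; rewrite flat_le0// ltW//; near: s; exact: lt_nbhsl.
  by rewrite flat_le0 ?ltW//; exact: is_derive_cst.
- apply: (@near_eq_is_derive R R R (fun s => P.[s^-1] * expR (- s^-1))); rewrite ?oner_neq0//.
    near=> s; by rewrite /flat ifT//; near: s; exact: lt_nbhsr.
  have dV : is_derive t 1 (fun s : R => s^-1) (- t ^- 2 *: 1).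
    by apply: is_deriveV; exact: lt0r_neq0.
  have dP := is_derive_horner P t^-1.
  have dPV := @is_derive1_comp R (horner P) (fun s => s^-1) t _ _ dP dV.
  have dN : is_derive t 1 (fun s : R => - s^-1) (- (- t ^- 2 *: 1)) by apply: is_deriveN.
  have dE := @is_derive1_comp R expR (fun s => - s^-1) t _ _ (is_derive_expR _) dN.
  have dM := @is_deriveM R R _ _ t 1 _ _ dPV dE.
  apply: is_derive_eq dM _.
  rewrite /flat t0 /= /GRing.scale/= !horner_rules mulr1.
  by rewrite -exprVn; ring.
- rewrite flat_le0//; apply/is_derive1_caratheodory.
  exists (fun z => flat P z / z); split.
  + move=> z; rewrite subr0 (flat_le0 P (lexx 0)) subr0.
    by have [->|z0] := eqVneq z 0; [rewrite mulr0 flat_le0 | rewrite divfK].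
  + have [C [C0 hC]] := flat_small P.
    have C1 : 0 < C + 1 by rewrite ltr_wpDl.
    rewrite /prop_for /continuous_at flat_le0// mul0r; apply/cvgrPdist_le => e e0.
    near=> z; rewrite sub0r normrN.
    have [z0|z0] := leP z 0; first by rewrite flat_le0// mul0r normr0 ltW.
    rewrite normrM [X in _ * X]gtr0_norm ?invr_gt0// ler_pdivrMr//.
    have z1 : z <= 1.
      by apply: ltW; near: z; exact: lt_nbhsl.
    have zd : C * z <= e.
      have : z < e / (C + 1) by near: z; apply: lt_nbhsl; exact: divr_gt0.
      rewrite ltr_pdivlMr// => ze; lra.
    apply: (le_trans (hC z _)); first by rewrite z0.
    by rewrite expr2 mulrA ler_wpM2r// ltW.
  + by rewrite !flat_le0// mul0r.
Unshelve. all: by end_near.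
Qed.

(** A class containing the bumps and closed under differentiation, as needed
    by [smooth_of_class]. *)
Inductive bumpy : (R -> R) -> Prop :=
| bumpy_flat P (al be : R) : bumpy (fun t => flat P (al * t + be))
| bumpy_add f g : bumpy f -> bumpy g -> bumpy (fun t => f t + g t)
| bumpy_mul f g : bumpy f -> bumpy g -> bumpy (fun t => f t * g t).

Lemma bumpy_derive f : bumpy f -> exists f', bumpy f' /\ forall t : R, is_derive t 1 f (f' t).
Proof.
elim=> {f} [P al be|f g bf [f' [bf' df]] bg [g' [bg' dg]]|f g bf [f' [bf' df]] bg [g' [bg' dg]]].
- exists (fun t => flat (al *: ('X^2 * (P - P^`()))) (al * t + be)); split; first exact: bumpy_flat.
  move=> t; have dl : is_derive t 1 (fun s : R => al * s + be) al.
    by apply: is_derive_eq; rewrite /GRing.scale/= !mulr1 ?mulr0 ?addr0 ?add0r.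
  have := @is_derive1_comp R (flat P) (fun s => al * s + be) t _ _ (is_derive_flat P _) dl.
  have -> // : flat (al *: ('X^2 * (P - P^`()))) (al * t + be) = flat ('X^2 * (P - P^`())) (al * t + be) * al.
  by rewrite /flat; case: ifP => _; rewrite ?mul0r// hornerZ; ring.
- exists (fun t => f' t + g' t); split; first exact: bumpy_add.
  by move=> t; exact: is_deriveD.
- exists (fun t => f t * g' t + g t * f' t); split; last by move=> t; exact: is_deriveM.
  by apply: bumpy_add; exact: bumpy_mul.
Qed.

(** A test function supported in [a, b] that increases with n to the indicator
    function of the open interval. *)
Definition bump (a b : R) (n : nat) (t : R) : R :=
  flat 1 (n%:R * t + - (n%:R * a)) * flat 1 (- n%:R * t + n%:R * b).

Lemma bumpE a b n t : bump a b n t = flat 1 (n%:R * (t - a)) * flat 1 (n%:R * (b - t)).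
Proof. by rewrite /bump; congr (flat 1 _ * flat 1 _); ring. Qed.

Lemma bump_test a b n : -1 < a -> b < 1 -> test_function (bump a b n).
Proof.
move=> a1 b1; split.
  apply: (smooth_of_class (S := bumpy)); first exact: bumpy_derive.
  by apply: bumpy_mul; exact: bumpy_flat.
exists a, b; split => // t; rewrite in_itv/= negb_and -!ltNge => /orP[ta|bt].
  by rewrite bumpE flat_le0 ?mul0r// mulr_ge0_le0// subr_le0 ltW.
by rewrite bumpE [X in _ * X]flat_le0 ?mulr0// mulr_ge0_le0// subr_le0 ltW.
Qed.

Lemma flat1_itv t : 0 <= flat 1 t <= 1.
Proof.
rewrite /flat; case: ifP => t0; last by rewrite lexx ler01.
rewrite horner1p mul1r expR_ge0/= -expR0 ler_expR oppr_le0 invr_ge0 ltW//.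
Qed.

Lemma bump_itv a b n t : 0 <= bump a b n t <= 1.
Proof.
rewrite /bump; have /andP[x0 x1] := flat1_itv (n%:R * t + - (n%:R * a)).
have /andP[y0 y1] := flat1_itv (- n%:R * t + n%:R * b).
by rewrite mulr_ge0//= mulr_ile1.
Qed.

Lemma flat1_cvg (x : R) : 0 < x -> (fun n : nat => flat 1 (n%:R * x)) @ \oo --> (1 : R).
Proof.
move=> x0.
have h : (fun n : nat => expR (- (n%:R * x)^-1)) @ \oo --> (1 : R).
  rewrite -[X in _ --> X]expR0; apply: continuous_cvg; first exact: continuous_expR.
  rewrite -oppr0; apply: cvgN.
  have -> : (fun n : nat => (n%:R * x)^-1) = (fun n : nat => n%:R^-1 * x^-1).
    by apply/funext => n; rewrite invfM.
  rewrite -(mul0r x^-1); apply: cvgMr_tmp; apply/cvgrPdist_le => e e0; near=> n.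
  rewrite sub0r normrN ger0_norm ?invr_ge0// invf_ple ?posrE//; last by rewrite ltr0n; near: n; exact: nbhs_infty_gt.
  by near: n; exact: nbhs_infty_ger.
apply: cvg_trans h; apply: near_eq_cvg; near=> n.
rewrite /flat ifT ?horner1p ?mul1r// mulr_gt0// ltr0n; near: n; exact: nbhs_infty_gt.
Unshelve. all: by end_near.
Qed.

End SmoothFunctions.

(** * Functions orthogonal to all test functions *)

Section TestFunctions.
Variable R : realType.
Local Notation mu := (@lebesgue_measure R).
Implicit Types (f g h w phi psi : R -> R) (t : R).

Lemma is_derive_derive1n phi k t : test_function phi ->
  is_derive t 1 (derive1n k phi) (derive1n k.+1 phi t).
Proof.
by move=> [sm _]; rewrite derive1nS derive1E; apply/derivableP; exact: sm.
Qed.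

Lemma derive1n_cont phi k : test_function phi -> continuous (derive1n k phi).
Proof. by move=> [sm _]; apply: derivable_cont => t; exact: sm. Qed.

Lemma derive1n_within phi k : test_function phi -> {within `[-1, 1], continuous (derive1n k phi)}.
Proof. by move=> tp; apply: continuous_subspaceT => t; exact: derive1n_cont. Qed.

Lemma derive1n_support phi : test_function phi ->
  exists a b : R, [/\ -1 < a, b < 1 & forall k t, t \notin `[a, b] -> derive1n k phi t = 0].
Proof.
move=> tp; have [_ [a [b [a1 b1 h]]]] := tp; exists a, b; split => //.
elim=> [//|k IH] t; rewrite in_itv/= negb_and -!ltNge => tab.
rewrite -[RHS](derive_cst (0 : R) t 1) /= derive1E.
apply: near_eq_derive; rewrite ?oner_neq0//.
case/orP: tab => tab.
  near=> s; rewrite IH// in_itv/= negb_and -!ltNge; apply/orP; left.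
  by near: s; exact: lt_nbhsl.
near=> s; rewrite IH// in_itv/= negb_and -!ltNge; apply/orP; right.
by near: s; exact: lt_nbhsr.
Unshelve. all: by end_near.
Qed.

Lemma derive1n_bnd phi k : test_function phi ->
  derive1n k phi 1 = 0 /\ derive1n k phi (-1) = 0.
Proof.
move=> /derive1n_support[a [b [a1 b1 h]]].
by split; apply: h; rewrite in_itv/= negb_and -!ltNge ?a1 ?b1 ?orbT.
Qed.

Lemma test_of_seq (F : nat -> R -> R) :
  (forall k t, is_derive t 1 (F k) (F k.+1 t)) ->
  (exists a b : R, [/\ -1 < a, b < 1 & forall t, t \notin `[a, b] -> F 0%N t = 0]) ->
  test_function (F 0%N).
Proof. by move=> dF s; split => // k t; exact: smooth_seq. Qed.

Lemma test_lin phi psi (c : R) : test_function phi -> test_function psi ->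
  let xi t := phi t - c * psi t in
  test_function xi /\ forall k, derive1n k xi = (fun t => derive1n k phi t - c * derive1n k psi t).
Proof.
move=> tp tq xi.
pose F k t := derive1n k phi t - c * derive1n k psi t.
have dF k t : is_derive t 1 (F k) (F k.+1 t).
  have dp := is_derive_derive1n k t tp; have dq := is_derive_derive1n k t tq.
  by apply: is_deriveB; exact: (@is_deriveZ R R R _ c t 1 _ dq).
split; last by move=> k; rewrite -[xi]/(F 0%N) (derive1n_seq dF).
apply: (test_of_seq (F := F)) => //.
have [a [b [a1 b1 h]]] := derive1n_support tp.
have [a' [b' [a1' b1' h']]] := derive1n_support tq.
exists (Num.min a a'), (Num.max b b'); split; rewrite ?lt_min ?gt_max ?a1 ?b1//.
move=> t; rewrite in_itv/= ge_min le_max => tn; rewrite /F h ?h' ?mulr0 ?subrr// in_itv/=; apply: contra tn => /andP[-> ->]; rewrite ?orbT//.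
Qed.

(** A primitive of a test function is constant to the left and to the right of
    its support; the vanishing integral makes both constants 0. *)
Lemma test_primitive phi : test_function phi -> itg phi (-1) 1 = 0 ->
  exists psi, test_function psi /\ forall k, derive1n k.+1 psi = derive1n k phi.
Proof.
move=> tp p0; pose psi := itg phi (-1).
have [a [b [a1 b1 h]]] := derive1n_support tp.
have cphi := derive1n_cont (k := 0%N) tp.
have psi_lt t : t < a -> psi t = 0.
  move=> ta; rewrite /psi (@eq_itg _ _ (fun=> 0)) ?/itg ?Rintegral0//.
    by rewrite Rintegral_cst// mul0r.
  by move=> s /andP[_ st]; apply: (h 0%N); rewrite in_itv/= negb_and -!ltNge (le_lt_trans st ta).
have dpsi t : is_derive t 1 psi (phi t).
  have [t1|t1] := ltP (-1) t.
    have [||||dt ft] := @continuous_FTC1_closed R phi (-1) t (t + 1) => //.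
    - by rewrite ltrDl.
    - apply: continuous_compact_integrable; first exact: segment_compact.
      by apply: continuous_subspaceT => s; exact: cphi.
    - exact: cphi.
    - by rewrite -ft; rewrite derive1E; apply/derivableP.
  have ta : t < a by exact: le_lt_trans a1.
  have -> : phi t = 0 by apply: (h 0%N); rewrite in_itv/= negb_and -!ltNge ta.
  apply: (@near_eq_is_derive R R R (cst 0)); rewrite ?oner_neq0//.
  by near=> s; rewrite psi_lt//; near: s; exact: lt_nbhsl.
have psi_gt t : b < t -> psi t = 0.
  move=> bt; rewrite -p0 -/(psi 1); apply/eqP; rewrite -subr_eq0 -normr_le0.
  have z s : b < s -> phi s = 0.
    by move=> bs; apply: (h 0%N); rewrite in_itv/= negb_and -!ltNge bs orbT.
  have [t1|t1] := leP t 1.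
    rewrite distrC -(mul0r (1 - t)); apply: (MVT_le (h' := phi)) => // s /andP[s1 _].
    by rewrite z ?normr0// (lt_le_trans bt).
  rewrite -(mul0r (t - 1)); apply: (MVT_le (h' := phi)); rewrite ?(ltW t1)// => s /andP[s1 _].
  by rewrite z ?normr0// (lt_le_trans b1).
pose F k := if k is k'.+1 then derive1n k' phi else psi.
have dF k t : is_derive t 1 (F k) (F k.+1 t).
  by case: k => [|k]; [exact: dpsi|exact: is_derive_derive1n].
exists psi; split.
  apply: (test_of_seq (F := F)) => //; exists a, b; split => // t.
  by rewrite in_itv/= negb_and -!ltNge => /orP[/psi_lt|/psi_gt].
by move=> k; rewrite -[psi]/(F 0%N) (derive1n_seq dF).
Unshelve. all: by end_near.
Qed.

Lemma bump_cvg a b t : a < t -> t < b -> (fun n => bump a b n t) @ \oo --> (1 : R).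
Proof.
move=> ta tb; have ha : 0 < t - a by rewrite subr_gt0.
have hb : 0 < b - t by rewrite subr_gt0.
have hc : (fun n => flat 1 (n%:R * (t - a)) * flat 1 (n%:R * (b - t))) @ \oo --> (1 * 1 : R).
  by apply: cvgM; exact: flat1_cvg.
rewrite mulr1 in hc; by have -> : (fun n => bump a b n t) =
  (fun n => flat 1 (n%:R * (t - a)) * flat 1 (n%:R * (b - t))) by apply/funext => n; rewrite bumpE.
Qed.

(** Testing against bumps converging to the indicator of ]a, b[ and dominated
    convergence give the vanishing of the integral of w over [a, b];
    continuity of the primitive extends it to the closed interval. *)
Lemma orth_test_prim_eq0 w : integrable_I w ->
  (forall phi, test_function phi -> itg (fun t => w t * phi t) (-1) 1 = 0) ->
  forall t, -1 <= t <= 1 -> itg w (-1) t = 0.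
Proof.
move=> wi w0.
have mw : measurable_fun (`[-1, 1]%classic : set (measurableTypeR R)) w by apply/measurable_EFinP; exact: measurable_int wi.
have sub a b : -1 < a -> b < 1 -> (`]a, b[%classic : set R) `<=` `[-1, 1]%classic.
  by move=> a1 b1 x /=; rewrite !in_itv/= => /andP[xa xb]; rewrite (ltW (lt_trans a1 xa)) (ltW (lt_trans xb b1)).
have inner a b : -1 < a -> a <= b -> b < 1 -> itg w a b = 0.
  move=> a1 ab b1.
  have mb n : measurable_fun (`[-1, 1]%classic : set (measurableTypeR R)) (bump a b n).
    have cb : {within `[-1, 1], continuous (bump a b n)}.
      exact: (derive1n_within (k := 0%N) (bump_test n a1 b1)).
    exact: subspace_continuous_measurable_fun.
  have mo : measurable (`]a, b[%classic : set R) by [].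
  have mi : measurable (`[-1, 1]%classic : set (measurableTypeR R)) := measurable_itv _.
  have h : (fun n => (\int[mu]_(t in `[(-1)%R, 1%R]) (w t * bump a b n t)%:E)%E) @ \oo -->
      (\int[mu]_(t in `[(-1)%R, 1%R]) ((w \_ `]a, b[%classic) t)%:E)%E.
  apply: (@dominated_cvg _ _ _ mu `[-1, 1]%classic mi
     (fun n t => (w t * bump a b n t)%:E) (fun t => ((w \_ `]a, b[%classic) t)%:E)
     (fun t => `|w t|%:E)).
  - by move=> n; apply/measurable_EFinP; exact: (measurable_funM mw (mb n)).
  - move=> t _; apply/fine_cvgP; split; first by apply: nearW.
    rewrite /= patchE; case: ifPn => [|tn].
      rewrite inE/= in_itv/= => /andP[ta tb].
      have hc : (fun n => w t * bump a b n t) @ \oo --> w t * 1.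
        by apply: cvgM; [exact: cvg_cst|exact: bump_cvg].
      by rewrite mulr1 in hc; exact: hc.
    have z n : bump a b n t = 0.
      move: tn; rewrite notin_setE/= in_itv/= => /negP; rewrite negb_and -!leNgt => /orP[ta|bt].
        by rewrite bumpE flat_le0 ?mul0r// mulr_ge0_le0// subr_le0.
      by rewrite bumpE [X in _ * X]flat_le0 ?mulr0// mulr_ge0_le0// subr_le0.
    by apply: cvg_near_cst; apply: nearW => n /=; rewrite z mulr0.
  - by [].
  - exact: integrable_norm wi.
  - move=> n t _; rewrite /= lee_fin normrM.
    have /andP[b0 b1'] := bump_itv a b n t.
    by rewrite ler_piMr// ger0_norm.
  have z n : (\int[mu]_(t in `[(-1)%R, 1%R]) (w t * bump a b n t)%:E = 0)%E.
    have ii : integrable_I (fun t => w t * bump a b n t).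
      by apply: integrable_IM => //; exact: (derive1n_within (k := 0%N) (bump_test n a1 b1)).
    rewrite -(fineK (integrable_fin_num mi ii)); congr EFin.
    exact: (w0 _ (bump_test n a1 b1)).
  have h0 : (\int[mu]_(t in `[(-1)%R, 1%R]) ((w \_ `]a, b[%classic) t)%:E = 0)%E.
    apply: (cvg_unique _ h); first exact: ereal_hausdorff.
    by apply: cvg_near_cst; apply: nearW => n; rewrite z.
  have E : itg w a b = \int[mu]_(t in `[-1, 1]) (w \_ `]a, b[%classic) t.
    rewrite -Rintegral_mkcondr setIidr; last exact: sub.
    have wi' := integrable_sub wi (ltW a1) (ltW b1).
    rewrite Rintegral_itv_bndo_bndc; last first.
      by apply: integrableS wi' => // x /=; rewrite !in_itv/= => /andP[/ltW -> /ltW ->].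
    rewrite Rintegral_itv_obnd_cbnd//.
    by apply: integrableS wi' => // x /=; rewrite !in_itv/= => /andP[/ltW -> ->].
  by rewrite E /Rintegral h0.
have W0 : itg w (-1) (-1) = 0 by rewrite itgxx.
have m11 : (-1 : R) < 1 by lra.
have [_ WN1 W1] := (continuous_within_itvP _ m11).1 (itg_prim_cont wi).
have Wc s t : -1 < s -> s <= t -> t < 1 -> itg w (-1) t = itg w (-1) s.
  move=> s1 st t1; apply/eqP; rewrite -subr_eq0 itg_prim_sub ?(ltW s1) ?(ltW t1)//.
  by rewrite inner.
have Win t : -1 < t < 1 -> itg w (-1) t = 0.
  move=> /andP[t0 t1]; rewrite -W0; apply: (cvg_unique _ _ WN1); first exact: Rhausdorff.
  apply: cvg_near_cst; near=> s.
  by apply/esym; apply: Wc => //; near: s; exact: nbhs_right_le.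
move=> t /andP[]; rewrite le_eqVlt => /predU1P[<-//|t0].
rewrite le_eqVlt => /predU1P[->|t1]; last by rewrite Win ?t0.
suff c0 : itg w (-1) x @[x --> 1^'-] --> (0 : R) by exact: (cvg_unique _ W1 c0).
apply: cvg_near_cst; near=> s.
rewrite Win//; apply/andP; split; first by near: s; exact: nbhs_left_gt.
by near: s; exact: nbhs_left_lt.
Unshelve. all: by end_near.
Qed.

Lemma cont_prim_eq0 w : {within `[-1, 1], continuous w} ->
  (forall t, -1 <= t <= 1 -> itg w (-1) t = 0) -> forall t, -1 <= t <= 1 -> w t = 0.
Proof.
move=> cw W0; have wi := cont_integrable cw; have m11 : (-1 : R) < 1 by lra.
have [cin wN1 w1] := (continuous_within_itvP _ m11).1 cw.
have win t : -1 < t < 1 -> w t = 0.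
  move=> /andP[t0 t1].
  have ct : {for t, continuous w} by apply: cin; rewrite in_itv/= t0 t1.
  have [d <-] := @continuous_FTC1_closed R w (-1) t 1 t1 wi t0 ct.
  rewrite derive1E -[RHS](derive_cst (0 : R) t 1); apply: near_eq_derive; rewrite ?oner_neq0//.
  near=> s; apply: W0; apply/andP; split; apply: ltW; near: s; [exact: lt_nbhsr|exact: lt_nbhsl].
move=> t /andP[]; rewrite le_eqVlt => /predU1P[<-|t0].
  move=> _; suff c0 : w x @[x --> (-1)^'+] --> (0 : R) by exact: (cvg_unique _ wN1 c0).
  apply: cvg_near_cst; near=> s.
  rewrite win//; apply/andP; split; first by near: s; exact: nbhs_right_gt.
  by near: s; exact: nbhs_right_lt.
rewrite le_eqVlt => /predU1P[->|t1]; last by rewrite win ?t0.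
suff c0 : w x @[x --> 1^'-] --> (0 : R) by exact: (cvg_unique _ w1 c0).
apply: cvg_near_cst; near=> s.
rewrite win//; apply/andP; split; first by near: s; exact: nbhs_left_gt.
by near: s; exact: nbhs_left_lt.
Unshelve. all: by end_near.
Qed.

(** Lebesgue's differentiation theorem: almost everywhere, w is the derivative
    of its primitive. *)
Lemma ae_prim_eq0 w : integrable_I w ->
  (forall t, -1 <= t <= 1 -> itg w (-1) t = 0) ->
  {ae mu, forall t, t \in `[-1, 1] -> w t = 0}.
Proof.
move=> wi W0; pose v := w \_ `[-1, 1]%classic.
have mi : measurable (`[-1, 1]%classic : set (measurableTypeR R)) := measurable_itv _.
have vi : mu.-integrable setT (EFin \o v).
  by have := (integrable_mkcond _ mi).1 wi; rewrite restrict_EFin.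
have W y : \int[mu]_(t in `]-oo, y]) v t = 0.
  rewrite /v -Rintegral_mkcondr.
  have [y1|y1] := ltP y (-1).
    rewrite (_ : _ `&` _ = set0) ?Rintegral_set0//.
    apply/seteqP; split => // x /=; rewrite !in_itv/= => -[xy /andP[x1 _]]; lra.
  have [y2|y2] := leP y 1.
    rewrite (_ : _ `&` _ = `[-1, y]%classic) ?W0 ?y1//.
      by rewrite -[RHS](W0 y) ?y1.
    apply/seteqP; split => x /=; rewrite !in_itv/=; first by move=> [-> /andP[-> _]].
    by move=> /andP[-> xy]; split => //=; rewrite (le_trans xy).
  rewrite (_ : _ `&` _ = `[-1, 1]%classic).
    by rewrite -[RHS](W0 1)//; lra.
  apply/seteqP; split => x /=; rewrite !in_itv/=; first by move=> [_ ].
  by move=> /andP[-> x1]; split => //=; rewrite (le_trans x1)// ltW.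
have := @FTC1Ny R v _ _.
case.
- by move=> y; apply: integrableS vi.
- exact: integrable_locally.
move=> A [mA A0 hA]; exists A; split => // t /= tn; apply: hA => /= -[_].
have -> : (fun y => \int[mu]_(t in `]-oo, y]) v t) = cst 0 by apply/funext => y; rewrite W.
rewrite derive1E derive_cst => v0; apply: tn => t1; rewrite v0 /v patchE mem_set//.
Qed.

End TestFunctions.

(** * From weak derivatives to iterated primitives *)

Section Chains.
Variable R : realType.
Local Notation mu := (@lebesgue_measure R).
Implicit Types (f g h w x phi psi : R -> R) (t : R).

Lemma within_eq f g : (forall t, -1 <= t <= 1 -> f t = g t) ->
  {within `[-1, 1], continuous f} -> {within `[-1, 1], continuous g}.
Proof.
move=> fg; apply: subspace_eq_continuous => t.
by rewrite inE/= in_itv/= => /fg.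
Qed.

(** The concrete form of a function with a bounded m-th weak derivative: each
    function X_j is a primitive of X_(j+1), so no almost everywhere statement
    remains. *)
Definition chain (m : nat) (X : nat -> R -> R) : Prop :=
  [/\ integrable_I (X m), exists U : R, forall t, -1 <= t <= 1 -> `|X m t| <= U &
   forall j, (j < m)%N -> forall t, -1 <= t <= 1 -> X j t = X j (-1) + itg (X j.+1) (-1) t].

Section OneChain.
Variables (m : nat) (X : nat -> R -> R).
Hypothesis cX : chain m X.

Lemma chain_int_cont j : (j <= m)%N -> integrable_I (X j) /\
  ((j < m)%N -> {within `[-1, 1], continuous (X j)}).
Proof.
have [Xi _ Xe] := cX.
elim: {j}(m - j)%N {-2}j (erefl (m - j)%N) => [|d IH] j jd jm.
  have -> : j = m by lia.
  by split => //; rewrite ltnn.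
have [||ij _] := IH j.+1; [lia|lia|].
have cj : {within `[-1, 1], continuous (X j)}.
  apply: (within_eq (f := fun t => X j (-1) + itg (X j.+1) (-1) t)).
    by move=> t t1; rewrite [RHS]Xe//; lia.
  by move=> x; apply: continuousD; [exact: cst_continuous|exact: itg_prim_cont].
by split => //; exact: cont_integrable.
Qed.

Lemma chain_int j : (j <= m)%N -> integrable_I (X j).
Proof. by move=> /chain_int_cont[]. Qed.

Lemma chain_cont j : (j < m)%N -> {within `[-1, 1], continuous (X j)}.
Proof. by move=> jm; have [_ /(_ jm)] := chain_int_cont (ltnW jm). Qed.

Lemma chain_bounded j : (j <= m)%N ->
  exists U : R, 0 <= U /\ forall t, -1 <= t <= 1 -> `|X j t| <= U.
Proof.
rewrite leq_eqVlt => /predU1P[->|/chain_cont/cont_bounded//].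
have [_ [U hU] _] := cX; exists U; split => //.
by apply: le_trans (normr_ge0 _) (hU 1 _); lra.
Qed.

Lemma chain_by_parts phi i j : test_function phi -> (i + j <= m)%N ->
  itg (fun t => X i t * derive1n j phi t) (-1) 1 =
  (-1) ^+ j * itg (fun t => X (i + j)%N t * phi t) (-1) 1.
Proof.
move=> tp; elim: j i => [|j IH] i ijm; first by rewrite addn0 expr0 mul1r.
have [_ _ Xe] := cX.
have im : (i < m)%N by lia.
have [U [_ hU]] := chain_bounded im.
have := @itg_by_parts R (X i (-1)) (X i.+1) (derive1n j phi) (derive1n j.+1 phi) U
  (chain_int im) hU (fun t => is_derive_derive1n j t tp) (derive1n_within tp).
have [-> ->] := derive1n_bnd j tp.
rewrite /= !mulr0 subrr sub0r (IH i.+1) ?addSnnS; last by lia.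
rewrite exprS mulN1r mulNr => <-; apply: eq_itg => t t1; rewrite -Xe//.
Qed.

Lemma chain_weak_deriv j : (j <= m)%N -> weak_deriv j (X 0%N) (X j).
Proof.
move=> jm; split; [exact: chain_int|exact: chain_int|move=> phi tp].
by have := chain_by_parts (i := 0%N) tp jm; rewrite add0n.
Qed.

End OneChain.

Lemma chain_poly m (p : {poly R}) : chain m (fun j => horner p^`(j)).
Proof.
have cp j : {within `[-1, 1], continuous (horner p^`(j))}.
  by apply: continuous_subspaceT => t; exact: continuous_horner.
split; first exact: cont_integrable.
  by have [C [_ hC]] := cont_bounded (cp m); exists C.
move=> j _ t /andP[t0 t1]; rewrite (@itg_FTC _ _ _ _ _ (horner p^`(j)))//; first ring.
Qed.

(** The lemma of du Bois-Reymond: a vanishing k-th weak derivative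
    characterises polynomials of degree less than k.  Fix a test function th
    of integral 1.  For any test function phi, the function phi - (integral of
    phi) th is the derivative of a test function, so that testing w with the
    k-th derivative of phi gives c times the integral of phi.  Subtracting
    from w a multiple of X^k cancels c and leads to the previous order. *)
Lemma du_bois_reymond k w : {within `[-1, 1], continuous w} ->
  (forall phi, test_function phi -> itg (fun t => w t * derive1n k phi t) (-1) 1 = 0) ->
  exists q : {poly R}, (size q <= k)%N /\ forall t, -1 <= t <= 1 -> w t = q.[t].
Proof.
elim: k w => [|k IH] w cw w0.
  exists 0; rewrite size_poly0; split => // t t1; rewrite horner0.
  by apply: cont_prim_eq0 t1 => //; apply: orth_test_prim_eq0 => //; exact: cont_integrable.
have wi := cont_integrable cw.
have [th [tth th1]] : exists th : R -> R, test_function th /\ itg th (-1) 1 = 1.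
  have [th [tth th0]] : exists th : R -> R, test_function th /\ itg th (-1) 1 != 0.
    apply: contrapT => no.
    have c1 : {within `[-1, 1], continuous (fun _ : R => 1 : R)} by move=> x; exact: cst_continuous.
    have : (1 : R) = 0.
      have t0 : -1 <= (0 : R) <= 1 by lra.
      apply: (cont_prim_eq0 c1 _ t0).
      apply: orth_test_prim_eq0; first exact: cont_integrable.
      move=> phi tp; apply: contrapT => ph; apply: no; exists phi; split => //.
      apply/eqP => p0; apply: ph; rewrite -[RHS]p0; apply: eq_itg => t _; exact: mul1r.
    by move/eqP; rewrite oner_eq0.
  pose I := itg th (-1) 1; have [tx _] := test_lin (1 - I^-1) tth tth.
  exists (fun t => th t - (1 - I^-1) * th t); split=> //.
  have ith := cont_integrable (derive1n_within (k := 0%N) tth).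
  rewrite itgB ?itgZ ?lexx//; last exact: integrable_IZ.
  by rewrite -/I mulrBl mul1r mulVf// opprB addrC subrK.
pose c := itg (fun t => w t * derive1n k th t) (-1) 1.
have wc phi : test_function phi ->
    itg (fun t => w t * derive1n k phi t) (-1) 1 = c * itg phi (-1) 1.
  move=> tp; have [tx dx] := test_lin (itg phi (-1) 1) tp tth.
  have cphi := cont_integrable (derive1n_within (k := 0%N) tp).
  have cth := cont_integrable (derive1n_within (k := 0%N) tth).
  have [|psi [tpsi dpsi]] := test_primitive tx.
    rewrite itgB ?itgZ ?th1 ?mulr1 ?subrr ?lexx//; exact: integrable_IZ.
  have := w0 _ tpsi; rewrite dpsi dx.
  have i1 := integrable_IM wi (derive1n_within (k := k) tp).
  have i2 := integrable_IM wi (derive1n_within (k := k) tth).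
  rewrite (@eq_itg _ _ (fun t => w t * derive1n k phi t -
     itg phi (-1) 1 * (w t * derive1n k th t))); last by move=> t _; ring.
  rewrite itgB ?itgZ ?lexx//; last exact: integrable_IZ.
  by rewrite -/c => /eqP; rewrite subr_eq0 mulrC => /eqP.
pose p : {poly R} := ((-1) ^+ k * c / k`!%:R) *: 'X^k.
have sp : (size p <= k.+1)%N by apply: leq_trans (size_scale_leq _ _) _; rewrite size_polyXn.
have dp : p^`(k) = ((-1) ^+ k * c)%:P.
  have kf : k`!%:R != 0 :> R by rewrite pnatr_eq0 -lt0n fact_gt0.
  rewrite /p derivnZ derivnXn subnn expr0 ffactnn -[X in _ *: X]scaler_nat scalerA divfK//.
  by rewrite -mul_polyC mulr1.
have cp : {within `[-1, 1], continuous (horner p)}.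
  by apply: continuous_subspaceT => t; exact: continuous_horner.
have cwp : {within `[-1, 1], continuous (fun t => w t - p.[t])}.
  by move=> x; apply: continuousB; [exact: cw|exact: cp].
have [phi tp|q [sq wq]] := IH _ cwp.
  have dk := derive1n_within (k := k) tp.
  rewrite (@eq_itg _ _ (fun t => w t * derive1n k phi t - p.[t] * derive1n k phi t)); last first.
    by move=> t _; ring.
  rewrite itgB ?lexx//; [|exact: integrable_IM|by apply: integrable_IM => //; exact: cont_integrable].
  rewrite wc//; have := chain_by_parts (i := 0%N) (j := k) (chain_poly k p) tp (leqnn _).
  rewrite derivn0 add0n dp => ->.
  rewrite (@eq_itg _ (fun t => ((-1) ^+ k * c)%:P.[t] * phi t) (fun t => ((-1) ^+ k * c) * phi t)); last by move=> t _; rewrite hornerC.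
  rewrite itgZ ?lexx//; last exact: cont_integrable (derive1n_within (k := 0%N) tp).
  by rewrite !mulrA -expr2 sqrr_sign mul1r subrr.
exists (p + q); split.
  by apply: leq_trans (size_polyD _ _) _; rewrite geq_max sp (leq_trans sq).
by move=> t t1; rewrite hornerD -wq// addrC subrK.
Qed.

(** The m-fold primitive of h has the same m-th weak derivative as x, so the
    two differ by a polynomial; its derivatives correct the intermediate
    primitives. *)
Lemma weak_deriv_chain m x h : (0 < m)%N -> {within `[-1, 1], continuous x} ->
  weak_deriv m x h -> (exists U : R, forall t : R, -1 <= t <= 1 -> `|h t| <= U) ->
  exists X : nat -> R -> R, [/\ chain m X, X m = h & forall t : R, -1 <= t <= 1 -> X 0%N t = x t].
Proof.
move=> m0 cx [ix ih hw] hU.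
pose Y i := iter i (fun f => itg f (-1)) h.
pose Y' j := Y (m - j)%N.
have cY : chain m Y'.
  split; rewrite /Y' ?subnn//= => j jm t t1.
  have -> : (m - j = (m - j.+1).+1)%N by lia.
  by rewrite /Y !iterS itgxx add0r.
have cY0 := chain_cont cY m0.
have cw : {within `[-1, 1], continuous (fun t => x t - Y' 0%N t)}.
  by move=> s; apply: continuousB; [exact: cx|exact: cY0].
have [phi tp|q [sq xq]] := du_bois_reymond (k := m) cw.
  have dm := derive1n_within (k := m) tp.
  rewrite (@eq_itg _ _ (fun t => x t * derive1n m phi t - Y' 0%N t * derive1n m phi t)); last first.
    by move=> t _; ring.
  rewrite itgB ?lexx//; [|exact: integrable_IM|by apply: integrable_IM => //; exact: cont_integrable].
  have -> := chain_by_parts (i := 0%N) (j := m) cY tp (leqnn _).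
  have -> : itg (fun t => x t * derive1n m phi t) (-1) 1 = (-1) ^+ m * itg (fun t => h t * phi t) (-1) 1.
    exact: hw.
  by rewrite add0n /Y' subnn subrr.
exists (fun j t => Y' j t + q^`(j).[t]); split.
- have qm : q^`(m) = 0 by exact: derivn_poly0.
  have [a b c] := cY; have [a' b' c'] := chain_poly m q.
  split; first exact: integrable_ID.
    have [U hU'] := b; exists U => t t1; rewrite qm horner0 addr0; exact: hU'.
  move=> j jm t t1; rewrite c// c'// itgD ?lexx//.
  - ring.
  - by case/andP: t1.
  - exact: (chain_int cY).
  - exact: (chain_int (chain_poly m q)).
- by apply/funext => t; rewrite derivn_poly0// horner0 addr0 /Y' subnn.
- by move=> t t1; rewrite derivn0 -xq// addrC subrK.
Qed.

End Chains.

(** * Decay of Legendre coefficients and bounded variation *)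

Section Variation.
Variable R : realType.
Local Notation mu := (@lebesgue_measure R).
Local Notation L := (legendre R).
Implicit Types (v w y : R -> R) (p q : {poly R}) (t : R).

Lemma within_contM (f g : R -> R) : {within `[-1, 1], continuous f} ->
  {within `[-1, 1], continuous g} -> {within `[-1, 1], continuous (fun t => f t * g t)}.
Proof. by move=> cf cg x; exact: (continuousM (cf x) (cg x)). Qed.

(** For w(t) one may take the variation of v on [-1, t].  Bounding the
    increments of v by those of w avoids suprema over subdivisions. *)
Definition varies w v : Prop :=
  forall a b : R, -1 <= a -> a <= b -> b <= 1 -> `|v b - v a| <= w b - w a.

Lemma BV_varies v : bounded_variation (-1) 1 v -> exists w, varies w v.
Proof.
move=> bv; exists (fun t => fine (total_variation (-1) t v)) => a b a1 ab b1.
have fin c d : -1 <= c -> c <= d -> d <= 1 -> total_variation c d v \is a fin_num.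
  move=> c1 cd d1; apply/bounded_variationP => //.
  by apply: (bounded_variationr c1 cd); apply: bounded_variationl bv => //; exact: le_trans cd.
rewrite (total_variationD v a1 ab) fineD ?fin ?(le_trans ab)//.
rewrite addrAC subrr add0r -lee_fin fineK ?fin//; exact: total_variation_ge.
Qed.

Lemma varies_bounded w v : varies w v ->
  forall t, -1 <= t <= 1 -> `|v t| <= `|v (-1)| + (w 1 - w (-1)).
Proof.
move=> vw t /andP[t0 t1].
have := vw _ _ (lexx _) t0 t1; have := le_trans (normr_ge0 _) (vw _ _ t0 t1 (lexx _)).
have := ler_normD (v (-1)) (v t - v (-1)); rewrite addrC subrK.
by move: (`|_|) (`|_|) (`|_|) => A B C; lra.
Qed.

Lemma itg_primp p (a b : R) : -1 <= a -> a <= b -> b <= 1 ->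
  itg (horner p) a b = (primp p).[b] - (primp p).[a].
Proof.
move=> a1 ab b1; have dP t : is_derive t 1 (horner (primp p)) p.[t].
  by have := is_derive_horner (primp p) t; rewrite deriv_primp.
have cp : {within `[-1, 1], continuous (horner p)}.
  by apply: continuous_subspaceT => t; exact: continuous_horner.
exact: (itg_FTC a1 b1 dP cp ab).
Qed.

(** An integration by parts against a function of bounded variation: if the
    primitive P of p vanishes at both ends and is bounded by eps, then the
    integral of v p is bounded by eps times the variation of v.  Over [a, b],
    the increment of itg (v p) - v P is at most the variation of v over [a, b]
    times A (b - a) + eps; sum over a grid and refine. *)
Lemma itg_varies w v p (A eps : R) : integrable_I v -> varies w v ->
  (forall t, -1 <= t <= 1 -> `|p.[t]| <= A) ->
  (forall t, -1 <= t <= 1 -> `|(primp p).[t]| <= eps) -> intp p = 0 ->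
  `|itg (fun t => v t * p.[t]) (-1) 1| <= (w 1 - w (-1)) * eps.
Proof.
move=> vi vw pA pe p0; pose V := w 1 - w (-1).
have A0 : 0 <= A by apply: le_trans (normr_ge0 _) (pA 1 _); lra.
have e0 : 0 <= eps by apply: le_trans (normr_ge0 _) (pe 1 _); lra.
have V0 : 0 <= V by apply: le_trans (normr_ge0 _) (vw (-1) 1 _ _ _); lra.
have cp q : {within `[-1, 1], continuous (horner q)}.
  by apply: continuous_subspaceT => t; exact: continuous_horner.
have ip := cont_integrable (cp p).
have ivp : integrable_I (fun t => v t * p.[t]) by exact: integrable_IM.
pose Phi t := itg (fun t => v t * p.[t]) (-1) t - v t * (primp p).[t].
have step a b : -1 <= a -> a <= b -> b <= 1 ->
    `|Phi b - Phi a| <= (w b - w a) * (A * (b - a) + eps).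
  move=> a1 ab b1; rewrite /Phi.
  have icst : integrable_I (fun t => v t - v a).
    by apply: integrable_IB => //; apply: cont_integrable => t; exact: cst_continuous.
  have i1 : integrable_I (fun t => (v t - v a) * p.[t]) by exact: integrable_IM.
  have E : itg (fun t => v t * p.[t]) a b =
      itg (fun t => (v t - v a) * p.[t]) a b + v a * ((primp p).[b] - (primp p).[a]).
    rewrite -itg_primp// -itgZ// -itgD//; last exact: integrable_IZ.
    by apply: eq_itg => t _; ring.
  have -> : itg (fun t => v t * p.[t]) (-1) b - v b * (primp p).[b] -
     (itg (fun t => v t * p.[t]) (-1) a - v a * (primp p).[a]) =
     itg (fun t => (v t - v a) * p.[t]) a b - (v b - v a) * (primp p).[b].
    have := itg_prim_sub ivp a1 ab b1; rewrite E => /eqP; rewrite subr_eq => /eqP ->; ring.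
  rewrite mulrDr; apply: (le_trans (ler_normB _ _)); apply: lerD.
    rewrite mulrA; apply: itg_norm_le => // t /andP[ta tb].
    rewrite normrM ler_pM// ?pA//; last by rewrite (le_trans a1)//= (le_trans tb).
    apply: (le_trans (vw _ _ a1 ta (le_trans tb b1))); rewrite lerD2r.
    by rewrite -subr_ge0 (le_trans _ (vw _ _ (le_trans a1 ta) tb b1)).
  by rewrite normrM ler_pM// ?vw// pe// (le_trans a1 ab).
have grid K : (0 < K)%N -> `|Phi 1 - Phi (-1)| <= V * (A * (2 / K%:R) + eps).
  move=> K0; have K0' : (0 : R) < K%:R by rewrite ltr0n.
  pose s n : R := -1 + n%:R * (2 / K%:R).
  have sS n : s n.+1 - s n = 2 / K%:R by rewrite /s -natr1; ring.
  have sK : s K = 1 by rewrite /s mulrCA divff ?mulr1; [ring|rewrite lt0r_neq0].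
  have s0 : s 0%N = -1 by rewrite /s mul0r addr0.
  have h0 : 0 <= 2 / K%:R :> R by rewrite divr_ge0.
  have hn n : -1 <= s n by rewrite /s lerDl mulr_ge0.
  have hK n : (n <= K)%N -> s n <= 1.
    by move=> nK; rewrite -sK /s lerD2l ler_wpM2r// ler_nat.
  suff h n : (n <= K)%N -> `|Phi (s n) - Phi (s 0%N)| <= (w (s n) - w (s 0%N)) * (A * (2 / K%:R) + eps).
    by have := h K (leqnn K); rewrite sK s0.
  elim: n => [|n IH] nK; first by rewrite !subrr normr0 mul0r.
  have -> : Phi (s n.+1) - Phi (s 0%N) = (Phi (s n.+1) - Phi (s n)) + (Phi (s n) - Phi (s 0%N)) by ring.
  have -> : w (s n.+1) - w (s 0%N) = (w (s n.+1) - w (s n)) + (w (s n) - w (s 0%N)) by ring.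
  rewrite mulrDl; apply: (le_trans (ler_normD _ _)); apply: lerD; last by apply: IH; exact: ltnW.
  rewrite -(sS n); apply: step => //; last exact: hK.
  by rewrite -subr_ge0 sS.
have -> : itg (fun t => v t * p.[t]) (-1) 1 = Phi 1 - Phi (-1).
  by rewrite /Phi itgxx primpN1 -/(intp p) p0 !mulr0 !subr0.
apply/ler_addgt0Pr => e ep.
pose K := (Num.bound (V * A * 2 / e)).+1.
have K0 : (0 < K)%N by [].
have K0' : (0 : R) < K%:R by rewrite ltr0n.
have hK : V * A * 2 / e < K%:R.
  apply: (@lt_le_trans _ _ (Num.bound (V * A * 2 / e))%:R); last by rewrite ler_nat.
  by apply: archi_boundP; rewrite divr_ge0 ?mulr_ge0// ltW.
rewrite ltr_pdivrMr// in hK.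
apply: (le_trans (grid K K0)); rewrite mulrDr addrC lerD2l.
have -> : V * (A * (2 / K%:R)) = V * A * 2 / K%:R by rewrite !mulrA.
by rewrite ler_pdivrMr// [e * _]mulrC; exact: ltW.
Qed.

Lemma itg_horner p : itg (horner p) (-1) 1 = intp p.
Proof. by rewrite itg_primp ?lexx// ?primpN1 ?subr0//; lra. Qed.

(** Bounding the general term n^(-3/2) by differences of n^(-1/2) gives the
    sum of the series without any comparison with an integral. *)
Lemma inv_sqrt_telescope n : (0 < n)%N ->
  Num.sqrt (2 * n%:R) / (n * n.+1)%:R <= 3 * ((Num.sqrt n%:R)^-1 - (Num.sqrt n.+1%:R)^-1) :> R.
Proof.
move=> n0; have n0' : (0 : R) < n%:R by rewrite ltr0n.
set a := Num.sqrt n%:R; set b := Num.sqrt n.+1%:R.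
have a0 : 0 < a by rewrite sqrtr_gt0.
have b0 : 0 < b by rewrite sqrtr_gt0 ltr0n.
have aa : a ^+ 2 = n%:R by rewrite sqr_sqrtr// ltW.
have bb : b ^+ 2 = n.+1%:R by rewrite sqr_sqrtr.
have ab : a <= b by rewrite ler_sqrt ?ler_nat.
have d1 : b ^+ 2 - a ^+ 2 = 1 by rewrite aa bb -natr1 addrC addKr.
rewrite sqrtrM// -/a natrM -aa -bb.
have s2 : Num.sqrt 2 <= 3 / 2 :> R.
  by rewrite -(@ler_pXn2r _ 2) ?nnegrE ?sqrtr_ge0// ?sqr_sqrtr//; lra.
have -> : a^-1 - b^-1 = (b - a) / (a * b) by field; rewrite !lt0r_neq0.
rewrite ler_pdivrMr ?mulr_gt0 ?exprn_gt0//.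
have -> : 3 * ((b - a) / (a * b)) * (a ^+ 2 * b ^+ 2) = 3 * (b - a) * b * a.
  by field; rewrite !lt0r_neq0.
rewrite ler_wpM2r ?(ltW a0)//; apply: (le_trans s2).
have : (b - a) * (b + a) = 1 by rewrite -d1; ring.
by nra.
Qed.

(** * Legendre series of a primitive of a function of bounded variation *)

Section LegendreCoefficients.
Variables (w v y : R -> R).
Hypothesis vi : integrable_I v.
Hypothesis vw : varies w v.
Hypothesis yv : forall t, -1 <= t <= 1 -> y t = y (-1) + itg v (-1) t.

Let vbd := varies_bounded vw.

Let cy : {within `[-1, 1], continuous y}.
Proof.
apply: (within_eq (f := fun t => y (-1) + itg v (-1) t)) => [t t1|x]; first by rewrite [RHS]yv.
by apply: continuousD; [exact: cst_continuous|exact: itg_prim_cont].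
Qed.

Let yi : integrable_I y := cont_integrable cy.

Let cp p : {within `[-1, 1], continuous (horner p)}.
Proof. by apply: continuous_subspaceT => t; exact: continuous_horner. Qed.

Definition fun_lcoef n : R := (n%:R + 1 / 2) * itg (fun t => y t * (L n).[t]) (-1) 1.

Let V := w 1 - w (-1).

Let V0 : 0 <= V.
Proof. by apply: le_trans (normr_ge0 _) (vw _ _ _); lra. Qed.

(** (2n + 3) L_(n+1) is the derivative of L_(n+2) - L_n, which vanishes at
    both ends: an integration by parts moves the derivative to y. *)
Lemma fun_lcoefS n : fun_lcoef n.+1 = - (1 / 2) *
  (itg (fun t => v t * (L n.+2).[t]) (-1) 1 - itg (fun t => v t * (L n).[t]) (-1) 1).
Proof.
rewrite /fun_lcoef; pose q := L n.+2 - L n.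
have E : itg (fun t => y t * (L n.+1).[t]) (-1) 1 =
    (2 * n.+1%:R + 1)^-1 * itg (fun t => (y (-1) + itg v (-1) t) * q^`().[t]) (-1) 1.
  rewrite -itgZ ?lexx//; last first.
    apply: integrable_IM => //; apply: cont_integrable; apply: (within_eq (f := y)) => //.
  apply: eq_itg => t t1; rewrite -yv// /q derivB legendre_rec -mul_polyC hornerM hornerC.
  by rewrite mulrCA mulKf ?n21_neq0.
rewrite E (@itg_by_parts R (y (-1)) v (horner q) (horner q^`()) _ vi vbd (fun t => is_derive_horner q t))//.
have -> : q.[1] = 0 by rewrite /q hornerD hornerN !legendre1 subrr.
have -> : q.[-1] = 0 by rewrite /q hornerD hornerN !legendreN1 !exprS mulrA mulrNN !mul1r subrr.
rewrite !mulr0 subrr sub0r /q.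
rewrite -itgB ?lexx//; try exact: integrable_IM.
rewrite (@eq_itg _ (fun t => v t * (L n.+2 - L n).[t]) (fun t => v t * (L n.+2).[t] - v t * (L n).[t])); last first.
  by move=> t _; rewrite hornerD hornerN mulrBr.
have := @n21_neq0 R n.+1; set N := n.+1%:R => N0; field.
by [].
Qed.

(** Both integrals of [fun_lcoefS] are estimated by [itg_varies] and
    [primp_legendre_bound]. *)
Lemma fun_lcoef_bound n : (0 < n)%N -> `|fun_lcoef n.+1| <= 3 / 2 * V *
  ((Num.sqrt n%:R)^-1 - (Num.sqrt n.+1%:R)^-1 +
   ((Num.sqrt n.+2%:R)^-1 - (Num.sqrt n.+3%:R)^-1)).
Proof.
have h k : (0 < k)%N -> `|itg (fun t => v t * (L k).[t]) (-1) 1| <=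
    V * (3 * ((Num.sqrt k%:R)^-1 - (Num.sqrt k.+1%:R)^-1)).
  move=> k0; apply: (@le_trans _ _ (V * (Num.sqrt (2 * k%:R) / (k * k.+1)%:R))).
    apply: (itg_varies (A := 1)) => //.
    - by move=> t t1; exact: legendre_bound.
    - by move=> t t1; exact: primp_legendre_bound.
    - by rewrite -[L k]mulr1 legendre_orth// -polyC1 (leq_trans (size_polyC_leq1 _)).
  by rewrite ler_wpM2l// inv_sqrt_telescope.
move=> n0; rewrite fun_lcoefS normrM normrN.
have -> : `|1 / 2| = 1 / 2 :> R by rewrite ger0_norm// divr_ge0.
have := h n n0; have := h n.+2 isT.
set A := itg _ _ _; set B := itg _ _ _ => hA hB.
apply: (@le_trans _ _ (1 / 2 * (`|A| + `|B|))); first by rewrite ler_wpM2l ?divr_ge0// ler_normB.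
apply: (@le_trans _ _ (1 / 2 * (V * (3 * ((Num.sqrt n.+2%:R)^-1 - (Num.sqrt n.+3%:R)^-1)) +
   V * (3 * ((Num.sqrt n%:R)^-1 - (Num.sqrt n.+1%:R)^-1))))).
  by rewrite ler_wpM2l ?divr_ge0// lerD.
move: (_^-1) (_^-1) (_^-1) (_^-1) => a b c d.
by rewrite le_eqVlt; apply/orP; left; apply/eqP; field.
Qed.

Lemma fun_lcoef_summable : exists S : R, 0 <= S /\ forall K, \sum_(n < K) `|fun_lcoef n| <= S.
Proof.
pose d n : R := (Num.sqrt n.+1%:R)^-1.
have d01 n : 0 <= d n <= 1.
  by rewrite invr_ge0 sqrtr_ge0 invf_le1 ?sqrtr_gt0// -[X in X <= _]sqrtr1 ler_sqrt// ler1n.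
have h K : \sum_(n < K) `|fun_lcoef n.+2| <= 3 / 2 * V * (d 0%N - d K + (d 2%N - d K.+2)).
  elim: K => [|K IH]; first by rewrite big_ord0 !subrr addr0 mulr0.
  rewrite big_ord_recr /=; have := fun_lcoef_bound (n := K.+1) isT; rewrite -/(d K) -/(d K.+1) -/(d K.+2) -/(d K.+3).
  move=> hK; apply: (le_trans (lerD IH hK)).
  by rewrite le_eqVlt; apply/orP; left; apply/eqP; ring.
exists (`|fun_lcoef 0| + `|fun_lcoef 1| + 3 * V); split; first by rewrite !addr_ge0// mulr_ge0.
move=> K; apply: (@le_trans _ _ (\sum_(n < K.+2) `|fun_lcoef n|)).
  by rewrite 2!big_ord_recr /= -addrA lerDl addr_ge0.
rewrite 2!big_ord_recl /= addrA lerD2l; apply: (le_trans (h K)).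
have -> : 3 * V = 3 / 2 * V * 2 by field.
apply: ler_wpM2l; first by rewrite mulr_ge0//; lra.
by have := d01 0%N; have := d01 K; have := d01 2%N; have := d01 K.+2; lra.
Qed.

Definition legendre_sum K : {poly R} := \sum_(n < K) fun_lcoef n *: L n.

Lemma size_legendre_sum K : (size (legendre_sum K) <= K)%N.
Proof.
apply: (leq_trans (size_sum _ _ _)); apply/bigmax_leqP => i _.
by rewrite (leq_trans (size_scale_leq _ _))// size_legendre.
Qed.

Lemma legendre_sum_intp K n : (n < K)%N -> intp (legendre_sum K * L n) = fun_lcoef n * (2 / (2 * n%:R + 1)).
Proof.
move=> nK; rewrite /legendre_sum mulr_suml intp_sum (bigD1 (Ordinal nK))//= big1 => [|i ni].
  by rewrite addr0 -scalerAl intpZ legendre_norm2.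
by rewrite -scalerAl intpZ legendre_orth_neq ?mulr0.
Qed.

Lemma poly_lcoef_sum K n : (n < K)%N -> poly_lcoef (legendre_sum K) n = fun_lcoef n.
Proof.
move=> nK; rewrite /poly_lcoef legendre_sum_intp//.
by have := @n21_neq0 R n; set N := n%:R => N0; field.
Qed.

Lemma legendre_sum_residual_orth K q : (size q <= K)%N ->
  itg (fun t => (y t - (legendre_sum K).[t]) * q.[t]) (-1) 1 = 0.
Proof.
move=> sq; rewrite {1}(legendre_expansion sq).
have cz : {within `[-1, 1], continuous (fun t => y t - (legendre_sum K).[t])}.
  by move=> x; apply: continuousB; [exact: cy|exact: cp].
have zi := cont_integrable cz.
suff h k : (k <= K)%N ->
    itg (fun t => (y t - (legendre_sum K).[t]) * (\sum_(n < k) poly_lcoef q n *: L n).[t]) (-1) 1 = 0.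
  exact: h.
elim: k => [|k IH] kK.
  rewrite (@eq_itg _ _ (fun=> 0 * 0)); last by move=> t _; rewrite big_ord0 horner0 !mulr0.
  rewrite itgZ ?mul0r ?lexx//; apply: cont_integrable => x; exact: cst_continuous.
rewrite (@eq_itg _ _ (fun t => (y t - (legendre_sum K).[t]) * (\sum_(n < k) poly_lcoef q n *: L n).[t] +
    poly_lcoef q k * ((y t - (legendre_sum K).[t]) * (L k).[t]))); last first.
  by move=> t _; rewrite big_ord_recr hornerD hornerZ; ring.
have i1 p : integrable_I (fun t => (y t - (legendre_sum K).[t]) * p.[t]) by exact: integrable_IM.
rewrite itgD ?lexx//; last exact: integrable_IZ.
rewrite (IH (ltnW kK)) add0r itgZ ?lexx//.
rewrite (@eq_itg _ _ (fun t => y t * (L k).[t] - (legendre_sum K * L k).[t])); last first.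
  by move=> t _; rewrite hornerM; ring.
rewrite itgB ?lexx//; [|exact: integrable_IM|exact: cont_integrable].
rewrite itg_horner legendre_sum_intp// /fun_lcoef.
by have := @n21_neq0 R k; set N := k%:R => N0; field.
Qed.

(** The partial sum is the best approximation of y in L^2 among polynomials of
    degree at most n, so it is at least as good as the one of
    [jackson_lipschitz], for y is Lipschitz.  The inequality 2 |z| <= de + z^2
    / de passes from L^2 to L^1 without square roots. *)
Lemma legendre_sum_L1 : exists C : R, 0 <= C /\ forall n, (0 < n)%N ->
  itg (fun t => `|y t - (legendre_sum n.+1).[t]|) (-1) 1 <= C / n%:R.
Proof.
pose U := `|v (-1)| + V.
have U0 : 0 <= U by rewrite addr_ge0.
pose C := 160 * 163 * U + 1.
have C0 : 0 < C by rewrite ltr_wpDl// mulr_ge0.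
exists (2 * C); split; first by rewrite mulr_ge0// ltW.
move=> n n0; have n0' : (0 : R) < n%:R by rewrite ltr0n.
have [|p [sp hp]] := jackson_lipschitz (f := y) U0 n0.
  move=> s t; wlog st : s t / s <= t.
    move=> W s1 t1; have [st|/ltW ts] := leP s t; first exact: W.
    by rewrite distrC (distrC s) W.
  move=> s1 t1; rewrite distrC (distrC s) yv// (yv s1) opprD addrACA subrr add0r.
  move/andP: s1 => [s0 s1]; move/andP: t1 => [t0 t1].
  rewrite itg_prim_sub// [X in _ * X]ger0_norm ?subr_ge0//.
  apply: itg_norm_le => // r /andP[rs rt]; apply: vbd.
  by rewrite (le_trans s0)//= (le_trans rt).
pose de := C / n%:R; have de0 : 0 < de by rewrite divr_gt0.
have hp' t : -1 <= t <= 1 -> `|y t - p.[t]| <= de.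
  move=> t1; apply: (le_trans (hp t t1)); rewrite /de ler_wpM2r ?invr_ge0 ?(ltW n0')//.
  by rewrite /C lerDl.
pose z t := y t - (legendre_sum n.+1).[t].
have cz : {within `[-1, 1], continuous z}.
  by move=> x; apply: continuousB; [exact: cy|exact: cp].
have zi := cont_integrable cz.
have czz : {within `[-1, 1], continuous (fun t => z t * z t)}.
  exact: within_contM.
have zzi := cont_integrable czz.
have cyp : {within `[-1, 1], continuous (fun t => y t - p.[t])}.
  by move=> x; apply: continuousB; [exact: cy|exact: cp].
have cyp2 : {within `[-1, 1], continuous (fun t => (y t - p.[t]) * (y t - p.[t]))}.
  exact: within_contM.
have ypi := cont_integrable cyp2.
have zz : itg (fun t => z t * z t) (-1) 1 <= 2 * de ^+ 2.
  pose q := legendre_sum n.+1 - p.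
  have sq : (size q <= n.+1)%N.
    by apply: leq_trans (size_polyD _ _) _; rewrite size_polyN geq_max size_legendre_sum.
  apply: (@le_trans _ _ (itg (fun t => (y t - p.[t]) * (y t - p.[t])) (-1) 1)).
    rewrite -[X in X <= _]addr0 -(mulr0 2) -(legendre_sum_residual_orth sq) -itgZ ?lexx//; last exact: integrable_IM.
    rewrite -itgD ?lexx//; last by apply: integrable_IZ; exact: integrable_IM.
    apply: le_itg => //; rewrite ?lexx//.
      by apply: integrable_ID => //; apply: integrable_IZ; exact: integrable_IM.
    move=> t _; rewrite /z /q hornerD hornerN; set a := y t; set b := (legendre_sum _).[t]; set c := p.[t].
    rewrite -subr_ge0 (_ : _ - _ = (b - c) ^+ 2) ?sqr_ge0//; ring.
  apply: (le_trans (ler_norm _)).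
  have -> : 2 * de ^+ 2 = de * de * (1 - -1) by ring.
  apply: itg_norm_le; rewrite ?lexx//.
  by move=> t t1; rewrite normrM ler_pM// hp'.
have -> : 2 * C / n%:R = 2 * de by rewrite /de mulrA.
apply: (@le_trans _ _ (itg (fun t => de / 2 + (2 * de)^-1 * (z t * z t)) (-1) 1)).
  have ci : integrable_I (fun=> de / 2) by apply: cont_integrable => x; exact: cst_continuous.
  apply: le_itg; rewrite ?lexx//.
  - exact: integrable_norm zi.
  - by apply: integrable_ID => //; exact: integrable_IZ.
  move=> t _; rewrite -/(z t).
  have -> : z t * z t = `|z t| ^+ 2 by rewrite -normrX ger0_norm ?sqr_ge0// expr2.
  set a := `|z t|; rewrite -subr_ge0.
  have -> : de / 2 + (2 * de)^-1 * a ^+ 2 - a = (2 * de)^-1 * (de - a) ^+ 2.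
    by field; rewrite lt0r_neq0.
  by rewrite mulr_ge0 ?sqr_ge0// invr_ge0 mulr_ge0// ltW.
have ci : integrable_I (fun=> de / 2) by apply: cont_integrable => x; exact: cst_continuous.
rewrite itgD ?lexx//; last exact: integrable_IZ.
rewrite [X in _ + X]itgZ ?lexx//.
have -> : 2 * de = de + de by ring.
apply: lerD.
  apply: (le_trans (ler_norm _)).
  rewrite [X in _ <= X](_ : de = de / 2 * (1 - -1)); last by field.
  apply: itg_norm_le; rewrite ?lexx//.
  by move=> t _; rewrite ger0_norm// divr_ge0// ltW.
rewrite mulrC ler_pdivrMr ?addr_gt0//; apply: (le_trans zz).
by rewrite le_eqVlt; apply/orP; left; apply/eqP; ring.
Qed.

End LegendreCoefficients.

End Variation.

(** * Integrating a Legendre series back along a chain *)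

Section ChainApproximation.
Variable R : realType.
Local Notation L := (legendre R).
Implicit Types (p q : {poly R}) (t : R).

(** The i-fold primitive of P whose values at -1 are those of the chain: it
    approximates W_(d-i) when P approximates W_d. *)
Fixpoint lift_chain (W : nat -> R -> R) (d : nat) (P : {poly R}) (i : nat) : {poly R} :=
  if i is i'.+1 then (W (d - i)%N (-1))%:P + primp (lift_chain W d P i') else P.

Variables (l d : nat) (W : nat -> R -> R) (w : R -> R).
Hypothesis cW : chain l W.
Hypothesis dl : (d < l)%N.
Hypothesis vw : varies w (W d.+1).

Local Notation lift := (lift_chain W d).
Local Notation part := (legendre_sum (W d)).

Let vi : integrable_I (W d.+1). Proof. exact: (chain_int cW). Qed.
Let yv t : -1 <= t <= 1 -> W d t = W d (-1) + itg (W d.+1) (-1) t.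
Proof. by have [_ _ h] := cW; apply: h. Qed.

Lemma size_lift P i : (size (lift P i) <= size P + i)%N.
Proof.
elim: i => [|i IH] /=; first by rewrite addn0.
apply: leq_trans (size_polyD _ _) _; rewrite geq_max addnS.
by rewrite (leq_trans (size_polyC_leq1 _))// (leq_trans (size_primp _))// ltnS.
Qed.

Lemma deriv_lift P i : (lift P i.+1)^`() = lift P i.
Proof. by rewrite /= derivD derivC add0r deriv_primp. Qed.

Lemma derivn_lift P i j : (j <= i)%N -> (lift P i)^`(j) = lift P (i - j).
Proof.
elim: j => [|j IH] ji; first by rewrite derivn0 subn0.
rewrite derivnS IH; last exact: ltnW.
have -> : (i - j = (i - j.+1).+1)%N by clear -ji; lia.
exact: deriv_lift.
Qed.

Lemma lift_init P i : (lift P i.+1).[-1] = W (d - i.+1)%N (-1).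
Proof. by rewrite /= hornerD hornerC primpN1 addr0. Qed.

Lemma lift_prim P i t : -1 <= t <= 1 ->
  (lift P i.+1).[t] = W (d - i.+1)%N (-1) + itg (horner (lift P i)) (-1) t.
Proof.
move=> /andP[t0 t1]; rewrite itg_primp// primpN1 subr0 /= hornerD hornerC.
by [].
Qed.

Let cp p : {within `[-1, 1], continuous (horner p)}.
Proof. by apply: continuous_subspaceT => t; exact: continuous_horner. Qed.

Let cWj j : (j <= d)%N -> {within `[-1, 1], continuous (W j)}.
Proof. by move=> jd; apply: (chain_cont cW); exact: leq_ltn_trans dl. Qed.

Lemma lift_error_step P i (e : R) : (i < d)%N ->
  (forall t, -1 <= t <= 1 -> `|W (d - i)%N t - (lift P i).[t]| <= e) ->
  forall t, -1 <= t <= 1 -> `|W (d - i.+1)%N t - (lift P i.+1).[t]| <= 2 * e.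
Proof.
move=> id h t t1; have [_ _ cWe] := cW.
have e0 : 0 <= e by apply: le_trans (normr_ge0 _) (h 1 _); lra.
rewrite lift_prim// cWe//; last by lia.
have -> : ((d - i.+1).+1 = d - i)%N by lia.
rewrite opprD addrACA subrr add0r; move/andP: (t1) => [t0 t2].
have iW : integrable_I (W (d - i)%N) by apply: cont_integrable; apply: cWj; lia.
have iP : integrable_I (horner (lift P i)) by exact: cont_integrable.
rewrite -itgB ?lexx//; apply: (@le_trans _ _ (e * (t - -1))).
  apply: itg_norm_le; rewrite ?lexx//; first exact: integrable_IB.
  by move=> s /andP[s0 s1]; apply: h; rewrite s0 (le_trans s1).
by rewrite mulrC ler_wpM2r//; lra.
Qed.

Lemma lift_error_iter P i j (e : R) : (i + j <= d)%N ->
  (forall t, -1 <= t <= 1 -> `|W (d - i)%N t - (lift P i).[t]| <= e) ->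
  forall t, -1 <= t <= 1 -> `|W (d - (i + j))%N t - (lift P (i + j)).[t]| <= 2 ^+ j * e.
Proof.
move=> ijd h; elim: j ijd => [|j IH] ijd t t1; first by rewrite addn0 mul1r h.
rewrite exprS -mulrA addnS; apply: lift_error_step => //; first lia.
by apply: IH; lia.
Qed.

(** One integration turns an error in L^1 into a uniform one. *)
Lemma lift_error_L1 P : (0 < d)%N -> forall t, -1 <= t <= 1 ->
  `|W (d - 1)%N t - (lift P 1).[t]| <= itg (fun s => `|W d s - P.[s]|) (-1) 1.
Proof.
move=> d0 t t1; have [_ _ cWe] := cW.
rewrite lift_prim// cWe//; last by lia.
have -> : ((d - 1).+1 = d)%N by lia.
rewrite opprD addrACA subrr add0r; move/andP: (t1) => [t0 t2].
have iW : integrable_I (W d) by apply: cont_integrable; exact: cWj.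
have iP : integrable_I (horner P) by exact: cont_integrable.
have iB := integrable_IB iW iP.
have iN : integrable_I (fun s => `|W d s - P.[s]|) by exact: integrable_norm iB.
rewrite -itgB ?lexx// (@itg_split _ (-1) 1 _ _ (fun s => `|W d s - P.[s]|) t) ?lexx//.
apply: (le_trans (le_normr_Rintegral _ _)).
- exact: measurable_itv.
- exact: integrable_sub.
by rewrite -/(itg _ (-1) t) lerDl itg_ge0.
Qed.

(** The initial values cancel in the difference of two lifts, and the
    primitives vanishing at -1 of the remaining terms are the [iterL]. *)
Lemma lift_part_diff M K i : (i <= M)%N -> (M <= K)%N ->
  lift (part K) i - lift (part M) i = \sum_(M <= n < K) fun_lcoef (W d) n *: iterL R i n.
Proof.
elim: i => [|i IH] iM MK.
  rewrite /= /legendre_sum -!(big_mkord xpredT (fun n => fun_lcoef (W d) n *: L n)).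
  by rewrite (big_cat_nat (n := M))//= addrAC subrr add0r.
have liftS P : lift P i.+1 = (W (d - i.+1)%N (-1))%:P + primp (lift P i) by [].
rewrite !liftS opprD addrACA subrr add0r; apply/eqP; rewrite subr_eq; apply/eqP.
apply: primp_eq.
  rewrite derivD deriv_primp; apply/eqP; rewrite eq_sym -subr_eq; apply/eqP.
  rewrite (IH (ltnW iM) MK) linear_sum big_nat [RHS]big_nat; apply: eq_bigr => n /andP[Mn _].
  by rewrite /= derivZ deriv_iterL// (leq_trans iM).
rewrite hornerD primpN1 addr0 horner_sum big_nat big1// => n /andP[Mn _].
by rewrite hornerZ iterLN1 ?mulr0// (leq_trans iM).
Qed.

Variable S : R.
Hypothesis hS : forall K, \sum_(n < K) `|fun_lcoef (W d) n| <= S.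

Lemma part_bound K t : -1 <= t <= 1 -> `|(part K).[t]| <= S.
Proof.
move=> t1; rewrite /legendre_sum horner_sum; apply: le_trans (hS K).
apply: (le_trans (ler_norm_sum _ _ _)); apply: ler_sum => n _.
by rewrite hornerZ normrM ler_piMr// legendre_bound.
Qed.

(** The error of the lifted partial sum is the tail of the lifted series,
    whose terms are O((M - k + 1)^-k) times summable coefficients.  The lifted
    series does converge to W_(d-k): compare with a partial sum of large order
    n0, whose lift is close by the L^1 estimate. *)
Lemma lift_part_error M k t : (0 < k <= d)%N -> (k <= M)%N -> -1 <= t <= 1 ->
  `|W (d - k)%N t - (lift (part M) k).[t]| <= S * ((M - k).+1%:R^-1) ^+ k.
Proof.
move=> /andP[k0 kd] kM t1.
have [C [C0 hC]] := legendre_sum_L1 vi vw yv.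
apply/ler_addgt0Pr => e e0.
pose n0 := (Num.bound (2 ^+ k.-1 * C / e) + M).+1.
have n00 : (0 < n0)%N by [].
have n0' : (0 : R) < n0%:R by rewrite ltr0n.
have h0 := hC n0 n00.
have hK : `|W (d - k)%N t - (lift (part n0.+1) k).[t]| <= e.
  have -> : k = (1 + k.-1)%N by lia.
  apply: (@le_trans _ _ (2 ^+ k.-1 * (C / n0%:R))).
    apply: lift_error_iter => //; first lia.
    by move=> s s1; apply: le_trans h0; apply: lift_error_L1 => //; lia.
  rewrite mulrA ler_pdivrMr// [e * _]mulrC -ler_pdivrMr//.
  apply: (@le_trans _ _ (Num.bound (2 ^+ k.-1 * C / e))%:R).
    by apply: ltW; apply: archi_boundP; rewrite divr_ge0 ?mulr_ge0 ?exprn_ge0// ltW.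
  by rewrite ler_nat /n0; lia.
have -> : W (d - k)%N t - (lift (part M) k).[t] =
    (W (d - k)%N t - (lift (part n0.+1) k).[t]) + (lift (part n0.+1) k - lift (part M) k).[t].
  by rewrite hornerD hornerN; ring.
apply: (le_trans (ler_normD _ _)); rewrite addrC; apply: lerD => //.
rewrite lift_part_diff//; last by rewrite /n0; lia.
rewrite horner_sum; apply: (le_trans (ler_norm_sum _ _ _)).
apply: (@le_trans _ _ (\sum_(M <= n < n0.+1) `|fun_lcoef (W d) n| * ((M - k).+1%:R^-1) ^+ k)).
  rewrite big_nat [leRHS]big_nat; apply: ler_sum => n /andP[Mn _].
  rewrite hornerZ normrM ler_wpM2l//.
  apply: (le_trans (iterL_bound (k := k) (n := n) _ t1)); first by rewrite (leq_trans kM).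
  rewrite ler_pXn2r ?nnegrE ?invr_ge0// lef_pV2 ?posrE// ler_nat; lia.
rewrite -mulr_suml ler_wpM2r ?exprn_ge0 ?invr_ge0//.
apply: le_trans (hS n0.+1).
rewrite -(big_mkord xpredT (fun n => `|fun_lcoef (W d) n|)) [leRHS](big_cat_nat (n := M))//=; last by rewrite /n0; lia.
by rewrite lerDr sumr_ge0.
Qed.

Lemma lift_part_bounded i : (i <= d)%N ->
  exists B : R, 0 <= B /\ forall M t, -1 <= t <= 1 -> `|(lift (part M) i).[t]| <= B.
Proof.
have S0 : 0 <= S by have := hS 0; rewrite big_ord0.
elim: i => [|i IH] id; first by exists S; split => // M t t1; exact: part_bound.
have [B [B0 hB]] := IH (ltnW id).
exists (`|W (d - i.+1)%N (-1)| + 2 * B); split; first by rewrite addr_ge0// mulr_ge0.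
move=> M t /andP[t0 t1]; rewrite lift_prim ?t0//; apply: (le_trans (ler_normD _ _)).
rewrite lerD2l; apply: (@le_trans _ _ (B * (t - -1))).
  apply: itg_norm_le; rewrite ?lexx//; first exact: cont_integrable.
  by move=> s /andP[s0 s1]; apply: hB; rewrite s0 (le_trans s1).
by rewrite mulrC ler_wpM2r//; lra.
Qed.

End ChainApproximation.

(** * Bounds on the interpolation of a feasible point *)

Lemma size_derivn_le (R : realType) (p : {poly R}) j : (size p^`(j) <= size p - j)%N.
Proof.
elim: j => [|j IH]; first by rewrite derivn0 subn0.
rewrite derivnS; have [->|p0] := eqVneq p^`(j) 0; first by rewrite deriv0 size_poly0.
by have := lt_size_deriv p0; lia.
Qed.

Section NodalValues.
Variables (R : realType) (N : nat).
Hypothesis N0 : (0 < N)%N.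
Local Notation t_ k := (@lgl_node R N k).
Implicit Types (p q : {poly R}).

Definition nodal p : 'cV[R]_N.+1 := \col_k p.[t_ k].

Lemma lgl_D_nodal p : (size p <= N.+1)%N -> lgl_D R N *m nodal p = nodal p^`().
Proof.
move=> sp; apply/colP => k; rewrite !mxE -(lgl_D_deriv N0 k sp).
by apply: eq_bigr => j _; congr (_ * _); rewrite mxE.
Qed.

Lemma lgl_D_nodal_iter p j : (size p <= N.+1)%N ->
  lgl_D R N ^+ j *m nodal p = nodal p^`(j).
Proof.
move=> sp; elim: j => [|j IH]; first by rewrite expr0 mul1mx derivn0.
rewrite exprS -mulmxE -mulmxA IH lgl_D_nodal ?derivnS//.
by apply: leq_trans (size_derivn_le _ _) _; lia.
Qed.

(** The discrete spectral coefficients are true Legendre coefficients, because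
    the quadrature is exact on the product of L_n and the derivative. *)
Lemma spectral_lcoef r' (x : 'M[R]_(r'.+1, N.+1)) p m1 n :
  (row ord_max x)^T = nodal p -> (size p <= N.+1)%N ->
  (size p^`(m1) + n <= 2 * N)%N ->
  spectral_coef m1 x n = poly_lcoef p^`(m1) n.
Proof.
move=> xp sp sn; rewrite /spectral_coef /poly_lcoef xp lgl_D_nodal_iter//; congr (_ * _).
rewrite -(quad_exact N0); last first.
  have [->|p0] := eqVneq p^`(m1) 0; first by rewrite mul0r size_poly0.
  by rewrite size_mul ?legendre_neq0// size_legendre addnS /=.
by apply: eq_bigr => k _; rewrite mxE hornerM; ring.
Qed.

End NodalValues.

Lemma poly_growth (R : realType) (q : {poly R}) (c C : R) : 0 <= C -> `|q.[-1]| <= c ->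
  (forall t : R, -1 <= t <= 1 -> `|q^`().[t]| <= C) ->
  forall t : R, -1 <= t <= 1 -> `|q.[t]| <= c + 2 * C.
Proof.
move=> C0 qc qC t /andP[t0 t1].
have h : `|q.[t] - q.[-1]| <= C * (t - -1).
  apply: (MVT_le (h := horner q) (h' := horner q^`())) => // s /andP[s0 s1].
  by apply: qC; rewrite s0 (le_trans s1).
rewrite -(subrK q.[-1] q.[t]); apply: (le_trans (ler_normD _ _)); rewrite addrC; apply: lerD => //.
by apply: (le_trans h); rewrite mulrC ler_wpM2r//; lra.
Qed.

Lemma common_bound (R : realType) (T : Type) (P : T -> R -> Prop) (f : nat -> T -> R -> R) (m : nat) :
  (forall j, (j <= m)%N -> exists C : R, forall s t, P s t -> `|f j s t| <= C) ->
  exists C : R, forall j s t, (j <= m)%N -> P s t -> `|f j s t| <= C.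
Proof.
elim: m => [|m IH] h.
  by have [C hC] := h 0%N (leqnn _); exists C => j s t; rewrite leqn0 => /eqP ->; exact: hC.
have [j jm|C hC] := IH; first by apply: h; exact: leqW.
have [C' hC'] := h _ (leqnn _); exists (Num.max C C') => j s t.
rewrite leq_eqVlt ltnS => /predU1P[->|jm] st; first by rewrite le_max hC' ?orbT.
by rewrite le_max hC.
Qed.

Section FeasiblePoints.
Variables (R : realType) (r' : nat) (B : problemB R r').
Local Notation r := r'.+1.
Local Notation t_ k := (lgl_node R k).

Lemma interpolates_row N (x : 'M[R]_(r, N.+1)) (p : 'I_r -> {poly R}) i :
  interpolates x p -> (row i x)^T = nodal N (p i).
Proof. by move=> h; apply/colP => k; rewrite !mxE (h i).2. Qed.

Lemma interpolates_col N (x : 'M[R]_(r, N.+1)) (p : 'I_r -> {poly R}) k :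
  interpolates x p -> col k x = interp_state p (t_ k).
Proof. by move=> h; apply/colP => i; rewrite !mxE (h i).2. Qed.

(** All feasible points of all the discrete problems, with their
    interpolations, are collected in one type, so that a bound independent of
    N and of the point becomes uniformity over an index type. *)
Record interpolant (m1 : nat) (b : bounds R r') := Interpolant {
  deg : nat;
  state : 'M[R]_(r, deg.+1);
  control : 'rV[R]_deg.+1;
  poly : 'I_r -> {poly R};
  deg_large : (r + m1 + 1 < deg)%N;
  feasible : feasibleBN B m1 b state control;
  interp : interpolates state poly }.

Section OneInterpolant.
Variables (m1 : nat) (b : bounds R r') (s : interpolant m1 b).
Local Notation N := (deg s).
Local Notation x := (state s).
Local Notation u := (control s).
Local Notation p := (poly s).

Lemma deg_gt0 : (0 < N)%N. Proof. by have := deg_large s; lia. Qed.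

(** Both sides have degree at most N and the same values at the N + 1 nodes.
    *)
Lemma poly_deriv (i j : 'I_r) : j = i.+1 :> nat -> (p i)^`() = p j.
Proof.
move=> ij; have [[h _] _ _ _ _] := feasible s.
have hp := interp s; apply: (lgl_poly_eq deg_gt0).
- by apply: leq_trans (size_derivn_le (p i) 1) _; have := (hp i).1; lia.
- exact: (hp j).1.
move=> k; have := h i j ij; rewrite !(interpolates_row _ hp) lgl_D_nodal ?deg_gt0//; last exact: (hp i).1.
by move=> /colP/(_ k); rewrite !mxE.
Qed.

Lemma poly_derivn (i : 'I_r) : p i = (p ord0)^`(i).
Proof.
case: i => i; elim: i => [|i IH] ir; first by rewrite derivn0; congr p; exact: val_inj.
have -> : (p ord0)^`(Ordinal ir) = (p (Ordinal (ltnW ir)))^`() by rewrite IH -derivnS.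
by apply/esym; apply: poly_deriv.
Qed.

Lemma size_poly_last : (size (p ord_max) <= N.+1 - r')%N.
Proof.
rewrite poly_derivn; apply: leq_trans (size_derivn_le _ _) _.
by have := (interp s ord0).1; rewrite /=; lia.
Qed.

Lemma poly_init : interp_state p (-1) = x0 B.
Proof.
have [_ h _ _ _] := feasible s.
by rewrite -h (interpolates_col _ (interp s)) lgl_node0 ?deg_gt0.
Qed.

Lemma poly_control k : interp_control B p (t_ k) = u 0 k.
Proof.
have [[_ h] _ _ _ _] := feasible s; have hp := interp s.
have := h k; rewrite (interpolates_row _ hp) lgl_D_nodal ?deg_gt0//; last exact: (hp _).1.
rewrite mxE (interpolates_col _ hp) /interp_control => ->.
by rewrite addrAC subrr add0r mulrC mulKf// g_neq0.
Qed.

(** The derivative of order m1 is the sum of its Legendre series, whose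
    coefficients are those bounded by the spectral constraint.  Their number N
    - r - m1 + 2 is exactly what the degree requires, since the last component
    is the (r - 1)-st derivative of a polynomial of degree at most N. *)
Lemma poly_top_bound (t : R) : (0 < m1)%N -> -1 <= t <= 1 ->
  `|(p ord_max)^`(m1).[t]| <= bd b.
Proof.
move=> m0 t1; have [_ _ _ _ h] := feasible s; have Nl := deg_large s.
have sl := size_poly_last; have sd := size_derivn_le (p ord_max) m1.
have sM : (size (p ord_max)^`(m1) <= N.+2 - r - m1)%N by lia.
rewrite [X in X.[t]](legendre_expansion sM) horner_sum; apply: le_trans h.
apply: (le_trans (ler_norm_sum _ _ _)); apply: ler_sum => n _.
rewrite (spectral_lcoef deg_gt0 (interpolates_row _ (interp s))); last 2 first.
- exact: (interp s _).1.
- apply: (leq_trans (leq_add sM (ltnW (ltn_ord n)))).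
  by rewrite addnn -mul2n leq_mul2l /=; clear -m0 Nl; lia.
by rewrite hornerZ normrM ler_piMr// legendre_bound.
Qed.

Lemma poly_bnd_deriv j : (1 <= j <= m1.-1)%N ->
  bjlo b j <= (p ord_max)^`(j).[-1] <= bjhi b j.
Proof.
have [_ _ _ h _] := feasible s; move=> /h.
rewrite (interpolates_row _ (interp s)) lgl_D_nodal_iter ?deg_gt0//; last exact: (interp s _).1.
by rewrite mxE lgl_node0 ?deg_gt0.
Qed.

End OneInterpolant.

(** Downward induction on the order from [poly_top_bound]: a derivative is
    bounded by its value at -1, controlled by the constraints, and by the
    bound on the next derivative. *)
Lemma poly_last_bounded m1 b : (0 < m1)%N -> exists C : R,
  forall j (s : interpolant m1 b) (t : R), (j <= m1)%N -> -1 <= t <= 1 ->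
  `|(poly s ord_max)^`(j).[t]| <= C.
Proof.
move=> m0.
have [j jm|C hC] := @common_bound R (interpolant m1 b) (fun _ t => -1 <= t <= 1)
   (fun j s t => (poly s ord_max)^`(j).[t]) m1; last by exists C.
elim: {j}(m1 - j)%N {-2}j jm (erefl (m1 - j)%N) => [|d IH] j jm jd.
  have -> : j = m1 by lia.
  by exists (bd b) => s t; exact: poly_top_bound.
have [||C hC] := IH j.+1; [lia|lia|].
have [j0|j0] := posnP j.
  exists (`|x0 B ord_max 0| + 2 * `|C|) => s; apply: poly_growth => //.
    by rewrite j0 derivn0 -(poly_init s) mxE.
  by move=> t t1; rewrite -derivnS; apply: le_trans (ler_norm C); exact: hC.
exists (`|bjlo b j| + `|bjhi b j| + 2 * `|C|) => s; apply: poly_growth => //.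
  have /andP[h1 h2] : bjlo b j <= (poly s ord_max)^`(j).[-1] <= bjhi b j.
    by apply: poly_bnd_deriv; lia.
  rewrite ler_norml; have := ler_norm (bjhi b j); have := ler_norm (- bjlo b j).
  have := normr_ge0 (bjhi b j); have := normr_ge0 (bjlo b j); rewrite normrN.
  by move: h1 h2; move: (_.[_]) `|_| `|_| => A b1 b2; lra.
by move=> t t1; rewrite -derivnS; apply: le_trans (ler_norm C); exact: hC.
Qed.

Lemma poly_all_bounded m1 b : (0 < m1)%N -> exists C : R,
  forall (i : 'I_r) (s : interpolant m1 b) (t : R), -1 <= t <= 1 ->
  `|(poly s i).[t]| <= C.
Proof.
move=> m0.
have [j jr|C hC] := @common_bound R (interpolant m1 b) (fun _ t => -1 <= t <= 1)
   (fun j s t => (poly s (inord j)).[t]) r'; last first.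
  by exists C => i s t t1; have := hC i s t (ltn_ord i) t1; rewrite inord_val.
elim: {j}(r' - j)%N {-2}j jr (erefl (r' - j)%N) => [|d IH] j jr jd.
  have -> : j = r' by lia.
  have -> : inord r' = ord_max :> 'I_r by apply: val_inj; rewrite /= inordK.
  have [C hC] := poly_last_bounded b m0.
  by exists C => s t t1; have := hC 0%N s t isT t1; rewrite derivn0.
have [||C hC] := IH j.+1; [lia|lia|].
exists (`|x0 B (inord j) 0| + 2 * `|C|) => s; apply: poly_growth => //.
  by rewrite -(poly_init s) mxE.
move=> t t1; rewrite (@poly_deriv _ _ s (inord j) (inord j.+1)); last by rewrite !inordK//; lia.
by apply: le_trans (ler_norm C); exact: hC.
Qed.

End FeasiblePoints.

(** * Uniform quadrature error of the cost *)

Lemma CkS (R : realType) k n (f : 'cV[R]_n.+1 -> R) : Ck k.+1 f -> Ck k f.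
Proof.
elim: k f => [|k IH] f [cf h]; first by split.
by split => // i; have [d c] := h i; split => //; exact: IH.
Qed.

Lemma Ck_le (R : realType) k l n (f : 'cV[R]_n.+1 -> R) : (k <= l)%N -> Ck l f -> Ck k f.
Proof.
move=> kl; rewrite -(subnKC kl); elim: (l - k)%N => [|d IH]; first by rewrite addn0.
by rewrite addnS => /CkS.
Qed.

Lemma Ck_continuous (R : realType) k n (f : 'cV[R]_n.+1 -> R) : Ck k f -> continuous f.
Proof. by case: k => [|k] []. Qed.

Section QuadratureError.
Variables (R : realType) (I : Type).
Local Notation t_ k := (lgl_node R k).

Lemma unif_smooth_seq k (h : I -> R -> R) : unif_smooth k h -> exists H : nat -> I -> R -> R,
  [/\ H 0%N = h, forall j i (t : R), (j < k)%N -> is_derive t 1 (H j i) (H j.+1 i t) &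
   exists C : R, forall i (t : R), -1 <= t <= 1 -> `|H k i t| <= C].
Proof.
elim: k h => [|k IH] h [hb hd]; first by exists (fun=> h).
have [h' [dh /IH[H [H0 Hd [C hC]]]]] := hd.
exists (fun j => if j is j'.+1 then H j' else h); split => //.
- by case=> [|j] i t; rewrite ?H0// ltnS => jk; exact: Hd.
- by exists C.
Qed.

Lemma unif_smooth_continuous k (h : I -> R -> R) i : (0 < k)%N -> unif_smooth k h ->
  {within `[-1, 1], continuous (h i)}.
Proof.
case: k => // k _ [_ [h' [dh _]]].
by apply: derivable_within_continuous => t _; apply: ex_derive; exact: dh.
Qed.

(** On the approximating polynomial of [jackson], of degree at most N + k, the
    quadrature is exact because k < N; the remainder is integrated and summed
    with weights of total mass 2. *)
Lemma quadrature_error k (h : I -> R -> R) : (0 < k)%N -> unif_smooth k h ->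
  exists C : R, 0 <= C /\ forall i N, (k < N)%N ->
    `|itg (h i) (-1) 1 - \sum_(j < N.+1) h i (t_ j) * lgl_weight R j| <= C / N%:R ^+ k.
Proof.
move=> k0 uh; have [H [H0 Hd [M hM]]] := unif_smooth_seq uh.
have [C [C0 hC]] := @jackson R k.
exists (4 * (C * `|M|)); split; first by rewrite !mulr_ge0// ltW.
move=> i N kN; have N0 : (0 < N)%N by lia.
have Hi j (t : R) : (j < k)%N -> is_derive t 1 (H j i) (H j.+1 i t) by exact: Hd.
have Mi (t : R) : -1 <= t <= 1 -> `|H k i t| <= `|M|.
  by move=> t1; apply: le_trans (ler_norm M); exact: hM.
have [p [sp hp]] := hC (fun j => H j i) `|M| N (normr_ge0 _) N0 Hi Mi.
set e := C * `|M| / N%:R ^+ k in hp.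
have ch := unif_smooth_continuous (i := i) k0 uh; have ih := cont_integrable ch.
have cp : {within `[-1, 1], continuous (horner p)}.
  by apply: continuous_subspaceT => t; exact: continuous_horner.
have ip := cont_integrable cp.
have sp2 : (size p <= 2 * N)%N by lia.
have E : itg (horner p) (-1) 1 = \sum_(j < N.+1) p.[t_ j] * lgl_weight R j.
  by rewrite itg_horner -(quad_exact N0 sp2).
have -> : itg (h i) (-1) 1 - \sum_(j < N.+1) h i (t_ j) * lgl_weight R j =
    itg (fun t => h i t - p.[t]) (-1) 1 - \sum_(j < N.+1) (h i (t_ j) - p.[t_ j]) * lgl_weight R j.
  rewrite itgB ?lexx// E -addrA; congr (_ + _); rewrite -opprD -big_split/=; congr (- _).
  by apply: eq_bigr => j _; ring.
have -> : 4 * (C * `|M|) / N%:R ^+ k = e * (1 - -1) + e * 2 by rewrite /e; ring.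
have hp' t : -1 <= t <= 1 -> `|h i t - p.[t]| <= e by rewrite -H0; exact: hp.
apply: (le_trans (ler_normB _ _)); apply: lerD.
  by apply: itg_norm_le; rewrite ?lexx//; exact: integrable_IB.
rewrite -(sum_lgl_weight R N0) mulr_sumr; apply: (le_trans (ler_norm_sum _ _ _)).
apply: ler_sum => j _; rewrite normrM [X in _ * X]ger0_norm ?lgl_weight_ge0// ler_wpM2r ?lgl_weight_ge0//.
by apply: hp'; exact: lgl_node_itv.
Qed.

End QuadratureError.

Section UniformFamilies.
Variables (R : realType) (r' : nat) (B : problemB R r') (I : Type).
Local Notation r := r'.+1.
Local Notation t_ k := (lgl_node R k).

(** What the interpolations of feasible points and the approximants of the
    optimal trajectory have in common, and what the quadrature estimate needs:
    the components are successive derivatives, all bounded uniformly on [-1,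
    1], together with the derivatives of the last one up to the order k. *)
Definition uniform_family (k : nat) (Y : I -> 'I_r -> {poly R}) : Prop :=
  [/\ forall s (i j : 'I_r), j = i.+1 :> nat -> (Y s i)^`() = Y s j,
      exists C : R, forall i s (t : R), -1 <= t <= 1 -> `|(Y s i).[t]| <= C &
      exists C : R, forall j s (t : R), (j <= k)%N -> -1 <= t <= 1 ->
        `|(Y s ord_max)^`(j).[t]| <= C].

Variables (k : nat) (Y : I -> 'I_r -> {poly R}).
Hypothesis uY : uniform_family k.+1 Y.

Lemma unif_smooth_last j d : (j + d = k.+1)%N -> unif_smooth d (fun s t => (Y s ord_max)^`(j).[t]).
Proof.
have [_ _ [C hC]] := uY.
elim: d j => [|d IH] j jd; split => //.
- by exists C => s t; apply: hC; lia.
- by exists C => s t; apply: hC; lia.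
exists (fun s t => (Y s ord_max)^`(j.+1).[t]); split; last by apply: IH; lia.
by move=> s t; rewrite derivnS; exact: is_derive_horner.
Qed.

Lemma unif_smooth_component (i : 'I_r) : unif_smooth k.+1 (fun s t => (Y s i).[t]).
Proof.
have [dY [C hC] _] := uY.
suff h j : (j <= r')%N -> unif_smooth k.+1 (fun s t => (Y s (inord j)).[t]).
  by have := h i (ltn_ord i); rewrite inord_val.
elim: {j}(r' - j)%N {-2}j (erefl (r' - j)%N) => [|d IH] j jd jr.
  have -> : j = r' by lia.
  have -> : inord r' = ord_max :> 'I_r by apply: val_inj; rewrite /= inordK.
  exact: (unif_smooth_last (j := 0)).
split; first by exists C => s t; exact: hC.
exists (fun s t => (Y s (inord j.+1)).[t]); split; last by apply: unif_smoothW; apply: IH; lia.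
have e : (inord j.+1 : 'I_r) = (inord j : 'I_r).+1 :> nat by rewrite !inordK//; lia.
by move=> s t; rewrite -(dY s _ _ e); exact: is_derive_horner.
Qed.

Lemma unif_smooth_state (i : 'I_r) : unif_smooth k.+1 (fun s t => interp_state (Y s) t i 0).
Proof. by apply: unif_smooth_eq (unif_smooth_component i) => s t; rewrite mxE. Qed.

Hypothesis fk : Ck k (f B).
Hypothesis gk : Ck k (g B).

(** The states stay in a common box, which is compact, and g has no zero
    there. *)
Lemma state_g_inv_bounded : exists C : R, forall s (t : R), -1 <= t <= 1 ->
  `|(g B (interp_state (Y s) t))^-1| <= C.
Proof.
have [_ [C hC] _] := uY.
have cV : continuous (fun x => (g B x)^-1).
  by move=> x; apply: continuousV; [exact: g_neq0|exact: (Ck_continuous gk)].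
have [M hM] := box_bounded C cV; exists M => s t t1; apply: hM => j.
by rewrite mxE hC.
Qed.

Lemma unif_smooth_control : unif_smooth k (fun s t => interp_control B (Y s) t).
Proof.
have us i := unif_smoothW (unif_smooth_state i).
apply: unif_smoothM.
  apply: unif_smoothD; first exact: (unif_smooth_last (j := 1)).
  by apply: unif_smoothN; exact: unif_smooth_comp.
apply: unif_smoothV; [by move=> s t; exact: g_neq0|exact: state_g_inv_bounded|exact: unif_smooth_comp].
Qed.

Hypothesis Fk : Ck k (F B).

Lemma unif_smooth_cost : unif_smooth k (fun s t => F B (xu (interp_state (Y s) t) (interp_control B (Y s) t))).
Proof.
apply: (@unif_smooth_comp _ _ k (r' + 1) (F B)) => // j.
rewrite /xu; case: (@split_ordP r 1 j) => a ->.
  by apply: unif_smooth_eq (unif_smoothW (unif_smooth_state a)) => s t; apply/esym; exact: (@col_mxEu R r 1 1).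
by apply: unif_smooth_eq unif_smooth_control => s t; apply/esym; rewrite (@col_mxEd R r 1 1) ord1 mxE eqxx.
Qed.

Lemma family_quadrature_error : (0 < k)%N -> exists C : R, 0 <= C /\
  forall s N, (k < N)%N ->
    `|J B (interp_state (Y s)) (interp_control B (Y s)) -
      (\sum_(j < N.+1) F B (xu (interp_state (Y s) (t_ j)) (interp_control B (Y s) (t_ j)))
         * lgl_weight R j + E B (interp_state (Y s) (-1)) (interp_state (Y s) 1))| <=
    C / N%:R ^+ k.
Proof.
move=> k0; have [C [C0 hC]] := quadrature_error k0 unif_smooth_cost.
exists C; split => // s N kN; rewrite /J opprD addrACA subrr addr0.
exact: (hC s N kN).
Qed.

End UniformFamilies.

(** * The optimal trajectory as a chain *)

Section Caratheodory.
Import HBSimple.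
Variable R : realType.

(** Measurability of a composition with a function continuous in its second
    argument: clear when v is simple, and v is a pointwise limit of simple
    functions. *)
Lemma caratheodory_measurable d (T : measurableType d) (D : set T) (H : T -> R -> R) (v : T -> R) :
  measurable D -> (forall u, measurable_fun D (fun t => H t u)) ->
  (forall t, D t -> continuous (H t)) -> measurable_fun D v ->
  measurable_fun D (fun t => H t (v t)).
Proof.
move=> mD mH cH mv.
have mv' : measurable_fun D (EFin \o v) by exact/measurable_EFinP.
have [s hs] := approximation_sfun mD mv'.
pose q n : T -> R := HBSimple.SimpleFun.sort (s n).
apply: (@measurable_fun_cvg _ T R D (fun n t => H t (q n t))); last first.
  move=> t Dt; apply: continuous_cvg; first exact: cH.
  by have /fine_cvgP[_] := hs t Dt.
move=> n.
have fq : finite_set (range (q n)) by exact: fimfunP.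
have -> : (fun t => H t (q n t)) =
    (fun t => \sum_(y <- finmap.enum_fset (fset_set (range (q n)))) H t y * \1_(q n @^-1` [set y]) t).
  apply/funext => t; rewrite (bigD1_seq (q n t))/= ?finmap.fset_uniq//; last first.
    by rewrite in_fset_set ?inE//; exists t.
  rewrite indicE mem_set//= mulr1 big1 ?addr0// => y ys.
  by rewrite indicE memNset ?mulr0//= => e; rewrite e eqxx in ys.
apply: measurable_sum => y; apply: measurable_funM; first exact: mH.
by apply: measurable_indic; exact: measurable_funPTI.
Qed.

End Caratheodory.

Section WeakDerivatives.
Variable R : realType.
Local Notation mu := (@lebesgue_measure R).
Implicit Types (x y h : R -> R) (t : R).

Lemma integrable_I_eq x y : (forall t, -1 <= t <= 1 -> x t = y t) ->
  integrable_I x -> integrable_I y.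
Proof.
move=> xy; apply: eq_integrable; first exact: measurable_itv.
by move=> t; rewrite inE/= in_itv/= => /xy ->.
Qed.

Lemma weak_deriv_eq k x y h : (forall t, -1 <= t <= 1 -> x t = y t) ->
  weak_deriv k x h -> weak_deriv k y h.
Proof.
move=> xy [ix ih hk]; split => //; first exact: integrable_I_eq ix.
move=> phi tp; rewrite -(hk phi tp); apply: eq_itg => t t1.
by rewrite xy.
Qed.

Lemma weak_deriv1_prim x y : {within `[-1, 1], continuous x} ->
  {within `[-1, 1], continuous y} -> weak_deriv 1 x y ->
  forall t, -1 <= t <= 1 -> x t = x (-1) + itg y (-1) t.
Proof.
move=> cx cy xy t t1; have [C [_ hC]] := cont_bounded cy.
have [|X [[_ _ cX] X1 X0]] := weak_deriv_chain (m := 1) isT cx xy; first by exists C.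
rewrite -X0// (cX 0%N)// X1 X0//; lra.
Qed.

Lemma weak_deriv1_uniq x y z : weak_deriv 1 x y -> weak_deriv 1 x z ->
  {ae mu, forall t, t \in `[-1, 1] -> y t = z t}.
Proof.
move=> [_ iy hy] [_ iz hz].
have iyz := integrable_IB iy iz.
have : {ae mu, forall t, t \in `[-1, 1] -> y t - z t = 0}.
  apply: ae_prim_eq0 => //; apply: orth_test_prim_eq0 => // phi tp.
  have cphi := derive1n_within (k := 0%N) tp.
  rewrite (@eq_itg _ _ (fun t => y t * phi t - z t * phi t)); last by move=> t _; rewrite mulrBl.
  rewrite itgB ?lexx//; [|exact: integrable_IM|exact: integrable_IM].
  have := hy _ tp; rewrite hz// => /eqP; rewrite !expr1 !mulN1r eqr_opp => /eqP.
  by rewrite /itg => ->; rewrite subrr.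
apply: filterS; first exact: (ae_filter_ringOfSetsType mu).
by move=> t ht t1; apply/eqP; rewrite -subr_eq0 ht.
Qed.

Lemma chain_lipschitz m (X : nat -> R -> R) j : chain m X -> (j < m)%N -> exists U : R, 0 <= U /\
  forall a b : R, -1 <= a -> a <= b -> b <= 1 -> `|X j b - X j a| <= U * (b - a).
Proof.
move=> cX jm; have [U [U0 hU]] := chain_bounded cX jm.
exists U; split => // a b a1 ab b1; have [_ _ Xe] := cX.
rewrite (Xe _ jm b) ?(le_trans a1 ab)// (Xe _ jm a) ?a1 ?(le_trans ab)//.
rewrite opprD addrACA subrr add0r itg_prim_sub ?(chain_int cX)//.
apply: itg_norm_le => //; [exact: (chain_int cX)|move=> t /andP[ta tb]; apply: hU; by rewrite (le_trans a1)//= (le_trans tb)].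
exact: (chain_int cX).
Qed.

(** A function X with Lipschitz constant U is the difference of the
    nondecreasing functions X + U t and U t. *)
Lemma chain_BV m (X : nat -> R -> R) j : chain m X -> bounded_variation (-1) 1 (X m) -> (j <= m)%N ->
  bounded_variation (-1) 1 (X j).
Proof.
move=> cX BVm; rewrite leq_eqVlt => /predU1P[->//|jm].
have [U [U0 hU]] := chain_lipschitz cX jm.
pose f t := X j t + U * t; pose l t := U * t.
have -> : X j = f \+ (\- l) by apply/funext => t; rewrite /f /l /=; ring.
have m11 : -1 < 1 :> R by lra.
have itv s : s \in `[-1, 1] -> -1 <= s <= 1 by rewrite in_itv.
apply: bounded_variationD => //; last apply: bounded_variationN; apply: nondecreasing_bounded_variation.
  move=> s t /itv/andP[s1 _] /itv/andP[_ t1] st; rewrite /f.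
  have := hU s t s1 st t1; rewrite ler_norml => /andP[h _]; move: h; rewrite mulrBr.
  by move: (U * t) (U * s) => a b; lra.
by move=> s t _ _ st; rewrite /l ler_wpM2l.
Qed.

End WeakDerivatives.

Section OptimalTrajectory.
Variables (R : realType) (r' : nat) (B : problemB R r').
Local Notation r := r'.+1.
Local Notation mu := (@lebesgue_measure R).
Variables (xs : R -> 'cV[R]_r) (us : R -> R).
Hypothesis tr : trajectory B xs us.

Lemma trajectory_component (i : 'I_r) : {within `[-1, 1], continuous (fun t => xs t i 0)}.
Proof.
have [cx _ _ _ _] := tr => t.
exact: (continuous_comp (cx t) (@coord_continuous R r 1 i 0 (xs t))).
Qed.

Arguments trajectory_component : clear implicits.

Lemma trajectory_comp (k : 'cV[R]_r -> R) : continuous k ->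
  {within `[-1, 1], continuous (fun t => k (xs t))}.
Proof.
have [cx _ _ _ _] := tr => ck t.
exact: (continuous_comp (cx t) (ck (xs t))).
Qed.

Variables (m : nat) (h : R -> R).
Hypothesis m0 : (0 < m)%N.
Hypothesis wh : weak_deriv m (fun t => xs t ord_max 0) h.
Hypothesis bh : bounded_variation (-1) 1 h.

(** One chain holds the state components, followed by the derivatives of the
    last one: the r state components are its first r members, and W_r agrees
    almost everywhere with the right-hand side of the last equation. *)
Lemma trajectory_chain : exists W : nat -> R -> R,
  [/\ chain (r' + m) W, W (r' + m)%N = h,
      forall (i : 'I_r) (t : R), -1 <= t <= 1 -> W i t = xs t i 0 &
      {ae mu, forall t, t \in `[-1, 1] -> W r t = f B (xs t) + g B (xs t) * us t}].
Proof.
have [_ _ tx tr_last _] := tr.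
have [w hw] := BV_varies bh.
have [|X [cX Xm X0]] := weak_deriv_chain m0 (trajectory_component ord_max) wh.
  by exists (`|h (-1)| + (w 1 - w (-1))); exact: varies_bounded.
pose W j := if (j < r')%N then (fun t => xs t (inord j) 0) else X (j - r')%N.
have WE (i : 'I_r) t : -1 <= t <= 1 -> W i t = xs t i 0.
  move=> t1; rewrite /W; case: ifPn => [_|]; first by rewrite inord_val.
  rewrite -leqNgt => ri; have e : i = ord_max by apply/val_inj/eqP; rewrite eqn_leq ri -ltnS ltn_ord.
  by rewrite e subnn X0.
exists W; split => //.
- have [iX bX eX] := cX; split.
  + by rewrite /W ifN ?addKn// -leqNgt leq_addr.
  + by rewrite /W ifN ?addKn// -leqNgt leq_addr.
  move=> j jm t t1; have [jr|jr] := ltnP j r'; last first.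
    rewrite /W !ifN -?leqNgt//; last exact: leqW.
    rewrite subSn//; apply: eX => //; lia.
  have j1 : (inord j.+1 : 'I_r) = (inord j : 'I_r).+1 :> nat by rewrite !inordK//; lia.
  have m1 : -1 <= (-1 : R) <= 1 by lra.
  have e := weak_deriv1_prim (trajectory_component (inord j)) (trajectory_component (inord j.+1)) (tx _ _ j1) t1.
  have jj : W j = W (inord j : 'I_r) by rewrite inordK//; lia.
  have jj1 : W j.+1 = W (inord j.+1 : 'I_r) by rewrite inordK//; lia.
  rewrite jj jj1 !WE// e; congr (_ + _); apply: eq_itg => s /andP[s0 s1].
  by rewrite WE// s0 (le_trans s1)//; case/andP: t1.
- by rewrite /W ifN ?addKn ?Xm// -leqNgt leq_addr.
have -> : W r = X 1%N by rewrite /W ifN ?subSn ?subnn// -leqNgt.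
apply: weak_deriv1_uniq tr_last; apply: weak_deriv_eq X0 _.
exact: (chain_weak_deriv cX m0).
Qed.

End OptimalTrajectory.

(** * Costs of polynomial trajectories and of the optimal one *)

Lemma lipschitz_bound (R : realType) (V W : normedModType R) (f : V -> W) : lipschitz f ->
  exists K : R, 0 <= K /\ forall x y, `|f x - f y| <= K * `|x - y|.
Proof.
move=> [M [_ hM]]; exists (`|M| + 1); split; first by rewrite addr_ge0.
move=> x y; have := hM (`|M| + 1); rewrite ltr_pwDr ?ltr01 ?ler_norm// => /(_ isT (x, y)).
by apply.
Qed.

Lemma xu_dist (R : realType) r' (x y : 'cV[R]_r'.+1) (u v e : R) : 0 <= e ->
  (forall i, `|x i 0 - y i 0| <= e) -> `|u - v| <= e -> `|xu x u - xu y v| <= e.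
Proof.
move=> e0 hx hu; apply: mx_norm_leP => // i j; rewrite mxE [X in _ + X]mxE (ord1 j).
case: (@split_ordP r'.+1 1 i) => a ->; rewrite /xu ?col_mxEu ?col_mxEd//.
by rewrite (ord1 a) !mxE eqxx.
Qed.

Section PolynomialTrajectories.
Variables (R : realType) (r' : nat) (B : problemB R r').
Local Notation r := r'.+1.
Hypothesis cf : continuous (f B).
Hypothesis cg : continuous (g B).
Implicit Types p : 'I_r -> {poly R}.

Lemma interp_state_cont p : continuous (interp_state p).
Proof.
move=> t; apply: cvg_col => i.
rewrite mxE (_ : (fun z => _) = horner (p i)); first exact: continuous_horner.
by apply/funext => z; rewrite mxE.
Qed.

Lemma interp_control_cont p : continuous (interp_control B p).
Proof.
move=> t; have ck (k : 'cV[R]_r -> R) : continuous k -> {for t, continuous (fun s => k (interp_state p s))}.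
  by move=> kc; exact: (continuous_comp (@interp_state_cont p t) (kc _)).
have cV : {for t, continuous (fun s => (g B (interp_state p s))^-1)}.
  by apply: continuousV; [exact: g_neq0|exact: ck].
exact: (continuousM (continuousB (@continuous_horner R _ t) (ck _ cf)) cV).
Qed.

Lemma interp_controlE p t :
  f B (interp_state p t) + g B (interp_state p t) * interp_control B p t = (p ord_max)^`().[t].
Proof. by rewrite /interp_control mulrC divfK ?g_neq0// addrC subrK. Qed.

Lemma poly_trajectory p : (forall i j : 'I_r, j = i.+1 :> nat -> (p i)^`() = p j) ->
  interp_state p (-1) = x0 B -> trajectory B (interp_state p) (interp_control B p).
Proof.
move=> dp p0.
have wp i : weak_deriv 1 (fun t => interp_state p t i 0) (horner (p i)^`()).
  have := chain_weak_deriv (chain_poly 1 (p i)) (leqnn 1).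
  apply: weak_deriv_eq => t _; by rewrite mxE derivn0.
split => //.
- by apply: continuous_subspaceT => t; exact: interp_state_cont.
- apply: subspace_continuous_measurable_fun; first exact: measurable_itv.
  by apply: continuous_subspaceT => t; exact: interp_control_cont.
- move=> i j ij; have := wp i; rewrite (dp i j ij).
  by have -> : (fun t => interp_state p t j 0) = horner (p j) by apply/funext => t; rewrite mxE.
- have := wp ord_max; congr (weak_deriv 1 _ _).
  by apply/funext => t; rewrite interp_controlE.
Qed.

End PolynomialTrajectories.

Lemma within_contB (R : realType) (f g : R -> R) : {within `[-1, 1], continuous f} ->
  {within `[-1, 1], continuous g} -> {within `[-1, 1], continuous (fun t => f t - g t)}.
Proof. by move=> cf cg x; exact: (continuousB (cf x) (cg x)). Qed.

Lemma within_comp (R : realType) n (k : 'cV[R]_n -> R) (y : R -> 'cV[R]_n) :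
  {within `[-1, 1], continuous y} -> continuous k ->
  {within `[-1, 1], continuous (fun t => k (y t))}.
Proof. by move=> cy ck t; exact: (continuous_comp (cy t) (ck (y t))). Qed.

Lemma comp_cont (R : realType) n (k : 'cV[R]_n -> R) (y : R -> 'cV[R]_n) :
  continuous y -> continuous k -> continuous (fun t => k (y t)).
Proof. by move=> cy ck t; exact: (continuous_comp (cy t) (ck (y t))). Qed.

Section OptimalCost.
Variables (R : realType) (r' : nat) (B : problemB R r').
Local Notation r := r'.+1.
Local Notation mu := (@lebesgue_measure R).
Variables (xs : R -> 'cV[R]_r) (us v : R -> R).
Hypothesis tr : trajectory B xs us.
Hypothesis cf : continuous (f B).
Hypothesis cg : continuous (g B).
Hypothesis cF : continuous (F B).
Hypothesis cv : {within `[-1, 1], continuous v}.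
Hypothesis aev : {ae mu, forall t, t \in `[-1, 1] -> v t = f B (xs t) + g B (xs t) * us t}.

(** The last equation determines the control from the state and the derivative
    v of its last component.  As v is continuous, this is a continuous
    representative of the optimal control, which itself is only measurable. *)
Definition smooth_control t := (v t - f B (xs t)) / g B (xs t).

Lemma smooth_control_ae : {ae mu, forall t, t \in `[-1, 1] -> us t = smooth_control t}.
Proof.
apply: filterS aev; first exact: (ae_filter_ringOfSetsType mu).
by move=> t ht t1; rewrite /smooth_control ht// addrAC subrr add0r mulrC mulKf// g_neq0.
Qed.

Lemma smooth_control_cont : {within `[-1, 1], continuous smooth_control}.
Proof.
apply: within_contM.
  by apply: within_contB => //; exact: (trajectory_comp tr cf).
apply: (trajectory_comp tr (k := fun x => (g B x)^-1)) => x.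
by apply: continuousV; [exact: g_neq0|exact: cg].
Qed.

Lemma cost_cont (u : R -> R) : {within `[-1, 1], continuous u} ->
  {within `[-1, 1], continuous (fun t => F B (xu (xs t) (u t)))}.
Proof.
move=> cu; suff cxu : {within `[-1, 1], continuous (fun t => xu (xs t) (u t))}.
  exact: within_comp cxu cF.
move=> t; apply: cvg_col => i; rewrite /xu; case: (@split_ordP r 1 i) => a ->.
  rewrite col_mxEu (_ : (fun z => _) = (fun z => xs z a 0)); last first.
    by apply/funext => z; rewrite col_mxEu.
  exact: (@trajectory_component _ _ _ _ _ tr a t).
rewrite col_mxEd ord1 mxE eqxx (_ : (fun z => _) = u); first exact: cu.
by apply/funext => z; rewrite col_mxEd mxE eqxx.
Qed.

(** Changing the control on a null set does not change the cost, provided that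
    both integrands are measurable; along the given control, which is merely
    measurable, this is [caratheodory_measurable]. *)
Lemma J_smooth_control : J B xs us =
  itg (fun t => F B (xu (xs t) (smooth_control t))) (-1) 1 + E B (xs (-1)) (xs 1).
Proof.
have [_ mus _ _ _] := tr; have mI : measurable (`[-1, 1]%classic : set (measurableTypeR R)) := measurable_itv _.
rewrite /J; congr (_ + _); rewrite /itg /Rintegral; congr fine.
apply: ae_eq_integral => //.
- apply/measurable_EFinP.
  apply: (@caratheodory_measurable R _ (measurableTypeR R) _ (fun t u => F B (xu (xs t) u))) => //.
  + move=> u; apply: subspace_continuous_measurable_fun => //.
    by apply: cost_cont => x; exact: cst_continuous.
  + move=> t _; suff cxu : continuous (fun u => xu (xs t) u).
      exact: (comp_cont cxu cF).
    move=> u; apply: cvg_col => i; rewrite /xu; case: (@split_ordP r 1 i) => a ->.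
      rewrite col_mxEu (_ : (fun z => _) = cst (xs t a 0)); first exact: cvg_cst.
      by apply/funext => z; rewrite col_mxEu.
    rewrite col_mxEd ord1 mxE eqxx (_ : (fun z => _) = id); first exact: cvg_id.
    by apply/funext => z; rewrite col_mxEd mxE eqxx.
- apply/measurable_EFinP; apply: subspace_continuous_measurable_fun => //.
  by apply: cost_cont; exact: smooth_control_cont.
apply: filterS smooth_control_ae; first exact: (ae_filter_ringOfSetsType mu).
by move=> t ht /= t1; rewrite ht//; move: t1; rewrite in_itv.
Qed.

End OptimalCost.

(** * Polynomial competitors close to the optimal trajectory *)

Section Approximants.
Variables (R : realType) (r' : nat) (B : problemB R r').
Local Notation r := r'.+1.
Local Notation t_ k := (lgl_node R k).
Variables (xs : R -> 'cV[R]_r) (us : R -> R).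
Hypothesis tr : trajectory B xs us.
Variables (m k : nat) (W : nat -> R -> R) (w : R -> R) (S : R).
Hypothesis km : (k.+1 < m)%N.
Hypothesis cW : chain (r' + m) W.
Hypothesis WE : forall (i : 'I_r) (t : R), -1 <= t <= 1 -> W i t = xs t i 0.
Local Notation d := (r' + k.+1)%N.
Hypothesis vw : varies w (W d.+1).
Hypothesis hS : forall K, \sum_(n < K) `|fun_lcoef (W d) n| <= S.
Hypothesis fk : Ck k (f B).
Hypothesis gk : Ck k (g B).
Hypothesis Fk : Ck k (F B).

(** With m1 = k + 1, the derivative of order m1 of the last state component is
    W_d.  Its Legendre series is truncated at the number of terms appearing in
    the spectral constraint, which makes the degree of the first component at
    most N. *)
Definition approximant (N : nat) (i : 'I_r) : {poly R} :=
  lift_chain W d (legendre_sum (W d) (N.+2 - r - k.+1)) (d - i).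

Local Notation hat := approximant.

Let dl : (d < r' + m)%N. Proof. by lia. Qed.

Lemma size_approximant N i : (r + k.+1 + 1 < N)%N -> (size (hat N i) <= N.+1)%N.
Proof.
move=> rN; apply: leq_trans (size_lift _ _ _ _) _.
apply: leq_trans (leq_add (size_legendre_sum _ _) (leqnn _)) _; lia.
Qed.

Lemma approximant_deriv N (i j : 'I_r) : j = i.+1 :> nat -> (hat N i)^`() = hat N j.
Proof.
move=> ij; rewrite /hat; have -> : (d - i = (d - j).+1)%N by have := ltn_ord j; lia.
exact: deriv_lift.
Qed.

Lemma approximant_last_derivn N j : (j <= k.+1)%N ->
  (hat N ord_max)^`(j) = lift_chain W d (legendre_sum (W d) (N.+2 - r - k.+1)) (k.+1 - j).
Proof.
by move=> jk; rewrite /hat derivn_lift; [congr lift_chain|]; rewrite /=; lia.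
Qed.

Lemma approximant_init N : interp_state (hat N) (-1) = xs (-1).
Proof.
apply/colP => i; rewrite mxE -WE; last lra.
have ir := ltn_ord i; rewrite /hat; have -> : (d - i = (d - i.+1).+1)%N by lia.
rewrite lift_init; congr (W _ _); lia.
Qed.

Lemma approximant_last_init N j : (0 < j <= k)%N ->
  (hat N ord_max)^`(j).[-1] = W (r' + j)%N (-1).
Proof.
move=> /andP[j0 jk]; rewrite approximant_last_derivn; last by lia.
have -> : (k.+1 - j = (k - j).+1)%N by lia.
rewrite lift_init; congr (W _ _); lia.
Qed.

Lemma approximant_family : uniform_family k.+1 approximant.
Proof.
have [j jd|C hC] := @common_bound R nat (fun _ t => -1 <= t <= 1)
    (fun j N t => (lift_chain W d (legendre_sum (W d) (N.+2 - r - k.+1)) j).[t]) d.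
  have [C [_ hC]] := lift_part_bounded hS jd; exists C => N t; exact: hC.
split.
- by move=> N i j; exact: approximant_deriv.
- by exists C => i N t t1; apply: hC => //; lia.
- by exists C => j N t jk t1; rewrite approximant_last_derivn//; apply: hC => //; lia.
Qed.

Lemma approximant_spectral N n : (r + k.+1 + 1 < N)%N -> (n < N.+2 - r - k.+1)%N ->
  spectral_coef k.+1 (\matrix_(i < r, l < N.+1) (hat N i).[t_ l]) n = fun_lcoef (W d) n.
Proof.
move=> rN nN; have sN := size_approximant ord_max rN.
have dE : (hat N ord_max)^`(k.+1) = legendre_sum (W d) (N.+2 - r - k.+1).
  by rewrite approximant_last_derivn// subnn.
have N0 : (0 < N)%N by lia.
have E : (row ord_max (\matrix_(i < r, l < N.+1) (hat N i).[t_ l]))^T = nodal N (hat N ord_max).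
  by apply/colP => l; rewrite !mxE.
rewrite (spectral_lcoef N0 E sN); last first.
  by rewrite dE; have := size_legendre_sum (W d) (N.+2 - r - k.+1); move: (size _) => s; lia.
by rewrite dE poly_lcoef_sum.
Qed.

Let cf := Ck_continuous fk.
Let cg := Ck_continuous gk.
Let cF := Ck_continuous Fk.

Lemma approximant_feasible (b : bounds R r') (C : R) N : (r + k.+1 + 1 < N)%N ->
  (forall i, blo b i 0 <= - C) -> (forall i, C <= bhi b i 0) ->
  (forall j, (1 <= j <= k)%N -> bjlo b j <= - C) ->
  (forall j, (1 <= j <= k)%N -> C <= bjhi b j) -> S <= bd b ->
  (forall i t, -1 <= t <= 1 -> `|(hat N i).[t]| <= C) ->
  (forall t, -1 <= t <= 1 -> `|interp_control B (hat N) t| <= C) ->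
  (forall j, (j <= r' + k)%N -> `|W j (-1)| <= C) ->
  feasibleBN B k.+1 b (\matrix_(i < r, l < N.+1) (hat N i).[t_ l])
    (\row_l interp_control B (hat N) (t_ l)).
Proof.
move=> rN lo hi jlo jhi bdS xC uC WC; have N0 : (0 < N)%N by lia.
set x := \matrix_(i, l) _.
have xrow i : (row i x)^T = nodal N (hat N i) by apply/colP => l; rewrite !mxE.
have xcol l : col l x = interp_state (hat N) (t_ l) by apply/colP => i; rewrite !mxE.
have sN i : (size (hat N i) <= N.+1)%N by exact: size_approximant.
split.
- split=> [i j ij|l].
    by rewrite !xrow lgl_D_nodal// (approximant_deriv N ij).
  by rewrite xrow lgl_D_nodal// mxE xcol mxE interp_controlE.
- by rewrite xcol lgl_node0// approximant_init; have [] := tr.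
- move=> l i; rewrite xcol mxE.
  suff : - C <= xu (interp_state (hat N) (t_ l)) (interp_control B (hat N) (t_ l)) i 0 <= C.
    by move=> /andP[h1 h2]; rewrite (le_trans (lo i))// (le_trans _ (hi i)).
  rewrite -ler_norml /xu; case: (@split_ordP r 1 i) => a ->; rewrite ?col_mxEu ?col_mxEd.
    by rewrite mxE xC// lgl_node_itv.
  by rewrite ord1 mxE eqxx uC// lgl_node_itv.
- move=> j /= j1; rewrite xrow lgl_D_nodal_iter// mxE lgl_node0// approximant_last_init//.
  have : - C <= W (r' + j)%N (-1) <= C by rewrite -ler_norml WC//; lia.
  by move=> /andP[h1 h2]; rewrite (le_trans (jlo _ j1))// (le_trans _ (jhi _ j1)).
- apply: le_trans bdS; apply: le_trans (hS (N.+2 - r - k.+1)); apply: ler_sum => n _.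
  by rewrite approximant_spectral.
Qed.

(** k integrations of the truncated series give the rate N^-k for W_r, the
    derivative of the last component; the r further integrations keep it. *)
Lemma approximant_error : (0 < k)%N -> exists C : R, 0 <= C /\
  forall N (t : R), (2 * (r + 2 * k.+1) <= N)%N -> -1 <= t <= 1 ->
    (forall i, `|xs t i 0 - (hat N i).[t]| <= C / N%:R ^+ k) /\
    `|W r t - (hat N ord_max)^`().[t]| <= C / N%:R ^+ k.
Proof.
move=> k0; have S0 : 0 <= S by have := hS 0; rewrite big_ord0.
exists (2 ^+ r * (S * 2 ^+ k)); split; first by rewrite !mulr_ge0 ?exprn_ge0.
move=> N t NN t1; set K := (N.+2 - r - k.+1)%N.
have N0 : (0 : R) < N%:R by rewrite ltr0n; lia.
have e0 : 0 <= S * 2 ^+ k / N%:R ^+ k by rewrite !mulr_ge0 ?invr_ge0 ?exprn_ge0// ltW.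
have base s : -1 <= s <= 1 ->
    `|W (d - k)%N s - (lift_chain W d (legendre_sum (W d) K) k).[s]| <= S * 2 ^+ k / N%:R ^+ k.
  move=> s1; apply: (le_trans (lift_part_error cW dl vw hS _ _ s1)); rewrite /K; [lia|lia|].
  have hb : (K - k).+1%:R^-1 <= 2 / N%:R :> R.
    rewrite ler_pdivlMr// mulrC ler_pdivrMr ?ltr0n// -natrM ler_nat /K; lia.
  rewrite -mulrA -exprVn -exprMn ler_wpM2l//; apply: lerXn2r => //; rewrite nnegrE ?invr_ge0//.
set e := S * 2 ^+ k / N%:R ^+ k in e0 base.
have -> : 2 ^+ r * (S * 2 ^+ k) / N%:R ^+ k = 2 ^+ r * e by rewrite /e; ring.
have h21 : 1 <= 2 :> R by lra.
split=> [i|].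
  rewrite -WE// /hat -/K; have ir := ltn_ord i.
  have -> : (d - i = k + (r - i))%N by lia.
  have ijd : (k + (r - i) <= d)%N by lia.
  have := lift_error_iter cW dl (P := legendre_sum (W d) K) ijd base t1.
  have -> : (d - (k + (r - i)) = i)%N by lia.
  move=> h; apply: (le_trans h); rewrite ler_wpM2r// ler_weXn2l//; lia.
have := approximant_last_derivn N (j := 1) isT; rewrite derivn1 subn1 /= => ->.
rewrite -/K; have -> : r = (d - k)%N by lia.
by apply: (le_trans (base _ t1)); rewrite ler_peMl// exprn_ege1.
Qed.

Hypothesis aeW : {ae @lebesgue_measure R, forall t, t \in `[-1, 1] ->
  W r t = f B (xs t) + g B (xs t) * us t}.
Hypothesis fL : lipschitz (f B).
Hypothesis gL : lipschitz (g B).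
Hypothesis FL : lipschitz (F B).
Hypothesis EL : lipschitz (E B (x0 B)).

(** Along the approximants 1/g is bounded, so that the errors of the state and
    of the derivative of its last component carry over linearly to the
    control.  The end cost is compared at the same initial state x0. *)
Lemma approximant_cost : (0 < k)%N -> exists C : R, 0 <= C /\
  forall N, (2 * (r + 2 * k.+1) <= N)%N ->
    J B (interp_state (hat N)) (interp_control B (hat N)) <= J B xs us + C / N%:R ^+ k.
Proof.
move=> k0; have [Ce [Ce0 hCe]] := approximant_error k0.
have [Lf [Lf0 hLf]] := lipschitz_bound fL.
have [Lg [Lg0 hLg]] := lipschitz_bound gL.
have [LF [LF0 hLF]] := lipschitz_bound FL.
have [LE [LE0 hLE]] := lipschitz_bound EL.
have [G hG] := state_g_inv_bounded approximant_family gk.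
have cWr : {within `[-1, 1], continuous (W r)} by apply: (chain_cont cW); lia.
pose ut := smooth_control B xs (W r).
have cu : {within `[-1, 1], continuous ut} by exact: (smooth_control_cont tr cf cg cWr).
have [U [U0 hU]] := cont_bounded cu.
pose Cu := `|G| * (1 + Lf + U * Lg).
have Cu0 : 0 <= Cu by rewrite mulr_ge0// !addr_ge0// mulr_ge0.
exists ((2 * (LF * (1 + Cu)) + LE) * Ce); split.
  by rewrite mulr_ge0// addr_ge0// !mulr_ge0// addr_ge0.
move=> N NN; set e := Ce / N%:R ^+ k.
have e0 : 0 <= e by rewrite divr_ge0// exprn_ge0.
have dist t : -1 <= t <= 1 -> `|interp_state (hat N) t - xs t| <= e.
  move=> t1; apply: mx_norm_leP => // i j; rewrite (ord1 j) mxE [X in _ + X]mxE mxE distrC.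
  exact: (hCe N t NN t1).1.
have udist t : -1 <= t <= 1 -> `|interp_control B (hat N) t - ut t| <= Cu * e.
  move=> t1; set y := interp_state (hat N) t; set p' := (hat N ord_max)^`().[t].
  have gy : g B y != 0 by exact: g_neq0.
  have uE : ut t * g B (xs t) = W r t - f B (xs t) by rewrite divfK// g_neq0.
  have -> : interp_control B (hat N) t - ut t =
      (g B y)^-1 * ((p' - W r t) - (f B y - f B (xs t)) - ut t * (g B y - g B (xs t))).
    rewrite [ut t * _]mulrBr uE /interp_control -/y -/p'; field; exact: gy.
  rewrite normrM /Cu -mulrA ler_pM//.
    by apply: le_trans (ler_norm G); exact: hG.
  rewrite !mulrDl mul1r; apply: (le_trans (ler_normB _ _)); apply: lerD.
    apply: (le_trans (ler_normB _ _)); apply: lerD; first by rewrite distrC; exact: (hCe N t NN t1).2.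
    by apply: (le_trans (hLf _ _)); rewrite ler_wpM2l// dist.
  rewrite normrM -mulrA ler_pM ?hU//.
  by apply: (le_trans (hLg _ _)); rewrite ler_wpM2l// dist.
have Fdist t : -1 <= t <= 1 ->
    F B (xu (interp_state (hat N) t) (interp_control B (hat N) t)) - F B (xu (xs t) (ut t)) <= LF * ((1 + Cu) * e).
  move=> t1; apply: (le_trans (ler_norm _)); apply: (le_trans (hLF _ _)); rewrite ler_wpM2l//.
  apply: xu_dist; first by rewrite mulr_ge0// addr_ge0.
    move=> i; rewrite mxE distrC; apply: (le_trans ((hCe N t NN t1).1 i)).
    by rewrite ler_peMl// lerDl.
  by apply: (le_trans (udist t t1)); rewrite ler_wpM2r// lerDr.
rewrite (J_smooth_control tr cf cg cF cWr aeW) /J -/ut approximant_init.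
have [_ _ _ _ ->] := tr.
have i1 : integrable_I (fun t => F B (xu (xs t) (ut t))).
  by apply: cont_integrable; exact: (cost_cont tr cF cu).
have i2 : integrable_I (fun t => F B (xu (interp_state (hat N) t) (interp_control B (hat N) t))).
  have := unif_smooth_cost approximant_family fk gk Fk => /(unif_smooth_continuous (i := N) k0).
  exact: cont_integrable.
have h1 : itg (fun t => F B (xu (interp_state (hat N) t) (interp_control B (hat N) t))) (-1) 1
    - itg (fun t => F B (xu (xs t) (ut t))) (-1) 1 <= 2 * (LF * ((1 + Cu) * e)).
  have ic : integrable_I (fun=> LF * ((1 + Cu) * e)) by apply: cont_integrable => t; exact: cst_continuous.
  rewrite -itgB ?lexx//; apply: (@le_trans _ _ (itg (fun=> LF * ((1 + Cu) * e)) (-1) 1)).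
    by apply: le_itg; rewrite ?lexx//; exact: integrable_IB.
  apply: (le_trans (ler_norm _)); apply: (@le_trans _ _ (LF * ((1 + Cu) * e) * (1 - -1))).
    apply: itg_norm_le; rewrite ?lexx// => t _.
    by rewrite ger0_norm// !mulr_ge0// addr_ge0.
  by rewrite le_eqVlt; apply/orP; left; apply/eqP; ring.
have h2 : E B (x0 B) (interp_state (hat N) 1) - E B (x0 B) (xs 1) <= LE * e.
  apply: (le_trans (ler_norm _)); apply: (le_trans (hLE _ _)); rewrite ler_wpM2l// dist//.
  by rewrite lexx andbT; lra.
have -> : (2 * (LF * (1 + Cu)) + LE) * Ce / N%:R ^+ k = 2 * (LF * ((1 + Cu) * e)) + LE * e.
  by rewrite /e; ring.
move: h1 h2; rewrite /itg; move: (2 * _) (LE * e) => a b; lra.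
Qed.

End Approximants.

(** * Comparison of the costs *)

Section FeasibleCost.
Variables (R : realType) (r' : nat) (B : problemB R r') (k : nat) (b : bounds R r').
Local Notation r := r'.+1.

Lemma interpolant_family :
  uniform_family k.+1 (fun s : interpolant B k.+1 b => poly s).
Proof.
split; first by move=> s i j; exact: poly_deriv.
- exact: (@poly_all_bounded R r' B k.+1 b isT).
- by have [C hC] := @poly_last_bounded R r' B k.+1 b isT; exists C.
Qed.

Hypothesis fk : Ck k (f B).
Hypothesis gk : Ck k (g B).
Hypothesis Fk : Ck k (F B).

Lemma interpolant_cost_error : (0 < k)%N -> exists C : R, 0 <= C /\
  forall s : interpolant B k.+1 b,
    `|J B (interp_state (poly s)) (interp_control B (poly s)) - Jbar B (state s) (control s)|
    <= C / (deg s)%:R ^+ k.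
Proof.
move=> k0; have [C [C0 hC]] := family_quadrature_error interpolant_family fk gk Fk k0.
exists C; split => // s; have ks : (k < deg s)%N by have := deg_large s; lia.
have := hC s (deg s) ks; congr (`|_ - _| <= _); rewrite /Jbar; congr (_ + _).
  by apply: eq_bigr => l _; rewrite (interpolates_col _ (interp s)) poly_control.
by rewrite !(interpolates_col _ (interp s)) lgl_node0 ?lgl_node_max ?deg_gt0.
Qed.

Lemma interpolant_trajectory (s : interpolant B k.+1 b) :
  trajectory B (interp_state (poly s)) (interp_control B (poly s)).
Proof.
apply: poly_trajectory; [exact: Ck_continuous fk|exact: Ck_continuous gk| |exact: poly_init].
by move=> i j; exact: poly_deriv.
Qed.

End FeasibleCost.

Lemma chain_shift (R : realType) (a m : nat) (W : nat -> R -> R) :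
  chain (a + m) W -> chain m (fun j => W (a + j)%N).
Proof.
move=> [iW bW eW]; split => // j jm t t1; rewrite addnS; apply: eW => //; lia.
Qed.

Lemma powR_rate (R : realType) (k N : nat) (alpha C : R) : (0 < N)%N -> 0 <= C ->
  alpha <= k%:R -> C / N%:R ^+ k <= C / N%:R `^ alpha.
Proof.
move=> N0 C0 ak; have N0' : (0 : R) < N%:R by rewrite ltr0n.
rewrite ler_wpM2l// lef_pV2 ?posrE ?powR_gt0 ?exprn_gt0// -powR_mulrn ?ler0n//.
by apply: ler_powR => //; rewrite ler1n.
Qed.

(** The estimates of the approximant hold for N >= N2 only; the finitely many
    other values of N are absorbed in the constant. *)
Lemma eventual_rate (R : realType) (k N1 N2 : nat) (alpha C : R) (a : nat -> R) :
  (0 < N1)%N -> 0 <= C -> alpha <= k%:R -> (forall N, 0 <= a N) ->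
  (forall N, (N1 <= N)%N -> (N2 <= N)%N -> a N <= C / N%:R ^+ k) ->
  exists M : R, forall N, (N1 <= N)%N -> a N <= M / N%:R `^ alpha.
Proof.
move=> N10 C0 ak a0 large; pose D N := a N * N%:R `^ alpha.
have D0 N : 0 <= D N by rewrite mulr_ge0 ?powR_ge0.
exists (C + \sum_(N < N2) D N) => N hN.
have N0 : (0 < N)%N := leq_trans N10 hN.
have Na0 : 0 < N%:R `^ alpha :> R by rewrite powR_gt0// ltr0n.
have [hN2|hN2] := leqP N2 N.
  apply: (le_trans (large N hN hN2)); apply: (le_trans (powR_rate N0 C0 ak)).
  by rewrite ler_wpM2r ?invr_ge0 ?powR_ge0// lerDl sumr_ge0.
rewrite ler_pdivlMr// -/(D N) (bigD1 (Ordinal hN2))//= addrCA lerDl addr_ge0// sumr_ge0//.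
Qed.

Lemma cost_squeeze (R : realType) (Js JN JbN Jbhat Jhat a b c : R) :
  0 <= a -> 0 <= b -> 0 <= c ->
  Js <= JN -> `|JN - JbN| <= a -> JbN <= Jbhat -> `|Jhat - Jbhat| <= b -> Jhat <= Js + c ->
  `|Js - JN| <= a + b + c /\ `|Js - JbN| <= a + b + c.
Proof.
rewrite !ler_norml => a0 b0 c0 h1 /andP[h2 h2'] h3 /andP[h4 h4'] h5.
by split; apply/andP; split; lra.
Qed.

(* The state dimension is r = r'.+1. *)
Theorem theorem1 (R : realType) (r' : nat) (B : problemB R r')
    (xs : R -> 'cV[R]_r'.+1) (us : R -> R) (m m1 : nat)
    (hopt : optimalB B xs us)
    (hm : (3 <= m)%N)
    (hBV : exists h : R -> R,
       weak_deriv m (fun t => xs t ord_max 0) h /\ bounded_variation (-1) 1 h)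
    (hm1 : (1 <= m1 <= m.-1)%N)
    (hf : Ck m (f B)) (hg : Ck m (g B)) (hF : Ck m (F B))
    (hE : Ck m (E B (x0 B)))
    (hfL : lipschitz (f B)) (hgL : lipschitz (g B)) (hFL : lipschitz (F B))
    (hEL : lipschitz (E B (x0 B))) :
  exists b0 : bounds R r', forall b : bounds R r', beyond m1 b0 b ->
    contains_optimal m1 xs us b /\
    forall (alpha : R), 0 < alpha < m1%:R - 1 ->
    forall (N1 : nat), (r'.+1 + m1 + 1 < N1)%N ->
    forall (xb : forall N : nat, 'M[R]_(r'.+1, N.+1))
           (ub : forall N : nat, 'rV[R]_N.+1)
           (p : nat -> 'I_r'.+1 -> {poly R}),
      (forall N, (N1 <= N)%N -> optimalBN B m1 b (xb N) (ub N)) ->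
      (forall N, (N1 <= N)%N -> interpolates (xb N) (p N)) ->
      (exists M1 M2 : R, forall N, (N1 <= N)%N ->
         let err := M1 / (N - r'.+1 - m1 - 1)%:R ^+ (2 * m - 2 * m1 - 1)
                    + M2 / N%:R `^ alpha in
         `|J B xs us - J B (interp_state (p N)) (interp_control B (p N))|
           <= err /\
         `|J B xs us - Jbar B (xb N) (ub N)| <= err) /\
      (forall N, (N1 <= N)%N ->
         trajectory B (interp_state (p N)) (interp_control B (p N))).
Proof.
(* alpha < m1 - 1 = k, so that it suffices to prove the rate N^-k. *)
case: m1 hm1 => [//|k] /andP[_ km']; have km : (k.+1 < m)%N by lia.
have m0 : (0 < m)%N by lia.
have fk : Ck k (f B) by apply: Ck_le hf; lia.
have gk : Ck k (g B) by apply: Ck_le hg; lia.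
have Fk : Ck k (F B) by apply: Ck_le hF; lia.
have [h [wh bh]] := hBV; have [tr opt] := hopt.
have [W [cW Wm WE aeW]] := trajectory_chain tr m0 wh bh.
pose d := (r' + k.+1)%N.
have bW : bounded_variation (-1) 1 (W d.+1).
  by apply: (chain_BV cW); rewrite ?Wm// /d; lia.
have [w vw] := BV_varies bW.
have dl : (d < r' + m)%N by rewrite /d; lia.
have vi : integrable_I (W d.+1) by exact: (chain_int cW).
have yv t : -1 <= t <= 1 -> W d t = W d (-1) + itg (W d.+1) (-1) t.
  by have [_ _ eW] := cW; apply: eW.
have [S [S0 hS]] := fun_lcoef_summable vi vw yv.
have [j jm|CW hCW] := @common_bound R unit (fun _ t => -1 <= t <= 1) (fun j _ t => W j t) (r' + m).
  by have [U [_ hU]] := chain_bounded cW jm; exists U => _ t; exact: hU.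
have cWr : {within `[-1, 1], continuous (W r'.+1)} by apply: (chain_cont cW); lia.
have cf := Ck_continuous fk; have cg := Ck_continuous gk.
have [Cu [Cu0 hCu]] := cont_bounded (smooth_control_cont tr cf cg cWr).
pose hat N := approximant k W N : 'I_r'.+1 -> {poly R}.
have fam : uniform_family k.+1 hat := approximant_family km hS.
have [_ [Ch hCh] _] := fam.
have [Cc [Cc0 hCc]] := unif_smooth_bounded (unif_smooth_control fam fk gk).
(* One constant dominates the optimal trajectory, its control and derivatives,
   and the approximants with their controls for every N; it serves as a
   threshold for all the box constraints. *)
pose C := `|CW| + Cu + `|Ch| + Cc.
have CWC : CW <= C by rewrite /C; have := ler_norm CW; have := normr_ge0 Ch; lra.
have CuC : Cu <= C by rewrite /C; have := normr_ge0 CW; have := normr_ge0 Ch; lra.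
have ChC : Ch <= C by rewrite /C; have := ler_norm Ch; have := normr_ge0 CW; lra.
have CcC : Cc <= C by rewrite /C; have := normr_ge0 CW; have := normr_ge0 Ch; lra.
pose thr := 6 / Num.sqrt pi * (CW + fine (total_variation (-1) 1 (W d.+1))) * zeta (3 / 2) : R.
exists (Bounds (const_mx (- C)) (const_mx C) (fun=> - C) (fun=> C) (Num.max S thr)) => b.
move=> [/= blo' bhi' bjlo' bjhi' bd'].
have lo i : blo b i 0 < - C by have := blo' i; rewrite mxE.
have hi i : C < bhi b i 0 by have := bhi' i; rewrite mxE.
have itv (t : R) : t \in `[-1, 1] -> -1 <= t <= 1 by rewrite in_itv.
have inner (z l' h' : R) : `|z| <= C -> l' < - C -> C < h' -> l' < z < h'.
  rewrite ler_norml => /andP[z1 z2] hl hh; apply/andP; split.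
    exact: lt_le_trans hl z1.
  exact: le_lt_trans z2 hh.
have WC j t : (j <= r' + m)%N -> -1 <= t <= 1 -> `|W j t| <= C.
  by move=> jm t1; apply: le_trans CWC; exact: (hCW j tt t jm t1).
have wd j : (j <= m)%N -> weak_deriv j (fun t => xs t ord_max 0) (W (r' + j)%N).
  move=> jm; apply: weak_deriv_eq (chain_weak_deriv (chain_shift cW) jm) => t t1.
  by rewrite -WE//= addn0.
split.
  split.
  - move=> t i /itv t1; apply: inner => //; rewrite -WE//; apply: WC => //.
    by have := ltn_ord i; lia.
  - apply: filterS (smooth_control_ae aeW); first exact: (ae_filter_ringOfSetsType (@lebesgue_measure R)).
    move=> t ht t1; rewrite ht//; apply: inner => //.
    by apply: le_trans CuC; apply: hCu; exact: itv.
  - move=> j j1; exists (W (r' + j)%N); split.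
    + by apply: wd; move: j1 => /=; lia.
    + by apply: (chain_cont cW); move: j1 => /=; lia.
    + move=> t /itv t1; apply: inner; [|exact: bjlo'|exact: bjhi'].
      by apply: WC => //; move: j1 => /=; lia.
  exists (W d.+1), CW; split => //.
  - by have := wd k.+2; rewrite /d !addnS; apply; lia.
  - by move=> t /itv t1; apply: (hCW d.+1 tt t) => //; rewrite /d; lia.
  - by apply: le_lt_trans bd'; rewrite le_max lexx orbT.
move=> alpha /andP[al0 al1] N1 hN1 xb ub p hoptN hint.
have k0 : (0 < k)%N.
  by rewrite lt0n; apply/eqP => k0; move: al1; rewrite k0; lra.
have alk : alpha <= k%:R by move: al1; rewrite -natr1; lra.
have NL N : (N1 <= N)%N -> (r'.+1 + k.+1 + 1 < N)%N by move=> hN; exact: leq_trans hN1 hN.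
pose s N (hN : (N1 <= N)%N) : interpolant B k.+1 b :=
  Interpolant (NL N hN) (hoptN N hN).1 (hint N hN).
have tN N (hN : (N1 <= N)%N) := interpolant_trajectory fk gk (s N hN).
split; last by move=> N hN; exact: (tN N hN).
have [Ca [Ca0 hCa]] := interpolant_cost_error b fk gk Fk k0.
have [Cb [Cb0 hCb]] := family_quadrature_error fam fk gk Fk k0.
have [Cd [Cd0 hCd]] := approximant_cost tr km cW WE vw hS fk gk Fk aeW hfL hgL hFL hEL k0.
pose N2 := (2 * (r'.+1 + 2 * k.+1))%N.
pose JN N := J B (interp_state (p N)) (interp_control B (p N)).
pose JbN N := Jbar B (xb N) (ub N).
(* Both errors are treated at once through their maximum. *)
pose a N := Num.max `|J B xs us - JN N| `|J B xs us - JbN N|.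
have N10 : (0 < N1)%N by exact: leq_ltn_trans (leq0n _) hN1.
have Cs0 : 0 <= Ca + Cb + Cd by rewrite !addr_ge0.
have a0 N : 0 <= a N by rewrite le_max normr_ge0.
have [N hN hN2|M hM] := @eventual_rate R k N1 N2 alpha _ a N10 Cs0 alk a0; last first.
  exists 0, M => N hN /=; rewrite mul0r add0r.
  by have := hM N hN; rewrite ge_max => /andP[].
have kN : (k < N)%N by have := NL N hN; clear; lia.
have N0 : (0 < N)%N by exact: leq_ltn_trans (leq0n _) kN.
have Nk0 : 0 <= (N%:R ^+ k)^-1 :> R by rewrite invr_ge0 exprn_ge0.
pose xh := \matrix_(i < r'.+1, l < N.+1) (hat N i).[lgl_node R l].
pose uh := \row_(l < N.+1) interp_control B (hat N) (lgl_node R l).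
have opth : JbN N <= Jbar B xh uh.
  apply: (hoptN N hN).2; apply: (approximant_feasible tr km WE hS (C := C)) => //.
  - exact (NL N hN).
  - by move=> i; rewrite ltW.
  - by move=> i; rewrite ltW.
  - by move=> j j1; rewrite ltW// bjlo'.
  - by move=> j j1; rewrite ltW// bjhi'.
  - by apply: ltW; apply: le_lt_trans bd'; rewrite le_max lexx.
  - by move=> i t t1; apply: le_trans ChC; exact: hCh.
  - by move=> t t1; apply: le_trans CcC; exact: hCc.
  - by move=> j jk; apply: WC; [clear -jk km; lia|lra].
have E : Jbar B xh uh = \sum_(j < N.+1) F B (xu (interp_state (hat N) (lgl_node R j))
    (interp_control B (hat N) (lgl_node R j))) * lgl_weight R j
    + E B (interp_state (hat N) (-1)) (interp_state (hat N) 1).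
  have xcol l : col l xh = interp_state (hat N) (lgl_node R l).
    by apply/colP => i; rewrite !mxE.
  rewrite /Jbar !xcol lgl_node0// lgl_node_max//; congr (_ + _).
  by apply: eq_bigr => l _; rewrite xcol mxE.
have hatq := hCb N N kN; rewrite -E in hatq.
rewrite !mulrDl /a ge_max; apply/andP.
apply: (cost_squeeze _ _ _ (opt _ _ (tN N hN)) (hCa (s N hN)) opth hatq (hCd N hN2));
  exact: mulr_ge0.
Qed.
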